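(* In $\mathbb{C}[x,y,z]$ put $$f_1=x^3z+y^4,\qquad f_{13}=f_1^3\,y+x^{13},\qquad f_{49}=\frac{f_{13}^4-f_1^{13}}{x^3},$$ (where $f_{49}$ is a homogeneous polynomial of degree $49$), and let $C_{49,\mathrm{gen}}\subset\mathbb{P}^2$ be the complex projective plane curve of degree $49$ defined by $$f_{49,\mathrm{gen}}:=f_{49}+13\,f_{13}\,f_1^{9}=0.$$ Let $P=[0:0:1]$. Then $C_{49,\mathrm{gen}}$ is irreducible and rational, $\operatorname{Sing}(C_{49,\mathrm{gen}})=\{P\}$, the number of branches of $C_{49,\mathrm{gen}}$ at $P$ is $4$, and $C_{49,\mathrm{gen}}$ is a nearly free divisor with exponents $d_1=24$, $d_2=d_3=25$ and total Tjurina number $\tau(C_{49,\mathrm{gen}})=1727$.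
   Context: Let $S=\mathbb{C}[x,y,z]$ with its standard grading. For a homogeneous $f\in S$ of degree $d$ defining a reduced curve $C:f=0$ in $\mathbb{P}^2$ (over $\mathbb{C}$), let $J_f=(f_x,f_y,f_z)$ be the Jacobian ideal, $I_f$ its saturation with respect to $(x,y,z)$, $N(f)=I_f/J_f$ with homogeneous components $N(f)_m$, and let $\operatorname{AR}(f)=\{(a,b,c)\in S^3: af_x+bf_y+cf_z=0\}$, a graded $S$-submodule of $S^3$ (graded by the degree of the entries $a,b,c$). The curve $C:f=0$ is a nearly free divisor if $N(f)\neq 0$ and $\dim_{\mathbb{C}}N(f)_m\leq 1$ for every $m$; equivalently, there are three syzygies $\rho_1,\rho_2,\rho_3\in\operatorname{AR}(f)$, homogeneous of degrees $d_1$ and $d_2=d_3=d-d_1$ with $1\le d_1\leq d_2$, which form a minimal system of generators of $\operatorname{AR}(f)$. The integers $d_1\leq d_2$ $(=d_3)$ are called the exponents of $C$. The total Tjurina number $\tau(C)$ is the sum of the Tjurina numbers of all singular points of $C$. The number of branches of $C$ at a point is the number of local analytic irreducible components of the germ of $C$ at that point. *)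

(* Defs.v *)
From HB Require Import structures.
From mathcomp Require Import all_boot all_order all_algebra.
From mathcomp Require Import mpoly.
From mathcomp Require Import boolp functions reals complex.

Set Implicit Arguments.
Unset Strict Implicit.
Unset Printing Implicit Defensive.

Import Order.TTheory GRing.Theory Num.Theory.
Local Open Scope ring_scope.

Section RingNotions.
Variable R : comNzRingType.

Definition invertible (x : R) : Prop := exists y, x * y = 1.

Definition associated (x y : R) : Prop :=
  exists2 u, invertible u & y = u * x.

Definition irreducible_elt (x : R) : Prop :=
  [/\ x <> 0, ~ invertible x
    & forall a b, x = a * b -> invertible a \/ invertible b].

Definition ideal_gen n (g : 'I_n -> R) (x : R) : Prop :=
  exists a : 'I_n -> R, x = \sum_i a i * g i.

Definition spans (V : lmodType R) n (M : V -> Prop) (rho : 'I_n -> V)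
    (A : {set 'I_n}) : Prop :=
  forall v, M v <-> exists a : 'I_n -> R, v = \sum_(i in A) a i *: rho i.

Definition minimal_generators (V : lmodType R) n (M : V -> Prop)
    (rho : 'I_n -> V) : Prop :=
  spans M rho setT /\ forall A : {set 'I_n}, A \proper setT -> ~ spans M rho A.

(* [dim_quot A B n]: for subspaces A and B of V, the space A / (A :&: B)
   has a basis with n elements. *)
Definition dim_quot (V : lmodType R) (A B : V -> Prop) (n : nat) : Prop :=
  exists e : 'I_n -> V,
    [/\ forall i, A (e i),
        forall c : 'I_n -> R, B (\sum_i c i *: e i) -> forall i, c i = 0
      & forall v, A v -> exists c : 'I_n -> R, B (v - \sum_i c i *: e i)].

End RingNotions.

(* Formal power series in two variables u and v: [a i j] is the coefficient of
   u^i v^j. *)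
Definition series2 (K : numFieldType) : Type := nat -> nat -> K^o.

Section Series2.
Variable K : numFieldType.
Implicit Types a b c : series2 K.

HB.instance Definition _ :=
  GRing.Lmodule.copy (series2 K) (nat -> nat -> K^o).

Definition series2_one : series2 K := fun i j => ((i == 0%N) && (j == 0%N))%:R.

Definition series2_mul a b : series2 K := fun i j =>
  \sum_(k < i.+1) \sum_(l < j.+1) a k l * b (i - k)%N (j - l)%N.

Definition series2_trunc n a : {poly {poly K}} := \poly_(i < n) \poly_(j < n) a i j.

Fact series2_truncE n a i j : (i < n)%N -> (j < n)%N -> (series2_trunc n a)`_i`_j = a i j.
Proof. by move=> hi hj; rewrite coef_poly hi coef_poly hj. Qed.

Fact coef_coefM (p q : {poly {poly K}}) i j : (p * q)`_i`_j =
  \sum_(k < i.+1) \sum_(l < j.+1) p`_k`_l * q`_(i - k)`_(j - l).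
Proof. by rewrite coefM coef_sum; apply: eq_bigr => k _; rewrite coefM. Qed.

Fact series2_mulE n a b (p q : {poly {poly K}}) :
  (forall i j, (i < n)%N -> (j < n)%N -> p`_i`_j = a i j) ->
  (forall i j, (i < n)%N -> (j < n)%N -> q`_i`_j = b i j) ->
  forall i j, (i < n)%N -> (j < n)%N -> (p * q)`_i`_j = series2_mul a b i j.
Proof.
move=> hp hq i j hi hj; rewrite coef_coefM; apply: eq_bigr => k _.
apply: eq_bigr => l _; rewrite hp ?hq //.
- exact: leq_ltn_trans (leq_subr _ _) hi.
- exact: leq_ltn_trans (leq_subr _ _) hj.
- exact: leq_trans (ltn_ord k) hi.
- exact: leq_trans (ltn_ord l) hj.
Qed.

Fact series2_eq a b (p : nat -> {poly {poly K}}) :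
  (forall n i j, (i < n)%N -> (j < n)%N -> (p n)`_i`_j = a i j) ->
  (forall n i j, (i < n)%N -> (j < n)%N -> (p n)`_i`_j = b i j) -> a = b.
Proof.
move=> ha hb; apply/funext => i; apply/funext => j.
have hi : (i < (maxn i j).+1)%N by rewrite ltnS leq_maxl.
have hj : (j < (maxn i j).+1)%N by rewrite ltnS leq_maxr.
by rewrite -(ha _ _ _ hi hj) (hb _ _ _ hi hj).
Qed.

Fact series2_mulA : associative series2_mul.
Proof.
move=> a b c.
apply: (@series2_eq _ _ (fun n => series2_trunc n a * series2_trunc n b * series2_trunc n c)) => n.
- rewrite -mulrA; apply: series2_mulE; first exact: series2_truncE.
  by apply: series2_mulE; exact: series2_truncE.
- apply: series2_mulE; last exact: series2_truncE.
  by apply: series2_mulE; exact: series2_truncE.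
Qed.

Fact series2_mulC : commutative series2_mul.
Proof.
move=> a b.
apply: (@series2_eq _ _ (fun n => series2_trunc n a * series2_trunc n b)) => n.
- by apply: series2_mulE; exact: series2_truncE.
- by rewrite mulrC; apply: series2_mulE; exact: series2_truncE.
Qed.

Fact series2_mul1 : left_id series2_one series2_mul.
Proof.
move=> a; apply: (@series2_eq _ _ (fun n => 1 * series2_trunc n a)) => n.
- apply: series2_mulE; last exact: series2_truncE.
  move=> i j _ _; rewrite coef1 /series2_one.
  by case: (i == 0%N); rewrite ?coef0 ?coef1.
- by move=> i j hi hj; rewrite mul1r series2_truncE.
Qed.

Fact series2_mulDl : left_distributive series2_mul +%R.
Proof.
move=> a b c; apply/funext => i; apply/funext => j.
rewrite /series2_mul !fctE -big_split; apply: eq_bigr => k _ /=.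
by rewrite -big_split; apply: eq_bigr => l _; rewrite !fctE mulrDl.
Qed.

Fact series2_one_neq0 : series2_one != 0.
Proof.
apply/eqP => /(congr1 (fun a : series2 K => a 0%N 0%N)) /eqP.
by rewrite /series2_one !eqxx oner_eq0.
Qed.

HB.instance Definition _ := GRing.Zmodule_isComNzRing.Build (series2 K)
  series2_mulA series2_mulC series2_mul1 series2_mulDl series2_one_neq0.

(* A power series converges in a neighbourhood of the origin iff its
   coefficients are dominated by those of a geometric series. *)
Definition convergent : {pred series2 K} := fun a =>
  `[< exists M r : K, forall i j, `|a i j| <= M * r ^+ (i + j) >].

Fact convergentP a : reflect
  (exists M r : K, [/\ 0 <= M, 1 <= r &
     forall i j, `|a i j| <= M * r ^+ (i + j)]) (a \in convergent).
Proof.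
apply: (iffP (asboolP _)); last by move=> [M [r [_ _ h]]]; exists M, r.
move=> [M [r h]]; exists `|M|, (`|r| + 1); split; rewrite ?lerDr // => i j.
apply: (@le_trans _ _ (`|M| * `|r| ^+ (i + j))).
  rewrite -normrX -normrM ger0_norm ?(le_trans _ (h i j)) //.
by rewrite ler_wpM2l // lerXn2r ?nnegrE ?addr_ge0 // lerDl.
Qed.

Fact convergent2P a b : a \in convergent -> b \in convergent ->
  exists M r : K, [/\ 0 <= M, 1 <= r,
     forall i j, `|a i j| <= M * r ^+ (i + j) &
     forall i j, `|b i j| <= M * r ^+ (i + j)].
Proof.
move=> /convergentP[M [r [M0 r1 ha]]] /convergentP[N [s [N0 s1 hb]]].
have r0 := le_trans ler01 r1; have s0 := le_trans ler01 s1.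
exists (M + N), (r + s); split; rewrite ?addr_ge0 //.
- by rewrite (le_trans r1) // lerDl.
- move=> i j; apply: le_trans (ha i j) _; apply: ler_pM; rewrite ?exprn_ge0 //.
    by rewrite lerDl.
  by rewrite lerXn2r ?nnegrE ?addr_ge0 // lerDl.
- move=> i j; apply: le_trans (hb i j) _; apply: ler_pM; rewrite ?exprn_ge0 //.
    by rewrite lerDr.
  by rewrite lerXn2r ?nnegrE ?addr_ge0 // lerDr.
Qed.

Fact convergentB a b :
  a \in convergent -> b \in convergent -> a - b \in convergent.
Proof.
move=> ca cb; have [M [r [M0 r1 ha hb]]] := convergent2P ca cb.
apply/asboolP; exists (M *+ 2), r => i j.
by rewrite mulrnAl mulr2n !fctE (le_trans (ler_normB _ _)) // lerD.
Qed.

Fact convergentM a b :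
  a \in convergent -> b \in convergent -> a * b \in convergent.
Proof.
move=> ca cb; have [M [r [M0 r1 ha hb]]] := convergent2P ca cb.
have r0 := le_trans ler01 r1.
apply/asboolP; exists (M * M), (r *+ 2) => i j.
have step k l : (k <= i)%N -> (l <= j)%N ->
    `|a k l * b (i - k)%N (j - l)%N| <= M * M * r ^+ (i + j).
  move=> ki lj; rewrite normrM.
  have -> : M * M * r ^+ (i + j) =
      (M * r ^+ (k + l)) * (M * r ^+ ((i - k) + (j - l))).
    rewrite mulrACA -exprD; congr (_ * _ ^+ _).
    by rewrite addnACA !subnKC.
  by apply: ler_pM.
apply: (@le_trans _ _ (\sum_(k < i.+1) \sum_(l < j.+1) M * M * r ^+ (i + j))).
  apply: (le_trans (ler_norm_sum _ _ _)); apply: ler_sum => k _.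
  apply: (le_trans (ler_norm_sum _ _ _)); apply: ler_sum => l _.
  by apply: step; rewrite -ltnS.
rewrite !sumr_const !card_ord -mulrnA exprMn_n mulrnAr.
apply: ler_wpMn2l; first by rewrite !mulr_ge0 // exprn_ge0.
by rewrite mulnC expnD leq_mul // ltn_expl.
Qed.

Fact convergent1 : 1 \in convergent.
Proof.
apply/asboolP; exists 1, 1 => i j; rewrite expr1n mulr1.
change (`|series2_one i j| <= 1).
by rewrite /series2_one normr_nat lern1 leq_b1.
Qed.

Fact convergent_subring : subring_closed convergent.
Proof. split; [exact: convergent1|exact: convergentB|exact: convergentM]. Qed.

HB.instance Definition _ :=
  GRing.isSubringClosed.Build (series2 K) convergent convergent_subring.

Fact convergentZ : GRing.scaler_closed convergent.
Proof.
move=> x a /asboolP[M [r h]]; apply/asboolP; exists (`|x| * M), r => i j.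
by rewrite !fctE normrM -mulrA ler_wpM2l.
Qed.

HB.instance Definition _ :=
  GRing.isScaleClosed.Build K (series2 K) convergent convergentZ.

(* The ring K{u,v} of germs at the origin of analytic functions. *)
Record cseries2 := CSeries2 { csval :> series2 K; _ : csval \in convergent }.

HB.instance Definition _ := [isSub for csval].
HB.instance Definition _ := [Choice of cseries2 by <:].
HB.instance Definition _ := [SubChoice_isSubComNzRing of cseries2 by <:].
HB.instance Definition _ := [SubZmodule_isSubLmodule of cseries2 by <:].

Definition series2_of_mpoly (p : {mpoly K[2]}) : series2 K :=
  fun i j => p@_[multinom [tuple i; j]].

Fact series2_of_mpoly_conv p : series2_of_mpoly p \in convergent.
Proof.
apply/asboolP; exists (\sum_(m <- msupp p) `|p@_m|), 1 => i j.
rewrite expr1n mulr1 /series2_of_mpoly; set m := Multinom _.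
have [hm|/memN_msupp_eq0 ->] := boolP (m \in msupp p).
  by rewrite (big_rem m) //= lerDl sumr_ge0.
by rewrite normr0 sumr_ge0.
Qed.

Definition germ (p : {mpoly K[2]}) : cseries2 :=
  CSeries2 (series2_of_mpoly_conv p).

End Series2.


Section ProjectivePlane.
Variable K : numFieldType.

(* Index of the last nonzero coordinate of v. *)
Definition pivot (v : 'rV[K]_3) : 'I_3 :=
  odflt ord0 [pick k : 'I_3 | (v ord0 k != 0) &&
                [forall j : 'I_3, (k < j)%N ==> (v ord0 j == 0)]].

(* P^2(K): a point is represented by its only vector of homogeneous coordinates
   whose last nonzero coordinate is 1. *)
Record point := Point { coords :> 'rV[K]_3; _ : coords ord0 (pivot coords) == 1 }.

HB.instance Definition _ := [isSub for coords].
HB.instance Definition _ := [Choice of point by <:].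

Fact point001_subproof : (delta_mx ord0 ord_max : 'rV[K]_3) ord0
  (pivot (delta_mx ord0 ord_max)) == 1.
Proof.
rewrite /pivot; case: pickP => [k /andP[+ _]|/(_ ord_max)] /=.
  by rewrite !mxE eqxx /=; case: (k == _); rewrite ?eqxx.
rewrite !mxE !eqxx oner_eq0 /= => /negbT /forallPn[j].
by rewrite negb_imply ltnNge -ltnS ltn_ord.
Qed.

(* The point [0 : 0 : 1]. *)
Definition point001 : point := Point point001_subproof.

Implicit Types (f g : {mpoly K[3]}) (p : point).

Definition singular f p : Prop :=
  f.@[p ord0] = 0 /\ forall i, (f^`M(i)).@[p ord0] = 0.

(* Equation of f = 0 in the affine chart around p where the pivot coordinate is
   1, with affine coordinates 'X_0 and 'X_1 centred at p. *)
Definition local_equation f p : {mpoly K[2]} :=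
  f \mPo [tuple if unlift (pivot p) i is Some j
               then (p ord0 i)%:MP + 'X_j else 1 | i < 3].

(* K{u,v} is factorial: the branches at p are the irreducible factors, up to
   association, of the germ of f at p. *)
Definition num_branches f p (n : nat) : Prop :=
  exists (g : 'I_n -> cseries2 K) (e : 'I_n -> nat) (u : cseries2 K),
    [/\ forall i, irreducible_elt (g i),
        forall i j, associated (g i) (g j) -> i = j,
        forall i, (0 < e i)%N,
        invertible u
      & germ (local_equation f p) = u * \prod_i g i ^+ e i].

Definition tjurina f p (n : nat) : Prop :=
  let h := local_equation f p in
  dim_quot (fun _ : cseries2 K => True)
    (ideal_gen (tnth [tuple germ h; germ h^`M(0); germ h^`M(1)])) n.

Definition total_tjurina f (n : nat) : Prop :=
  exists (s : seq point) (t : point -> nat),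
    [/\ uniq s,
        forall p, p \in s <-> singular f p,
        forall p, p \in s -> tjurina f p (t p)
      & n = (\sum_(p <- s) t p)%N].

Definition jacobian_ideal f g : Prop := ideal_gen (fun i => f^`M(i)) g.

Definition saturation (J : {mpoly K[3]} -> Prop) g : Prop :=
  exists k, forall m : 'X_{1..3}, mdeg m = k -> J ('X_[m] * g).

Definition nearly_free f : Prop :=
  let J := jacobian_ideal f in
  (exists2 g, saturation J g & ~ J g) /\
  forall m, exists2 n, (n <= 1)%N
    & dim_quot (fun g => saturation J g /\ g \is m.-homog) J n.

Definition syzygy f (r : 'rV[{mpoly K[3]}]_3) : Prop :=
  \sum_i r ord0 i * f^`M(i) = 0.

Definition exponents f (d1 d2 d3 : nat) : Prop :=
  [/\ (1 <= d1 <= d2)%N, d2 = ((msize f).-1 - d1)%N, d3 = d2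
    & exists2 rho : 'I_3 -> 'rV[{mpoly K[3]}]_3,
        forall i j, rho i ord0 j \is (tnth [tuple d1; d2; d3] i).-homog
      & minimal_generators (syzygy f) rho].

End ProjectivePlane.

(* A projective algebraic set is given by its affine cone X; for X irreducible,
   a rational map is a tuple of homogeneous polynomials of the same degree which
   do not all vanish identically on X. *)
Section Birational.
Variable K : numFieldType.

Definition peval n m (q : m.-tuple {mpoly K[n]}) (v : 'rV[K]_n) : 'rV[K]_m :=
  \row_j (tnth q j).@[v ord0].

Definition proportional n (v w : 'rV[K]_n) : Prop :=
  forall i j, v ord0 i * w ord0 j = v ord0 j * w ord0 i.

Definition rational_map n m (X : 'rV[K]_n -> Prop) (Y : 'rV[K]_m -> Prop)
    (q : m.-tuple {mpoly K[n]}) : Prop :=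
  [/\ exists e, forall j, tnth q j \is e.-homog,
      exists2 v, X v & peval q v != 0
    & forall v, X v -> Y (peval q v)].

(* The rational map q \o p is defined on X and is the identity; [proportional]
   holds trivially at the points where q \o p is undefined. *)
Definition rational_cancel n m (X : 'rV[K]_n -> Prop)
    (p : m.-tuple {mpoly K[n]}) (q : n.-tuple {mpoly K[m]}) : Prop :=
  (exists2 v, X v & peval q (peval p v) != 0) /\
  forall v, X v -> proportional (peval q (peval p v)) v.

Definition birational n m (X : 'rV[K]_n -> Prop) (Y : 'rV[K]_m -> Prop) : Prop :=
  exists (p : m.-tuple {mpoly K[n]}) (q : n.-tuple {mpoly K[m]}),
    [/\ rational_map X Y p, rational_map Y X q,
        rational_cancel X p q & rational_cancel Y q p].

Definition rational_curve (f : {mpoly K[3]}) : Prop :=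
  birational (fun v : 'rV[K]_3 => f.@[v ord0] = 0) (fun _ : 'rV[K]_2 => True).

End Birational.

Definition f1 (K : numFieldType) : {mpoly K[3]} := 'X_0 ^+ 3 * 'X_2 + 'X_1 ^+ 4.

Definition f13 (K : numFieldType) : {mpoly K[3]} :=
  f1 K ^+ 3 * 'X_1 + 'X_0 ^+ 13.

(* Main.v *)
(** Write [A = f1] and [B = f13]. There are vectors [a], [b], [c]
    of forms of degrees 23, 23, 24 such that, up to a constant, the gradient of [f] is
    [y (b x c) + z (c x a) + k x^2 (a x b)]. Hence the syzygies of the partial
    derivatives are the combinations of [a], [b], [c] with coefficients orthogonal
    to [(y, z, k x^2)], and the Koszul relations give generators of degrees 24, 25, 25.
    The determinant [g] of [a], [b], [c] has degree 70 and generates the saturation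
    modulo the Jacobian ideal; as [y g], [z g], [x^2 g] lie in that ideal and [g]
    does not, the curve is nearly free. In large degrees the quotient by the Jacobian
    ideal has dimension [1727], and dehomogenizing at [P] gives the Tjurina number.

    The map [(s : t) |-> (s u^12 : u^9 (t u^3 - s^13) : ...)] with
    [u = t^4 + 13 t s^3] parametrizes the curve, with inverse [(x A^3 : B)], and [A],
    [B] pull back to [u^49], [t u^159]. Powers of [x] and [y] lie in the Jacobian
    ideal, so [P] is the only singular point, and the fibre over [P] consists of the
    four roots [t] of [t^4 + 13 t] at [s = 1]. Near each of them a local parameter [v]
    with [y = v^9] exists, and [x = xi(v)] is a convergent Puiseux series. The value
    of [A] on this branch has order 49 in [v], prime to 9, so the nine conjugates of
    [xi] are distinct and the norm of [x - xi(v)] is an irreducible power series; the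
    value of [B / (x A^3)] at [v = 0] tells the four branches apart. *)

Require Import Defs.
From HB Require Import structures.
From mathcomp Require Import all_boot all_order all_algebra.
From mathcomp Require Import mpoly.
From mathcomp Require Import reals complex.
From mathcomp Require Import ring boolp.
Import Order.TTheory GRing.Theory Num.Theory.
Local Open Scope ring_scope.

Set Implicit Arguments.
Unset Strict Implicit.
Unset Printing Implicit Defensive.

(** Exactness is obtained by Cramer's rule, which puts a power of x times a relation into the span
    of the columns; the powers of x are then removed one at a time, because one minor is a constant
    times y^48 modulo x. This is done modulo a parameter t. For t = 0 it describes the syzygies; for
    t = z it shows that z is regular modulo J + (g), so that both the saturation and the passage
    from germs at P back to forms amount to cancelling powers of z. The number 1727 is dim S_70 - 3
    dim S_22 - 1: the gradient has no syzygy in degree 22, and modulo J + (g) multiplication by z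
    maps degree 70 onto degree 71, so that after z = 1 forms of degree 70 suffice. For the branches,
    equations are solved by maps that contract for the order at the origin, which determines the
    coefficients, and preserve a ball for a norm on truncations, which makes the solution converge.
    Irreducibility is tested after ramification: divisibility by a norm is equivalent to
    divisibility by the prime u - xi once v is replaced by v^9. *)

Lemma forall_ord3 (P : 'I_3 -> Prop) : P 0 -> P 1 -> P 2 -> forall i, P i.
Proof.
move=> h0 h1 h2 [[|[|[|//]]] hi].
- by rewrite (_ : Ordinal hi = 0) //; apply/val_inj.
- by rewrite (_ : Ordinal hi = 1) //; apply/val_inj.
- by rewrite (_ : Ordinal hi = 2) //; apply/val_inj.
Qed.

Lemma sum_ord3 (V : nmodType) (F : 'I_3 -> V) : \sum_i F i = F 0 + F 1 + F 2.
Proof.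
rewrite !big_ord_recl big_ord0 addr0 addrA.
by congr (_ + F _ + F _); apply/val_inj.
Qed.

Lemma forall_ord2 (P : 'I_2 -> Prop) : P 0 -> P 1 -> forall i, P i.
Proof.
move=> h0 h1 [[|[|//]] hi].
- by rewrite (_ : Ordinal hi = 0) //; apply/val_inj.
- by rewrite (_ : Ordinal hi = 1) //; apply/val_inj.
Qed.

(** * Congruences modulo an ideal given by a predicate *)

Section Congruence.
Variables (T : comNzRingType) (I : T -> Prop).
Hypotheses (I0 : I 0) (ID : forall s t, I s -> I t -> I (s + t))
  (IM : forall s t, I t -> I (s * t)).

Lemma ideal_sum J (r : seq J) (F : J -> T) :
  (forall j, I (F j)) -> I (\sum_(j <- r) F j).
Proof. by move=> h; elim/big_ind: _. Qed.

Lemma congr_mul a a' b b' : I (a - a') -> I (b - b') -> I (a * b - a' * b').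
Proof.
move=> ha hb; have -> : a * b - a' * b' = b * (a - a') + a' * (b - b') by ring.
by apply: ID; apply: IM.
Qed.

Lemma congr_mmap n (R : comNzRingType) (f : {rmorphism R -> T}) (h h' : 'I_n -> T)
    (p : {mpoly R[n]}) :
  (forall i, I (h i - h' i)) -> I (mmap f h p - mmap f h' p).
Proof.
move=> hh; rewrite /mmap -sumrB; apply: ideal_sum => m; rewrite -mulrBr.
apply: IM; rewrite /mmap1.
elim/big_ind2: _ => [|a a' b b' ha hb|i _]; first by rewrite subrr.
  exact: congr_mul.
elim: (m i) => [|k IHk]; first by rewrite subrr.
by rewrite !exprS; apply: congr_mul.
Qed.

Lemma ideal_expr_add a b m n : I (a ^+ m) -> I (b ^+ n) -> I ((a + b) ^+ (m + n)).
Proof.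
move=> ha hb; rewrite exprDn; apply: ideal_sum => i.
rewrite -mulr_natl; apply: IM.
have [le_ni|lt_in] := leqP n i.
  by rewrite -(subnK le_ni) (exprD b); do 2![apply: IM].
have le_m : (m <= m + n - i)%N by rewrite -addnBA ?leq_addr // ltnW.
by rewrite -(subnK le_m) (exprD a) mulrAC; apply: IM.
Qed.

End Congruence.

(** * Relations among Hilbert-Burch minors *)

Section HilbertBurch.
Variable S : comNzRingType.
Variables (x y z k : S) (N : nat).
Variables (a0 a1 a2 b0 b1 b2 c0 c1 c2 p0 p1 p2 : S).

Let F0 := y * (b1 * c2 - b2 * c1) + z * (c1 * a2 - c2 * a1) + k * x ^+ 2 * (a1 * b2 - a2 * b1).
Let F1 := y * (b2 * c0 - b0 * c2) + z * (c2 * a0 - c0 * a2) + k * x ^+ 2 * (a2 * b0 - a0 * b2).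
Let F2 := y * (b0 * c1 - b1 * c0) + z * (c0 * a1 - c1 * a0) + k * x ^+ 2 * (a0 * b1 - a1 * b0).
Let g := a0 * (b1 * c2 - b2 * c1) + a1 * (b2 * c0 - b0 * c2) + a2 * (b0 * c1 - b1 * c0).

(** The scalar product with one of the three vectors kills the two cross products that contain it
    and turns the third into the determinant. *)
Lemma hb_relations :
  [/\ a0 * F0 + a1 * F1 + a2 * F2 = y * g,
      b0 * F0 + b1 * F1 + b2 * F2 = z * g
    & c0 * F0 + c1 * F1 + c2 * F2 = k * x ^+ 2 * g].
Proof. by rewrite /F0 /F1 /F2 /g; split; ring. Qed.

Hypothesis x_nilpotent : x ^+ N = p0 * F0 + p1 * F1 + p2 * F2.
Variable t : S.
Hypothesis F2_regular : forall s u w, F2 * s = x * u + t * w ->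
  exists u' w', s = x * u' + t * w'.
Hypothesis x_regular : forall s w, x * s = t * w -> exists w', s = t * w'.

(** Membership of the column (v0, v1, v2, e), modulo [t], in the span of the columns (a, y), (b, z),
    (c, k x^2). *)
Let in_span v0 v1 v2 e := exists al be ga r0 r1 r2 r,
  [/\ v0 = al * a0 + be * b0 + ga * c0 + t * r0,
      v1 = al * a1 + be * b1 + ga * c1 + t * r1,
      v2 = al * a2 + be * b2 + ga * c2 + t * r2
    & e = al * y + be * z + ga * (k * x ^+ 2) + t * r].

(** The hypothesis says that the 4 x 4 determinant of the three columns and (v, e) vanishes modulo
    [t]. Hence Cramer's rule puts each minor [F0], [F1], [F2] times (v, e) into the span, and the
    combination with coefficients [p0], [p1], [p2] turns the minors into x^N. *)
Let cramer v0 v1 v2 e q : v0 * F0 + v1 * F1 + v2 * F2 = e * g + t * q ->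
  in_span (x ^+ N * v0) (x ^+ N * v1) (x ^+ N * v2) (x ^+ N * e).
Proof.
move=> hv.
pose det u0 u1 u2 v0 v1 v2 w0 w1 w2 : S := u0 * (v1 * w2 - v2 * w1)
  + u1 * (v2 * w0 - v0 * w2) + u2 * (v0 * w1 - v1 * w0).
pose h := k * x ^+ 2.
exists (p0 * det v1 v2 e b1 b2 z c1 c2 h + p1 * det v2 v0 e b2 b0 z c2 c0 h
  + p2 * det v0 v1 e b0 b1 z c0 c1 h).
exists (p0 * det a1 a2 y v1 v2 e c1 c2 h + p1 * det a2 a0 y v2 v0 e c2 c0 h
  + p2 * det a0 a1 y v0 v1 e c0 c1 h).
exists (p0 * det a1 a2 y b1 b2 z v1 v2 e + p1 * det a2 a0 y b2 b0 z v2 v0 e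
  + p2 * det a0 a1 y b0 b1 z v0 v1 e).
exists (p0 * q), (p1 * q), (p2 * q), 0.
have htq : t * q = v0 * F0 + v1 * F1 + v2 * F2 - e * g by rewrite hv; ring.
rewrite !(mulrCA t) htq x_nilpotent /det /F0 /F1 /F2 /g /h.
by split; ring.
Qed.

(** If x times a column is in the span, Cramer's rule on the rows 0, 1 and last gives [F2] times
    each coefficient as a multiple of x modulo [t]. As [F2] is regular modulo (x, t), the
    coefficients are themselves multiples of x, and x can be cancelled. *)
Let strip n v0 v1 v2 e :
  in_span (x ^+ n.+1 * v0) (x ^+ n.+1 * v1) (x ^+ n.+1 * v2) (x ^+ n.+1 * e) ->
  in_span (x ^+ n * v0) (x ^+ n * v1) (x ^+ n * v2) (x ^+ n * e).
Proof.
move=> [al [be [ga [r0 [r1 [r2 [r [e0 e1 e2 e3]]]]]]]].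
rewrite !(exprS x n) -!(mulrA x (x ^+ n)) in e0 e1 e2 e3.
move: (x ^+ n * v0) (x ^+ n * v1) (x ^+ n * v2) (x ^+ n * e) e0 e1 e2 e3.
move=> {v0 v1 v2 e} v0 v1 v2 e e0 e1 e2 e3.
pose det u0 u1 u2 v0 v1 v2 w0 w1 w2 : S := u0 * (v1 * w2 - v2 * w1)
  + u1 * (v2 * w0 - v0 * w2) + u2 * (v0 * w1 - v1 * w0).
pose h := k * x ^+ 2.
have [|al1 [al2 hal]] := @F2_regular al (det v0 v1 e b0 b1 z c0 c1 h)
    (- det r0 r1 r b0 b1 z c0 c1 h).
  have -> : x * det v0 v1 e b0 b1 z c0 c1 h
    = det (x * v0) (x * v1) (x * e) b0 b1 z c0 c1 h by rewrite /det; ring.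
  by rewrite e0 e1 e3 /det /F2 /h; ring.
have [|be1 [be2 hbe]] := @F2_regular be (det a0 a1 y v0 v1 e c0 c1 h)
    (- det a0 a1 y r0 r1 r c0 c1 h).
  have -> : x * det a0 a1 y v0 v1 e c0 c1 h
    = det a0 a1 y (x * v0) (x * v1) (x * e) c0 c1 h by rewrite /det; ring.
  by rewrite e0 e1 e3 /det /F2 /h; ring.
have [|ga1 [ga2 hga]] := @F2_regular ga (det a0 a1 y b0 b1 z v0 v1 e)
    (- det a0 a1 y b0 b1 z r0 r1 r).
  have -> : x * det a0 a1 y b0 b1 z v0 v1 e
    = det a0 a1 y b0 b1 z (x * v0) (x * v1) (x * e) by rewrite /det; ring.
  by rewrite e0 e1 e3 /det /F2 /h; ring.
have red v a b c s : x * v = al * a + be * b + ga * c + t * s ->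
    exists s', v = al1 * a + be1 * b + ga1 * c + t * s'.
  rewrite hal hbe hga => hv.
  have [|s' hs'] := @x_regular (v - (al1 * a + be1 * b + ga1 * c))
    (al2 * a + be2 * b + ga2 * c + s); first by rewrite mulrBr hv; ring.
  by exists s'; rewrite -hs'; ring.
have [s0 h0] := red _ _ _ _ _ e0; have [s1 h1] := red _ _ _ _ _ e1.
have [s2 h2] := red _ _ _ _ _ e2; have [s3 h3] := red _ _ _ _ _ e3.
by exists al1, be1, ga1, s0, s1, s2, s3.
Qed.

(* The ideal of maximal minors of the matrix with columns (a, -y), (b, -z),
   (c, -k x^2) contains a power of x, and one minor is regular modulo (x, t). *)
Lemma hilbert_burch v0 v1 v2 e q : v0 * F0 + v1 * F1 + v2 * F2 = e * g + t * q ->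
  exists al be ga r0 r1 r2 r,
  [/\ v0 = al * a0 + be * b0 + ga * c0 + t * r0,
      v1 = al * a1 + be * b1 + ga * c1 + t * r1,
      v2 = al * a2 + be * b2 + ga * c2 + t * r2
    & e = al * y + be * z + ga * (k * x ^+ 2) + t * r].
Proof.
move=> /cramer; elim: N => [|n IHn] h; last exact/IHn/strip.
by move: h; rewrite expr0 !mul1r.
Qed.

(** Cramer's rule on the rows 0, 1 and last, whose minor is [F2]. It makes the columns linearly
    independent once [F2] is a nonzero element of a domain. *)
Lemma hb_injective al be ga :
    al * a0 + be * b0 + ga * c0 = 0 -> al * a1 + be * b1 + ga * c1 = 0 ->
    al * y + be * z + ga * (k * x ^+ 2) = 0 ->
  [/\ F2 * al = 0, F2 * be = 0 & F2 * ga = 0].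
Proof.
pose det u0 u1 u2 v0 v1 v2 w0 w1 w2 : S := u0 * (v1 * w2 - v2 * w1)
  + u1 * (v2 * w0 - v0 * w2) + u2 * (v0 * w1 - v1 * w0).
pose h := k * x ^+ 2; move=> e0 e1 e2; split.
- transitivity (det (al * a0 + be * b0 + ga * c0) (al * a1 + be * b1 + ga * c1)
    (al * y + be * z + ga * h) b0 b1 z c0 c1 h); first by rewrite /det /F2 /h; ring.
  by rewrite e0 e1 e2 /det; ring.
- transitivity (det a0 a1 y (al * a0 + be * b0 + ga * c0) (al * a1 + be * b1 + ga * c1)
    (al * y + be * z + ga * h) c0 c1 h); first by rewrite /det /F2 /h; ring.
  by rewrite e0 e1 e2 /det; ring.
- transitivity (det a0 a1 y b0 b1 z (al * a0 + be * b0 + ga * c0)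
    (al * a1 + be * b1 + ga * c1) (al * y + be * z + ga * h));
    first by rewrite /det /F2 /h; ring.
  by rewrite e0 e1 e2 /det; ring.
Qed.

End HilbertBurch.

(** * The explicit vectors and the determinantal form of the gradient *)

Section Data.
(* The vectors a, b, c were found by linear algebra over the rationals; they depend
   on [z] mostly through A = x^3 z + y^4, and [gen_fx], [gen_fy], [gen_fz] are the
   partial derivatives of the curve in terms of A. Large coefficients are written
   as products because the numeral [k] of a ring is a sum of [k] ones. *)
Variables (R : comNzRingType) (x y z A : R).

Definition hb_a0 : R := 1183 * 648 * x ^+ 7 * A ^+ 4 + 1456 * 2 * x ^+ 11 * A ^+ 3.

Definition hb_a1 : R := - 1274 * 189 * x ^+ 3 * A ^+ 5 - 1183 * 1323 * 6 * x ^+ 19 * A -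
  1274 * 28 * x ^+ 23.

Definition hb_a2 : R := - 1443 * 819 * 2 * x ^+ 3 * A ^+ 5 - 1008 * 8 * x ^+ 7 * A ^+ 4 +
  1029 * 8 * x ^+ 23.

Definition hb_b0 : R := - 1053 * 16 * x * y ^+ 2 * A ^+ 5 - 1183 * 648 * x ^+ 4 * y ^+ 3 *
  A ^+ 4 + 1014 * 1053 * 6 * x ^+ 7 * A ^+ 4 - 1456 * 2 * x ^+ 8 * y ^+ 3 * A ^+ 3 - 936 *
  2 * x ^+ 11 * A ^+ 3 - 1053 * 16 * x ^+ 14 * y * A ^+ 2.

Definition hb_b1 : R := 975 * 18 * y ^+ 3 * A ^+ 5 - 1131 * 819 * 3 * x ^+ 3 * A ^+ 5 +
  1014 * 1053 * 6 * x ^+ 6 * y * A ^+ 4 - 168 * x ^+ 7 * A ^+ 4 + 1366 * 18 * x ^+ 10 * y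
  * A ^+ 3 - 1378 * 162 * x ^+ 13 * y ^+ 2 * A ^+ 2 + 1183 * 1323 * 6 * x ^+ 16 * y ^+ 3 *
  A - 1183 * 819 * 81 * x ^+ 19 * A + 1274 * 28 * x ^+ 20 * y ^+ 3 + 1323 * 36 * x ^+ 23.

Definition hb_b2 : R := - 975 * 864 * y ^+ 2 * z * A ^+ 5 + 1183 * 1050 * 9 * y ^+ 3 * A
  ^+ 5 - 1443 * 507 * 27 * x ^+ 3 * A ^+ 5 - 1014 * 1053 * 6 * x ^+ 3 * y ^+ 4 * A ^+ 4 -
  762 * 4 * x ^+ 7 * A ^+ 4 - 1083 * 96 * x ^+ 7 * y ^+ 4 * A ^+ 3 + 1170 * 162 * x ^+ 10
  * y * A ^+ 3 + 975 * 864 * x ^+ 10 * y ^+ 5 * A ^+ 2 - 1183 * 1323 * 24 * x ^+ 13 * y ^+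
  2 * A ^+ 2 + 1183 * 819 * 324 * x ^+ 16 * y ^+ 3 * A - 1274 * 112 * x ^+ 17 * y ^+ 2 * A
  - 1183 * 168 * x ^+ 20 * y ^+ 3 + 1274 * 54 * x ^+ 23.

Definition hb_c0 : R := - 1183 * 1050 * 96 * A ^+ 6 - 1274 * 1296 * 4 * y ^+ 4 * A ^+ 5 -
  949 * 819 * 288 * x ^+ 3 * y * A ^+ 5 + 1183 * 819 * 1296 * 2 * x ^+ 6 * y ^+ 2 * A ^+ 4
  - 1274 * 896 * x ^+ 7 * y * A ^+ 4 - 1274 * 576 * x ^+ 10 * y ^+ 2 * A ^+ 3 - 1274 *
  1296 * 4 * x ^+ 13 * y ^+ 3 * A ^+ 2 + 1183 * 1350 * 48 * x ^+ 16 * A ^+ 2.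

Definition hb_c1 : R := 1378 * 1323 * 48 * x ^+ 2 * y * z * A ^+ 5 - 1183 * 972 * 64 * x
  ^+ 2 * y ^+ 2 * A ^+ 5 + 1183 * 819 * 1296 * 2 * x ^+ 5 * y ^+ 3 * A ^+ 4 - 1029 * 64 *
  x ^+ 6 * y ^+ 2 * A ^+ 4 - 1183 * 845 * 1215 * 24 * x ^+ 8 * A ^+ 4 + 1366 * 882 * 8 * x
  ^+ 9 * y ^+ 3 * A ^+ 3 + 1366 * 1183 * 900 * x ^+ 12 * A ^+ 3 - 1378 * 1323 * 48 * x ^+
  12 * y ^+ 4 * A ^+ 2 + 1114 * 1183 * 891 * 4 * x ^+ 15 * y * A ^+ 2 - 1183 * 1274 * 1134
  * 18 * x ^+ 18 * y ^+ 2 * A + 1274 * 1372 * 8 * x ^+ 19 * y * A + 1029 * 1134 * 16 * x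
  ^+ 22 * y ^+ 2.

Definition hb_c2 : R := 1274 * 1350 * 192 * x ^+ 2 * z ^+ 2 * A ^+ 5 + 1066 * 819 * 432 *
  x ^+ 2 * y * z * A ^+ 5 - 1378 * 1183 * 1134 * 24 * x ^+ 2 * y ^+ 2 * A ^+ 5 + 1029 *
  768 * 4 * x ^+ 3 * y * A ^+ 5 - 1183 * 819 * 1296 * 2 * x ^+ 2 * y ^+ 6 * A ^+ 4 - 1029
  * 768 * 4 * x ^+ 3 * y ^+ 5 * A ^+ 4 + 1183 * 845 * 1215 * 24 * x ^+ 5 * y ^+ 3 * A ^+ 4
  - 889 * 1344 * x ^+ 6 * y ^+ 2 * A ^+ 4 - 1083 * 1176 * 32 * x ^+ 6 * y ^+ 6 * A ^+ 3 -
  1306 * 923 * 1260 * 4 * x ^+ 9 * y ^+ 3 * A ^+ 3 - 1183 * 1125 * 648 * x ^+ 12 * A ^+ 3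
  + 1274 * 1350 * 192 * x ^+ 9 * y ^+ 7 * A ^+ 2 - 1157 * 1326 * 756 * 16 * x ^+ 12 * y ^+
  4 * A ^+ 2 + 1183 * 1274 * 1134 * 72 * x ^+ 15 * y ^+ 5 * A - 1274 * 1372 * 32 * x ^+ 16
  * y ^+ 4 * A - 1183 * 1183 * 1050 * 972 * x ^+ 18 * y ^+ 2 * A - 1029 * 784 * 4 * x ^+
  19 * y * A - 1029 * 1134 * 64 * x ^+ 19 * y ^+ 5 - 1051 * 1274 * 1008 * 4 * x ^+ 22 * y
  ^+ 2.

(** The ratio between the vector of minors and the gradient of the curve. *)
Definition hb_kappa : R := - (1183 * 1029 * 1050 * 864 * 2).

Definition gen_fx : R :=
  36 * x ^+ 2 * z * A ^+ 11 * (13 * y - z)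
  + 27 * x ^+ 2 * z * A ^+ 8 * (4 * x ^+ 10 * y ^+ 3 + 13 * x ^+ 13)
  + A ^+ 9 * (40 * x ^+ 9 * y ^+ 3 + 169 * x ^+ 12)
  + 108 * x ^+ 25 * y ^+ 2 * z * A ^+ 5 + 138 * x ^+ 22 * y ^+ 2 * A ^+ 6
  + 36 * x ^+ 38 * y * z * A ^+ 2 + 144 * x ^+ 35 * y * A ^+ 3 + 49 * x ^+ 48.

Definition gen_fy : R :=
  48 * y ^+ 3 * A ^+ 11 * (13 * y - z) + 13 * A ^+ 12
  + 36 * y ^+ 3 * A ^+ 8 * (4 * x ^+ 10 * y ^+ 3 + 13 * x ^+ 13)
  + 12 * x ^+ 10 * y ^+ 2 * A ^+ 9 + 144 * x ^+ 23 * y ^+ 5 * A ^+ 5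
  + 12 * x ^+ 23 * y * A ^+ 6 + 48 * x ^+ 36 * y ^+ 4 * A ^+ 2
  + 4 * x ^+ 36 * A ^+ 3.

Definition gen_fz : R :=
  12 * x ^+ 3 * A ^+ 11 * (13 * y - z) - A ^+ 12
  + 9 * x ^+ 3 * A ^+ 8 * (4 * x ^+ 10 * y ^+ 3 + 13 * x ^+ 13)
  + 36 * x ^+ 26 * y ^+ 2 * A ^+ 5 + 12 * x ^+ 39 * y * A ^+ 2.

Hypothesis HA : A = x ^+ 3 * z + y ^+ 4.

(** [A] stays an atom and the identity is checked modulo the relation [HA], so the powers of A in
    the data need not be expanded by hand. *)
Lemma hb_identity_x : y * (hb_b1 * hb_c2 - hb_b2 * hb_c1) + z * (hb_c1 * hb_a2 - hb_c2 * hb_a1)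
  + 845 * 45 * x ^+ 2 * (hb_a1 * hb_b2 - hb_a2 * hb_b1) = hb_kappa * gen_fx.
Proof.
rewrite /hb_kappa /gen_fx /hb_a0 /hb_a1 /hb_a2 /hb_b0 /hb_b1 /hb_b2 /hb_c0 /hb_c1 /hb_c2.
ring: HA.
Qed.

Lemma hb_identity_y : y * (hb_b2 * hb_c0 - hb_b0 * hb_c2) + z * (hb_c2 * hb_a0 - hb_c0 * hb_a2)
  + 845 * 45 * x ^+ 2 * (hb_a2 * hb_b0 - hb_a0 * hb_b2) = hb_kappa * gen_fy.
Proof.
rewrite /hb_kappa /gen_fy /hb_a0 /hb_a1 /hb_a2 /hb_b0 /hb_b1 /hb_b2 /hb_c0 /hb_c1 /hb_c2.
ring: HA.
Qed.

Lemma hb_identity_z : y * (hb_b0 * hb_c1 - hb_b1 * hb_c0) + z * (hb_c0 * hb_a1 - hb_c1 * hb_a0)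
  + 845 * 45 * x ^+ 2 * (hb_a0 * hb_b1 - hb_a1 * hb_b0) = hb_kappa * gen_fz.
Proof.
rewrite /hb_kappa /gen_fz /hb_a0 /hb_a1 /hb_a2 /hb_b0 /hb_b1 /hb_b2 /hb_c0 /hb_c1 /hb_c2.
ring: HA.
Qed.

End Data.

(** * The equation of the curve and its partial derivatives *)

Section Curve.
Variable K : numFieldType.
Local Notation S := {mpoly K[3]}.
Local Notation x := ('X_0 : S).
Local Notation y := ('X_1 : S).
Local Notation z := ('X_2 : S).
Local Notation A := (f1 K).
Local Notation B := (f13 K).

(** Expand (B - x^13)^4 = A^12 y^4 = A^12 (A - x^3 z): all terms other than B^4 and A^13 carry the
    factor x^3, which gives the quotient without a division. *)
Definition f49 : S :=
  4 * (B ^+ 3 * x ^+ 10) - 6 * (B ^+ 2 * x ^+ 23) + 4 * (B * x ^+ 36) - x ^+ 49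
  - A ^+ 12 * z.

Definition f49gen : S := f49 + 13 *: (B * A ^+ 9).
Local Notation f := f49gen.

Lemma f1E : A = x ^+ 3 * z + y ^+ 4. Proof. by []. Qed.

Lemma f13E : B = A ^+ 3 * y + x ^+ 13. Proof. by []. Qed.

Lemma f49_spec : x ^+ 3 * f49 = B ^+ 4 - A ^+ 13.
Proof. rewrite /f49 f13E. ring: f1E. Qed.

Lemma f49genE : f = 13 * B * A ^+ 9 + 4 * B ^+ 3 * x ^+ 10 - 6 * B ^+ 2 * x ^+ 23
  + 4 * B * x ^+ 36 - x ^+ 49 - A ^+ 12 * z.
Proof.
rewrite /f49gen /f49 -mul_mpolyC (_ : 13%:MP = 13) ?mpolyC_nat //; ring.
Qed.

Lemma f49gen_spec : x ^+ 3 * f = B ^+ 4 + 13 * x ^+ 3 * B * A ^+ 9 - A ^+ 13.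
Proof. rewrite f49genE f13E. ring: f1E. Qed.

(** With B eliminated, a derivative of the curve needs only that of A, and the residue x^49 modulo A
    becomes visible. *)
Lemma f49gen_expand : f = A ^+ 12 * (13 * y - z)
  + A ^+ 9 * (4 * x ^+ 10 * y ^+ 3 + 13 * x ^+ 13)
  + 6 * A ^+ 6 * y ^+ 2 * x ^+ 23 + 4 * A ^+ 3 * y * x ^+ 36 + x ^+ 49.
Proof. rewrite f49genE f13E. ring. Qed.

Lemma dhomog_natr n (d : nat) (p : S) : p \is d.-homog -> n%:R * p \is d.-homog.
Proof. by rewrite -mpolyC_nat mul_mpolyC; apply: dhomogZ. Qed.

Lemma dhomog_var (i : 'I_3) n : ('X_i : S) ^+ n \is n.-homog.
Proof.
have h1 : ('X_i : S) \is 1.-homog by rewrite dhomogX /= mdeg1.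
by have := dhomogMn n h1; rewrite mul1n.
Qed.

Lemma f1_homog n : A ^+ n \is (4 * n).-homog.
Proof.
apply: dhomogMn; rewrite f1E; apply: rpredD; last exact: dhomog_var.
exact: (dhomogM (dhomog_var 0 3) (dhomog_var 2 1)).
Qed.

Lemma f13_homog n : B ^+ n \is (13 * n).-homog.
Proof.
apply: dhomogMn; rewrite f13E; apply: rpredD; last exact: dhomog_var.
exact: (dhomogM (f1_homog 3) (dhomog_var 1 1)).
Qed.

Lemma f49_homog : f49 \is 49.-homog.
Proof.
rewrite /f49; apply: rpredB; last first.
  exact: (dhomogM (f1_homog 12) (dhomog_var 2 1)).
apply: rpredB; last exact: dhomog_var.
apply: rpredD; [apply: rpredB|]; apply: dhomog_natr.
- exact: (dhomogM (f13_homog 3) (dhomog_var 0 10)).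
- exact: (dhomogM (f13_homog 2) (dhomog_var 0 23)).
- exact: (dhomogM (f13_homog 1) (dhomog_var 0 36)).
Qed.

Lemma f49gen_homog : f \is 49.-homog.
Proof.
rewrite /f49gen; apply: rpredD; first exact: f49_homog.
by apply: dhomogZ; exact: (dhomogM (f13_homog 1) (f1_homog 9)).
Qed.

Lemma mderiv_exp n (i : 'I_n) (p : {mpoly K[n]}) k :
  (p ^+ k.+1)^`M(i) = k.+1%:R * p ^+ k * p^`M(i).
Proof.
elim: k => [|k IHk]; first by rewrite expr0 expr1 !mul1r.
by rewrite exprS mderivM IHk (exprS p k) -[k.+2]addn1 natrD; ring.
Qed.

Lemma mderiv_natr n (i : 'I_n) (k : nat) : (k%:R : {mpoly K[n]})^`M(i) = 0.
Proof. by rewrite -mpolyC_nat mderivC. Qed.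

Lemma mderiv_var n (i j : 'I_n) : ('X_j : {mpoly K[n]})^`M(i) = (j == i)%:R.
Proof.
rewrite mderivX mnm1E; case: eqP => [->|_]; last by rewrite scale0r.
rewrite (_ : (U_(i) - U_(i))%MM = 0%MM) ?mpolyX0 ?scale1r //.
by apply/mnmP => j'; rewrite mnmBE subnn mnm0E.
Qed.

(** A relation, so that [compute_mderiv] can fill in the derivative as an existential variable by
    recursion on the expression; a single [ring] then compares it with the intended form. *)
Definition is_mderiv n (i : 'I_n) (p q : {mpoly K[n]}) : Prop := p^`M(i) = q.

Section IsMderiv.
Variables (n : nat) (i : 'I_n).
Implicit Types p q : {mpoly K[n]}.

Lemma is_mderivD p p' q q' : is_mderiv i p p' -> is_mderiv i q q' ->
  is_mderiv i (p + q) (p' + q').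
Proof. by rewrite /is_mderiv mderivD => -> ->. Qed.

Lemma is_mderivN p p' : is_mderiv i p p' -> is_mderiv i (- p) (- p').
Proof. by rewrite /is_mderiv mderivN => ->. Qed.

Lemma is_mderivM p p' q q' : is_mderiv i p p' -> is_mderiv i q q' ->
  is_mderiv i (p * q) (p' * q + p * q').
Proof. by rewrite /is_mderiv mderivM => -> ->. Qed.

Lemma is_mderiv_exp p p' k : is_mderiv i p p' ->
  is_mderiv i (p ^+ k) (k%:R * p ^+ k.-1 * p').
Proof.
rewrite /is_mderiv => <-; case: k => [|k]; last exact: mderiv_exp.
by rewrite expr0 (mderiv_natr i 1) !mul0r.
Qed.

Lemma is_mderiv_natr k : is_mderiv i k%:R 0.
Proof. exact: mderiv_natr. Qed.

Lemma is_mderiv_eq p q q' : is_mderiv i p q -> q = q' -> p^`M(i) = q'.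
Proof. by move=> -> ->. Qed.

End IsMderiv.

Ltac compute_mderiv := lazymatch goal with
  | |- is_mderiv _ (_ + _) _ => apply: is_mderivD; compute_mderiv
  | |- is_mderiv _ (- _) _ => apply: is_mderivN; compute_mderiv
  | |- is_mderiv _ (_ * _) _ => apply: is_mderivM; compute_mderiv
  | |- is_mderiv _ (_ ^+ _) _ => apply: is_mderiv_exp; compute_mderiv
  | |- is_mderiv _ (_%:R) _ => exact: is_mderiv_natr
  | |- is_mderiv _ 'X_ _ _ => exact: mderiv_var
  | _ => eassumption
  end.

Lemma f1_dx : A^`M(0) = 3 * x ^+ 2 * z.
Proof.
rewrite f1E; apply: is_mderiv_eq; first by compute_mderiv.
by rewrite /=; ring.
Qed.

Lemma f49gen_dx : f^`M(0) = gen_fx x y z A.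
Proof.
(* A becomes a variable known only through its derivative, which keeps the result in the shape of
   [gen_fx]. *)
rewrite f49gen_expand /gen_fx; move: A f1_dx => a da.
apply: is_mderiv_eq; first by compute_mderiv.
by rewrite /=; ring.
Qed.

Lemma f1_dy : A^`M(1) = 4 * y ^+ 3.
Proof.
rewrite f1E; apply: is_mderiv_eq; first by compute_mderiv.
by rewrite /=; ring.
Qed.

Lemma f49gen_dy : f^`M(1) = gen_fy x y z A.
Proof.
rewrite f49gen_expand /gen_fy; move: A f1_dy => a da.
apply: is_mderiv_eq; first by compute_mderiv.
by rewrite /=; ring.
Qed.

Lemma f1_dz : A^`M(2) = x ^+ 3.
Proof.
rewrite f1E; apply: is_mderiv_eq; first by compute_mderiv.
by rewrite /=; ring.
Qed.

Lemma f49gen_dz : f^`M(2) = gen_fz x y z A.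
Proof.
rewrite f49gen_expand /gen_fz; move: A f1_dz => a da.
apply: is_mderiv_eq; first by compute_mderiv.
by rewrite /=; ring.
Qed.

End Curve.

(** * The Jacobian ideal *)

Section IdealGen.
Variables (T : comNzRingType) (n : nat) (g : 'I_n -> T).

Lemma ideal_gen0 : ideal_gen g 0.
Proof. by exists (fun=> 0); rewrite big1 // => i _; rewrite mul0r. Qed.

Lemma ideal_genD s t : ideal_gen g s -> ideal_gen g t -> ideal_gen g (s + t).
Proof.
move=> [p ->] [q ->]; exists (fun i => p i + q i); rewrite -big_split /=.
by apply: eq_bigr => i _; rewrite mulrDl.
Qed.

Lemma ideal_genM s t : ideal_gen g t -> ideal_gen g (s * t).
Proof.
move=> [p ->]; exists (fun i => s * p i); rewrite mulr_sumr.
by apply: eq_bigr => i _; rewrite mulrA.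
Qed.

Lemma ideal_genN t : ideal_gen g t -> ideal_gen g (- t).
Proof. by rewrite -mulN1r; apply: ideal_genM. Qed.

Lemma ideal_genB s t : ideal_gen g s -> ideal_gen g t -> ideal_gen g (s - t).
Proof. by move=> hs ht; apply: ideal_genD => //; apply: ideal_genN. Qed.

Lemma mem_ideal_gen i : ideal_gen g (g i).
Proof.
exists (fun j => (j == i)%:R); rewrite (bigD1 i) //= eqxx mul1r big1 ?addr0 //.
by move=> j /negbTE ->; rewrite mul0r.
Qed.

End IdealGen.

Section JacobianIdeal.
Variable K : numFieldType.
Local Notation S := {mpoly K[3]}.
Local Notation x := ('X_0 : S).
Local Notation y := ('X_1 : S).
Local Notation z := ('X_2 : S).
Local Notation A := (f1 K).
Local Notation B := (f13 K).
Local Notation f := (f49gen K).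
Local Notation fx := (gen_fx x y z A).
Local Notation fy := (gen_fy x y z A).
Local Notation fz := (gen_fz x y z A).
Local Notation J := (jacobian_ideal f).

Lemma jacobianP q : J q <-> exists p0 p1 p2, q = p0 * fx + p1 * fy + p2 * fz.
Proof.
rewrite /jacobian_ideal /ideal_gen; split=> [[p ->]|[p0 [p1 [p2 ->]]]].
  by exists (p 0), (p 1), (p 2); rewrite sum_ord3 f49gen_dx f49gen_dy f49gen_dz.
exists (fun i => if i == 0 then p0 else if i == 1 then p1 else p2).
by rewrite sum_ord3 f49gen_dx f49gen_dy f49gen_dz.
Qed.

Lemma jacobian0 : J 0. Proof. exact: ideal_gen0. Qed.

Lemma jacobianD p q : J p -> J q -> J (p + q). Proof. exact: ideal_genD. Qed.

Lemma jacobianB p q : J p -> J q -> J (p - q). Proof. exact: ideal_genB. Qed.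

Lemma jacobianM p q : J q -> J (p * q). Proof. exact: ideal_genM. Qed.

Lemma natr_mpoly_neq0 k : (k.+1%:R : S) != 0.
Proof. by rewrite -mpolyC_nat mpolyC_eq0 pnatr_eq0. Qed.

Lemma mpolyC_mulVr (c : K) : c != 0 -> (c^-1)%:MP * c%:MP = 1 :> S.
Proof. by move=> c0; rewrite -mpolyCM mulVf. Qed.

Lemma jacobian_natr k q : J (k.+1%:R * q) -> J q.
Proof.
move=> /(jacobianM (k.+1%:R^-1)%:MP); rewrite mulrA -mpolyC_nat mpolyC_mulVr ?mul1r //.
by rewrite pnatr_eq0.
Qed.

Lemma jacobian_fx : J fx.
Proof. by rewrite -f49gen_dx; exact: (@mem_ideal_gen _ _ (fun i => f^`M(i))). Qed.

Lemma jacobian_fy : J fy.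
Proof. by rewrite -f49gen_dy; exact: (@mem_ideal_gen _ _ (fun i => f^`M(i))). Qed.

Lemma jacobian_fz : J fz.
Proof. by rewrite -f49gen_dz; exact: (@mem_ideal_gen _ _ (fun i => f^`M(i))). Qed.

Lemma euler : 49 * f = x * fx + y * fy + z * fz.
Proof.
rewrite f49gen_expand /gen_fx /gen_fy /gen_fz. ring: (f1E K).
Qed.

Lemma jacobian_f : J f.
Proof.
apply: (@jacobian_natr 48); rewrite euler.
by do 2?[apply: jacobianD]; apply: jacobianM;
  [exact: jacobian_fx|exact: jacobian_fy|exact: jacobian_fz].
Qed.

(* On the chart x <> 0 the curve is t^4 + 13 t = u with u = A / x^4 and
   t = B / (x A^3); the next lemmas are the smoothness of this curve, with
   denominators cleared. *)
Let E := 4 * B ^+ 3 + 13 * x ^+ 3 * A ^+ 9.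

Lemma jacobian_f1 : J (A ^+ 16).
Proof.
(* The derivation x^3 d/dy - 4 y^3 d/dz kills A and maps B to x^3 A^3; applied to [f49gen_spec] it
   leaves A^3 E. *)
have hE : J (A ^+ 3 * E).
  have -> : A ^+ 3 * E = x ^+ 3 * fy - 4 * y ^+ 3 * fz.
    rewrite /E /gen_fy /gen_fz f13E. ring: (f1E K).
  by apply: jacobianB; apply: jacobianM; [exact: jacobian_fy|exact: jacobian_fz].
have h1 : J (A ^+ 9 * (9 * x ^+ 3 * B - A ^+ 4)).
  apply: (@jacobian_natr 12).
  have -> : 13 * (A ^+ 9 * (9 * x ^+ 3 * B - A ^+ 4)) = A * fz - 3 * y * (A ^+ 3 * E).
    rewrite /E /gen_fz f13E. ring: (f1E K).
  by apply: jacobianB; apply: jacobianM; [exact: jacobian_fz|exact: hE].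
(* B E - 4 x^3 f no longer contains B^4. *)
have h2 : J (A ^+ 12 * (4 * A ^+ 4 - 39 * x ^+ 3 * B)).
  have -> : A ^+ 12 * (4 * A ^+ 4 - 39 * x ^+ 3 * B)
    = B * (A ^+ 3 * E) - 4 * A ^+ 3 * x ^+ 3 * f.
    rewrite -[4 * _ * _ * f]mulrA f49gen_spec /E. ring.
  by apply: jacobianB; apply: jacobianM; [exact: hE|exact: jacobian_f].
(* The two combinations of A^4 and x^3 B in [h1] and [h2] are independent: 39 - 4 * 9 = 3. Both A^16
   and A^12 x^3 B therefore lie in J. *)
have h3 : J (A ^+ 12 * (x ^+ 3 * B)).
  apply: (@jacobian_natr 2).
  have -> : 3 * (A ^+ 12 * (x ^+ 3 * B)) =
    - (A ^+ 12 * (4 * A ^+ 4 - 39 * x ^+ 3 * B))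
    - 4 * A ^+ 3 * (A ^+ 9 * (9 * x ^+ 3 * B - A ^+ 4)) by ring.
  by apply: jacobianB; [exact: ideal_genN|exact: jacobianM].
have -> : A ^+ 16 = 9 * (A ^+ 12 * (x ^+ 3 * B))
    - A ^+ 3 * (A ^+ 9 * (9 * x ^+ 3 * B - A ^+ 4)) by ring.
by apply: jacobianB; apply: jacobianM.
Qed.

Definition f49gen_mod_f1 : S := A ^+ 11 * (13 * y - z)
  + A ^+ 8 * (4 * x ^+ 10 * y ^+ 3 + 13 * x ^+ 13)
  + 6 * A ^+ 5 * y ^+ 2 * x ^+ 23 + 4 * A ^+ 2 * y * x ^+ 36.

Lemma f49gen_mod_f1E : f = A * f49gen_mod_f1 + x ^+ 49.
Proof. rewrite f49gen_expand /f49gen_mod_f1. ring. Qed.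

Lemma jacobian_x : J (x ^+ (49 * 17)).
Proof.
(* Modulo f, x^49 is a multiple of A; the exponent 17 is 1 for f plus 16 for A. *)
have -> : x ^+ (49 * 17) = (f + - (A * f49gen_mod_f1)) ^+ (1 + 16).
  by rewrite exprM {1}f49gen_mod_f1E addrAC subrr add0r.
apply: (ideal_expr_add jacobian0 jacobianD jacobianM).
  by rewrite expr1; exact: jacobian_f.
rewrite -mulrN exprMn mulrC; apply: jacobianM; exact: jacobian_f1.
Qed.

Lemma jacobian_y : J (y ^+ (4 * (16 + 49 * 17))).
Proof.
have -> : y ^+ (4 * (16 + 49 * 17)) = (A + - (x ^+ 3 * z)) ^+ (16 + 49 * 17).
  by rewrite exprM f1E addrAC subrr add0r.
apply: (ideal_expr_add jacobian0 jacobianD jacobianM); first exact: jacobian_f1.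
have -> : - (x ^+ 3 * z) = - (x ^+ 2 * z) * x by ring.
by rewrite exprMn; apply: jacobianM; exact: jacobian_x.
Qed.

Local Notation kappa := (hb_kappa S).

Lemma hb_kappaE : kappa = (hb_kappa K)%:MP.
Proof.
rewrite /hb_kappa mpolyCN; congr (- _).
by do 4![rewrite mpolyCM; congr (_ * _); last by rewrite mpolyC_nat]; rewrite mpolyC_nat.
Qed.

Lemma natr_neq0 k : (k.+1%:R : K) != 0.
Proof. by rewrite pnatr_eq0. Qed.

Lemma hb_kappa_neq0 : hb_kappa K != 0.
Proof.
rewrite /hb_kappa oppr_eq0.
by do 4![apply: mulf_neq0; last exact: natr_neq0]; exact: natr_neq0.
Qed.

Lemma mpolyX_neq0 n (m : 'X_{1..n}) : 'X_[m] != 0 :> {mpoly K[n]}.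
Proof. by rewrite -msupp_eq0 msuppX. Qed.

Lemma comp_var (i : 'I_3) (lq : 3.-tuple S) : 'X_i \mPo lq = tnth lq i.
Proof. by rewrite comp_mpolyXU (tnth_nth 0). Qed.

Lemma comp_f1 (lq : 3.-tuple S) : A \mPo lq = tnth lq 0 ^+ 3 * tnth lq 2 + tnth lq 1 ^+ 4.
Proof. by rewrite f1E rmorphD rmorphM !rmorphXn /= !comp_var. Qed.

(** Modulo x, A is y^4 and every term of [gen_fz] except - A^12 disappears. The value - y^48 makes
    this derivative regular modulo x and modulo (x, z). *)
Lemma comp_fz (lq : 3.-tuple S) : tnth lq 0 = 0 -> fz \mPo lq = - (tnth lq 1 ^+ 4) ^+ 12.
Proof.
move=> h0.
have [q ->] : exists q, fz = x * q - A ^+ 12.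
  rewrite /gen_fz.
  exists (12 * x ^+ 2 * A ^+ 11 * (13 * y - z)
    + 9 * x ^+ 2 * A ^+ 8 * (4 * x ^+ 10 * y ^+ 3 + 13 * x ^+ 13)
    + 36 * x ^+ 25 * y ^+ 2 * A ^+ 5 + 12 * x ^+ 38 * y * A ^+ 2).
  by ring.
by rewrite rmorphB rmorphM rmorphXn /= comp_f1 comp_var h0 mul0r sub0r expr0n mul0r add0r.
Qed.

(** Separates the degree from the predicate, so that the degree of a monomial is synthesized and
    then compared with the expected number by computation. *)
Definition is_dhomog (p : S) (d : nat) : Prop := p \is d.-homog.

Lemma is_dhomogD p q d : is_dhomog p d -> is_dhomog q d -> is_dhomog (p + q) d.
Proof. exact: rpredD. Qed.

Lemma is_dhomogN p d : is_dhomog p d -> is_dhomog (- p) d.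
Proof. by move=> h; rewrite /is_dhomog rpredN. Qed.

Lemma is_dhomogM p q d e : is_dhomog p d -> is_dhomog q e -> is_dhomog (p * q) (d + e).
Proof. exact: dhomogM. Qed.

Lemma is_dhomogX p d k : is_dhomog p d -> is_dhomog (p ^+ k) (d * k).
Proof. exact: dhomogMn. Qed.

Lemma is_dhomog_natr k : is_dhomog k%:R 0.
Proof. by rewrite -[k%:R]mulr1; apply: dhomog_natr; exact: dhomog1. Qed.

Lemma is_dhomog_var (i : 'I_3) : is_dhomog 'X_i 1.
Proof. by rewrite /is_dhomog dhomogX /= mdeg1. Qed.

Lemma is_dhomog_f1 : is_dhomog A 4.
Proof. exact: (f1_homog K 1). Qed.

Lemma is_dhomog_eq p d e : is_dhomog p d -> d = e -> is_dhomog p e.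
Proof. by move=> h <-. Qed.

Ltac prove_monomial_dhomog := lazymatch goal with
  | |- is_dhomog (_ * _) _ => apply: is_dhomogM; prove_monomial_dhomog
  | |- is_dhomog (_ ^+ _) _ => apply: is_dhomogX; prove_monomial_dhomog
  | |- is_dhomog (- _) _ => apply: is_dhomogN; prove_monomial_dhomog
  | |- is_dhomog (_%:R) _ => exact: is_dhomog_natr
  | |- is_dhomog 'X_ _ _ => exact: is_dhomog_var
  | _ => exact: is_dhomog_f1
  end.

Ltac prove_dhomog := lazymatch goal with
  | |- is_dhomog (_ + _) _ => apply: is_dhomogD; prove_dhomog
  | |- is_dhomog (- _) _ => apply: is_dhomogN; prove_dhomog
  | _ => apply: is_dhomog_eq; [prove_monomial_dhomog|reflexivity]
  end.

Lemma hb_a0_homog : is_dhomog (hb_a0 x A) 23.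
Proof. rewrite /hb_a0; prove_dhomog. Qed.

Lemma hb_a1_homog : is_dhomog (hb_a1 x A) 23.
Proof. rewrite /hb_a1; prove_dhomog. Qed.

Lemma hb_a2_homog : is_dhomog (hb_a2 x A) 23.
Proof. rewrite /hb_a2; prove_dhomog. Qed.

Lemma hb_b0_homog : is_dhomog (hb_b0 x y A) 23.
Proof. rewrite /hb_b0; prove_dhomog. Qed.

Lemma hb_b1_homog : is_dhomog (hb_b1 x y A) 23.
Proof. rewrite /hb_b1; prove_dhomog. Qed.

Lemma hb_b2_homog : is_dhomog (hb_b2 x y z A) 23.
Proof. rewrite /hb_b2; prove_dhomog. Qed.

Lemma hb_c0_homog : is_dhomog (hb_c0 x y A) 24.
Proof. rewrite /hb_c0; prove_dhomog. Qed.

Lemma hb_c1_homog : is_dhomog (hb_c1 x y z A) 24.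
Proof. rewrite /hb_c1; prove_dhomog. Qed.

Lemma hb_c2_homog : is_dhomog (hb_c2 x y z A) 24.
Proof. rewrite /hb_c2; prove_dhomog. Qed.

Lemma dhomog_mderiv n (i : 'I_n) d (p : {mpoly K[n]}) :
  p \is d.+1.-homog -> p^`M(i) \is d.-homog.
Proof.
move=> hp; apply/dhomogP => m; rewrite mcoeff_msupp mcoeff_deriv => hm.
have : p@_(m + U_(i)) != 0 by apply: contraNneq hm => ->; rewrite mul0rn.
rewrite -mcoeff_msupp => /(dhomog_mf hp) /= /eqP.
by rewrite mdegD mdeg1 addn1 eqSS => /eqP.
Qed.

Lemma gen_fx_homog : is_dhomog fx 48.
Proof. by rewrite -f49gen_dx; apply: dhomog_mderiv; exact: f49gen_homog. Qed.

Lemma gen_fy_homog : is_dhomog fy 48.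
Proof. by rewrite -f49gen_dy; apply: dhomog_mderiv; exact: f49gen_homog. Qed.

Lemma gen_fz_homog : is_dhomog fz 48.
Proof. by rewrite -f49gen_dz; apply: dhomog_mderiv; exact: f49gen_homog. Qed.

End JacobianIdeal.

Global Opaque gen_fx gen_fy gen_fz hb_kappa
  hb_a0 hb_a1 hb_a2 hb_b0 hb_b1 hb_b2 hb_c0 hb_c1 hb_c2.

(** * Saturation and syzygies *)

Section Saturation.
Variable K : numFieldType.
Local Notation S := {mpoly K[3]}.
Local Notation x := ('X_0 : S).
Local Notation y := ('X_1 : S).
Local Notation z := ('X_2 : S).
Local Notation A := (f1 K).
Local Notation f := (f49gen K).
Local Notation fx := (gen_fx x y z A).
Local Notation fy := (gen_fy x y z A).
Local Notation fz := (gen_fz x y z A).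
Local Notation J := (jacobian_ideal f).
Local Notation a0 := (hb_a0 x A).
Local Notation a1 := (hb_a1 x A).
Local Notation a2 := (hb_a2 x A).
Local Notation b0 := (hb_b0 x y A).
Local Notation b1 := (hb_b1 x y A).
Local Notation b2 := (hb_b2 x y z A).
Local Notation c0 := (hb_c0 x y A).
Local Notation c1 := (hb_c1 x y z A).
Local Notation c2 := (hb_c2 x y z A).
Local Notation kappa := (hb_kappa S).

Lemma hb_kappa_mulVr : (hb_kappa K)^-1%:MP * kappa = 1 :> S.
Proof. by rewrite hb_kappaE mpolyC_mulVr // hb_kappa_neq0. Qed.

Lemma hb_kappa_inj (p q : S) : kappa * p = kappa * q -> p = q.
Proof.
by move=> /(congr1 ( *%R (hb_kappa K)^-1%:MP)); rewrite !mulrA hb_kappa_mulVr !mul1r.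
Qed.

(** The determinant of a, b, c, divided by [hb_kappa] so that its relations involve the partial
    derivatives themselves. *)
Definition sat_gen : S := (hb_kappa K)^-1%:MP *
  (a0 * (b1 * c2 - b2 * c1) + a1 * (b2 * c0 - b0 * c2) + a2 * (b0 * c1 - b1 * c0)).
Local Notation g := sat_gen.

Lemma sat_genE : kappa * g =
  a0 * (b1 * c2 - b2 * c1) + a1 * (b2 * c0 - b0 * c2) + a2 * (b0 * c1 - b1 * c0).
Proof. by rewrite /g mulrA [kappa * _]mulrC hb_kappa_mulVr mul1r. Qed.

Lemma sat_gen_relations :
  [/\ a0 * fx + a1 * fy + a2 * fz = y * g,
      b0 * fx + b1 * fy + b2 * fz = z * g
    & c0 * fx + c1 * fy + c2 * fz = 845 * 45 * x ^+ 2 * g].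
Proof.
have [h1 h2 h3] := hb_relations x y z (845 * 45) a0 a1 a2 b0 b1 b2 c0 c1 c2.
have scal u v w q k : u * (kappa * fx) + v * (kappa * fy) + w * (kappa * fz) = k * (kappa * q)
    -> u * fx + v * fy + w * fz = k * q.
  move=> hk; apply: hb_kappa_inj; transitivity (k * (kappa * q)); last by ring.
  by rewrite -hk; ring.
split; apply: scal; rewrite sat_genE -(hb_identity_x (f1E K)) -(hb_identity_y (f1E K))
  -(hb_identity_z (f1E K)) //.
Qed.

(** Used as division with remainder by variables: the substitution sets some variables to 0, and the
    remainder is the substituted polynomial. *)
Lemma sub_comp_mpoly (I : S -> Prop) (lq : 3.-tuple S) p :
    I 0 -> (forall s t, I s -> I t -> I (s + t)) -> (forall s t, I t -> I (s * t)) ->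
  (forall i, I ('X_i - tnth lq i)) -> I (p - (p \mPo lq)).
Proof.
move=> I0 ID IM h; rewrite -{1}[p]comp_mpoly_id /comp_mpoly.
by apply: congr_mmap => // i; rewrite tnth_mktuple.
Qed.

Definition at_x0 : 3.-tuple S := [tuple 0; y; z].
Definition at_xz0 : 3.-tuple S := [tuple 0; y; 0].
Definition at_z0 : 3.-tuple S := [tuple x; y; 0].

Lemma mod_x p : exists q, p = x * q + (p \mPo at_x0).
Proof.
have [|s t [u ->] [v ->]|s t [u ->]|i|q hq] :=
    @sub_comp_mpoly (fun s => exists q, s = x * q) at_x0 p.
- by exists 0; rewrite mulr0.
- by exists (u + v); rewrite mulrDr.
- by exists (s * u); rewrite mulrCA.
- elim/forall_ord3: i; rewrite (tnth_nth 0) /= ?subrr;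
    by [exists 1; rewrite subr0 mulr1|exists 0; rewrite mulr0].
- by exists q; rewrite -hq subrK.
Qed.

Lemma mod_z p : exists q, p = z * q + (p \mPo at_z0).
Proof.
have [|s t [u ->] [v ->]|s t [u ->]|i|q hq] :=
    @sub_comp_mpoly (fun s => exists q, s = z * q) at_z0 p.
- by exists 0; rewrite mulr0.
- by exists (u + v); rewrite mulrDr.
- by exists (s * u); rewrite mulrCA.
- elim/forall_ord3: i; rewrite (tnth_nth 0) /= ?subrr;
    by [exists 1; rewrite subr0 mulr1|exists 0; rewrite mulr0].
- by exists q; rewrite -hq subrK.
Qed.

Lemma mod_xz p : exists q r, p = x * q + z * r + (p \mPo at_xz0).
Proof.
have [|s t [u [v ->]] [u' [v' ->]]|s t [u [v ->]]|i|q [r hq]] :=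
    @sub_comp_mpoly (fun s => exists q r, s = x * q + z * r) at_xz0 p.
- by exists 0, 0; rewrite !mulr0 addr0.
- by exists (u + u'), (v + v'); ring.
- by exists (s * u), (s * v); ring.
- elim/forall_ord3: i; rewrite (tnth_nth 0) /= ?subrr.
  + by exists 1, 0; rewrite subr0 mulr1 mulr0 addr0.
  + by exists 0, 0; rewrite !mulr0 addr0.
  + by exists 0, 1; rewrite subr0 mulr1 mulr0 add0r.
- by exists q, r; rewrite -hq subrK.
Qed.

Lemma x_dvd_z q r : x * q = z * r -> exists s, q = z * s.
Proof.
move=> h; have [s hs] := mod_z q; exists s.
suff q0 : q \mPo at_z0 = 0 by rewrite {1}hs q0 addr0.
move/(congr1 (comp_mpoly at_z0)): h; rewrite !rmorphM /= !comp_var /= !(tnth_nth 0) /=.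
by rewrite mul0r => /eqP; rewrite mulf_eq0 (negPf (mpolyX_neq0 _ _)) => /eqP.
Qed.

(** The term [0 * w] is the parameter [t] of [hilbert_burch] at 0. After x = 0 the factor in front
    of s is a nonzero element of a domain. *)
Lemma fz_regular_x s u w : kappa * fz * s = x * u + 0 * w ->
  exists u' w', s = x * u' + 0 * w'.
Proof.
rewrite mul0r addr0 => h; have [q hq] := mod_x s; exists q, 0; rewrite mul0r addr0.
suff s0 : s \mPo at_x0 = 0 by rewrite {1}hq s0 addr0.
move/(congr1 (comp_mpoly at_x0)): h; rewrite !rmorphM /= comp_var.
rewrite (_ : tnth at_x0 0 = 0) // mul0r comp_fz //.
rewrite hb_kappaE comp_mpolyC => /eqP; rewrite !mulf_eq0 mpolyC_eq0.
rewrite (negPf (hb_kappa_neq0 K)) oppr_eq0 -exprM expf_eq0 /= => /orP[|/eqP //].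
by rewrite (tnth_nth 0) /= (negPf (mpolyX_neq0 _ _)).
Qed.

Lemma fz_regular_xz s u w : kappa * fz * s = x * u + z * w ->
  exists u' w', s = x * u' + z * w'.
Proof.
move=> h; have [q [r hq]] := mod_xz s; exists q, r.
suff s0 : s \mPo at_xz0 = 0 by rewrite {1}hq s0 addr0.
move/(congr1 (comp_mpoly at_xz0)): h; rewrite rmorphD !rmorphM /= !comp_var.
rewrite (_ : tnth at_xz0 0 = 0) // (_ : tnth at_xz0 2 = 0) // !mul0r addr0 comp_fz //.
rewrite hb_kappaE comp_mpolyC => /eqP; rewrite !mulf_eq0 mpolyC_eq0.
rewrite (negPf (hb_kappa_neq0 K)) oppr_eq0 -exprM expf_eq0 /= => /orP[|/eqP //].
by rewrite (tnth_nth 0) /= (negPf (mpolyX_neq0 _ _)).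
Qed.

Lemma hilbert_burch_mod t v0 v1 v2 e q :
    (forall s u w, kappa * fz * s = x * u + t * w -> exists u' w', s = x * u' + t * w') ->
    (forall s w, x * s = t * w -> exists w', s = t * w') ->
  v0 * fx + v1 * fy + v2 * fz = e * g + t * q ->
  exists al be ga r0 r1 r2 r,
  [/\ v0 = al * a0 + be * b0 + ga * c0 + t * r0,
      v1 = al * a1 + be * b1 + ga * c1 + t * r1,
      v2 = al * a2 + be * b2 + ga * c2 + t * r2
    & e = al * y + be * z + ga * (845 * 45 * x ^+ 2) + t * r].
Proof.
move=> reg xreg hv.
have [p0 [p1 [p2]]] := iffLR (jacobianP _) (jacobian_x K).
pose k' : S := (hb_kappa K)^-1%:MP.
have kk p : p = k' * (kappa * p) by rewrite mulrA hb_kappa_mulVr mul1r.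
have -> : p0 * fx + p1 * fy + p2 * fz =
    k' * p0 * (kappa * fx) + k' * p1 * (kappa * fy) + k' * p2 * (kappa * fz).
  by rewrite [LHS]kk; ring.
have hkv : v0 * (kappa * fx) + v1 * (kappa * fy) + v2 * (kappa * fz) =
    e * (kappa * g) + t * (kappa * q).
  have -> : e * (kappa * g) + t * (kappa * q) = kappa * (e * g + t * q) by ring.
  by rewrite -hv; ring.
rewrite sat_genE in hkv; move: hkv.
move: reg.
rewrite -(hb_identity_x (f1E K)) -(hb_identity_y (f1E K)) -(hb_identity_z (f1E K)).
move=> reg hkv hx.
exact: hilbert_burch hx _ reg xreg _ _ _ _ _ hkv.
Qed.

(** The case t = 0. For e = 0 it lists the syzygies of the gradient; for other e it tells which
    multiples e g lie in J, namely those with e in (y, z, x^2). *)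
Lemma jacobian_syzygy v0 v1 v2 e : v0 * fx + v1 * fy + v2 * fz = e * g ->
  exists al be ga,
  [/\ v0 = al * a0 + be * b0 + ga * c0,
      v1 = al * a1 + be * b1 + ga * c1,
      v2 = al * a2 + be * b2 + ga * c2
    & e = al * y + be * z + ga * (845 * 45 * x ^+ 2)].
Proof.
move=> h; have [|| al [be [ga [r0 [r1 [r2 [r]]]]]]] :=
    @hilbert_burch_mod 0 v0 v1 v2 e 0 fz_regular_x.
- move=> s w /eqP; rewrite mul0r mulf_eq0 (negPf (mpolyX_neq0 _ _)) => /eqP ->.
  by exists 0; rewrite mul0r.
- by rewrite mul0r addr0.
by rewrite !mul0r !addr0; exists al, be, ga.
Qed.

Lemma jacobian_syzygy_z v0 v1 v2 e q :
  v0 * fx + v1 * fy + v2 * fz = e * g + z * q ->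
  exists al be ga r0 r1 r2 r,
  [/\ v0 = al * a0 + be * b0 + ga * c0 + z * r0,
      v1 = al * a1 + be * b1 + ga * c1 + z * r1,
      v2 = al * a2 + be * b2 + ga * c2 + z * r2
    & e = al * y + be * z + ga * (845 * 45 * x ^+ 2) + z * r].
Proof. exact: hilbert_burch_mod fz_regular_xz x_dvd_z. Qed.

Definition sat_ideal q := exists p e, J p /\ q = p + e * g.
Local Notation J1 := sat_ideal.

(** Write z q = v . grad f + e g. Modulo z, the column (v, -e) is a combination of the three
    columns, and these contribute nothing to v . grad f + e g by [sat_gen_relations]. Only z times
    an element of J + (g) remains, and z cancels. *)
Lemma sat_ideal_z q : J1 (z * q) -> J1 q.
Proof.
move=> [p [e [/jacobianP[v0 [v1 [v2 ->]]] hq]]].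
have [|al [be [ga [r0 [r1 [r2 [r [h0 h1 h2 h3]]]]]]]] :=
    @jacobian_syzygy_z v0 v1 v2 (- e) q; first by rewrite hq; ring.
exists (r0 * fx + r1 * fy + r2 * fz), (- r); split.
  by apply/jacobianP; exists r0, r1, r2.
have [ea eb ec] := sat_gen_relations.
have z0 : z != 0 := mpolyX_neq0 _ _.
apply: (mulfI z0); rewrite hq -[e]opprK h3 h0 h1 h2.
have -> : (al * a0 + be * b0 + ga * c0 + z * r0) * fx
   + (al * a1 + be * b1 + ga * c1 + z * r1) * fy
   + (al * a2 + be * b2 + ga * c2 + z * r2) * fz
   = al * (a0 * fx + a1 * fy + a2 * fz) + be * (b0 * fx + b1 * fy + b2 * fz)
   + ga * (c0 * fx + c1 * fy + c2 * fz) + z * (r0 * fx + r1 * fy + r2 * fz).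
  move: fx fy fz a0 a1 a2 b0 b1 b2 c0 c1 c2 {h0 h1 h2 h3 hq ea eb ec}.
  by move=> *; ring.
rewrite ea eb ec.
move: fx fy fz g {h0 h1 h2 h3 hq ea eb ec} => ? ? ? ?; ring.
Qed.

Lemma sat_ideal_zn n q : J1 (z ^+ n * q) -> J1 q.
Proof.
by elim: n => [|n IHn]; rewrite ?expr0 ?mul1r // exprS -mulrA => /sat_ideal_z.
Qed.

Lemma jacobian_mul_sat_gen i : i != 0 -> J ('X_i * g).
Proof.
have [ea eb _] := sat_gen_relations.
elim/forall_ord3: i => // _; apply/jacobianP.
  by exists a0, a1, a2; rewrite ea.
by exists b0, b1, b2; rewrite eb.
Qed.

Lemma jacobian_mul_sat_gen_x2 : J (x ^+ 2 * g).
Proof.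
have [_ _ ec] := sat_gen_relations.
pose c : K := 845 * 45.
have c0' : c != 0 by rewrite mulf_eq0 !pnatr_eq0.
have -> : x ^+ 2 * g = (c^-1)%:MP * (845 * 45 * x ^+ 2 * g).
  rewrite -[845 * 45 * _ * _]mulrA [RHS]mulrA (_ : 845 * 45 = c%:MP) ?mpolyC_mulVr ?mul1r //.
  by rewrite mpolyCM !mpolyC_nat.
by apply: jacobianM; apply/jacobianP; exists c0, c1, c2; rewrite ec.
Qed.

End Saturation.

(** Used to replace the coefficients of an ideal membership by their homogeneous parts of the right
    degree. The test guards against truncated subtraction. *)
Lemma pihomog_mulr n (R : idomainType) d m (p q : {mpoly R[n]}) : q \is d.-homog ->
  pihomog mdeg m (p * q) = if (d <= m)%N then pihomog mdeg (m - d) p * q else 0.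
Proof.
move=> hq.
rewrite {1}(pihomog_partitionE (leqnn (msize p))) mulr_suml raddf_sum /=.
have step i : pihomog mdeg m (pihomog mdeg i p * q) =
    if (d <= m)%N && (i == m - d)%N then pihomog mdeg i p * q else 0.
  have hi : pihomog mdeg i p * q \is (i + d).-homog.
    by apply: dhomogM => //; exact: pihomogP.
  have [le_dm|lt_md] /= := leqP d m.
    have [->|ne] := eqVneq i (m - d)%N.
      by rewrite pihomog_dE // -{2}(subnK le_dm) dhomogM // pihomogP.
    apply: pihomog_ne0 hi; apply: contraNneq ne => <-; by rewrite addnK.
  by apply: pihomog_ne0 hi; rewrite neq_ltn (leq_trans lt_md (leq_addl _ _)) orbT.
rewrite (eq_bigr _ (fun (i : 'I__) _ => step i)).
case: leqP => [le_dm|_] /=; last by rewrite big1.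
rewrite -big_mkcond /=.
have [lt|ge] := ltnP (m - d) (msize p).
  by rewrite (big_pred1 (Ordinal lt)).
rewrite big_pred0 => [|i]; last first.
  by apply/negbTE; rewrite neq_ltn (leq_trans (ltn_ord i) ge).
rewrite /pihomog big1_seq ?mul0r // => u /andP[/eqP hu].
move=> /msize_mdeg_lt; rewrite /= in hu; by rewrite hu ltnNge ge.
Qed.

(** * The saturation of the Jacobian ideal and near freeness *)

Section NearlyFree.
Variable K : numFieldType.
Local Notation S := {mpoly K[3]}.
Local Notation x := ('X_0 : S).
Local Notation y := ('X_1 : S).
Local Notation z := ('X_2 : S).
Local Notation A := (f1 K).
Local Notation f := (f49gen K).
Local Notation fx := (gen_fx x y z A).
Local Notation fy := (gen_fy x y z A).
Local Notation fz := (gen_fz x y z A).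
Local Notation J := (jacobian_ideal f).
Local Notation a0 := (hb_a0 x A).
Local Notation a1 := (hb_a1 x A).
Local Notation a2 := (hb_a2 x A).
Local Notation b0 := (hb_b0 x y A).
Local Notation b1 := (hb_b1 x y A).
Local Notation b2 := (hb_b2 x y z A).
Local Notation c0 := (hb_c0 x y A).
Local Notation c1 := (hb_c1 x y z A).
Local Notation c2 := (hb_c2 x y z A).
Local Notation g := (sat_gen K).
Local Notation J1 := (@sat_ideal K).

Lemma sat_gen_homog : g \is 70.-homog.
Proof.
rewrite /sat_gen mul_mpolyC; apply: dhomogZ.
have [ha0 ha1 ha2] := And3 (hb_a0_homog K) (hb_a1_homog K) (hb_a2_homog K).
have [hb0 hb1 hb2] := And3 (hb_b0_homog K) (hb_b1_homog K) (hb_b2_homog K).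
have [hc0 hc1 hc2] := And3 (hb_c0_homog K) (hb_c1_homog K) (hb_c2_homog K).
have m3 (u v w s t : S) : is_dhomog u 23 -> is_dhomog v 23 -> is_dhomog w 24 ->
    is_dhomog s 23 -> is_dhomog t 24 -> u * (v * w - s * t) \is 70.-homog.
  move=> hu hv hw hs ht; apply: (@dhomogM _ _ _ 23 _ 47 _ hu).
  by apply: rpredB; apply: (@dhomogM _ _ _ 23 _ 24).
by apply: rpredD; [apply: rpredD|]; apply: m3.
Qed.

(** A monomial of degree at least 2 is divisible by y, by z or by x^2. *)
Lemma jacobian_mul_sat_gen2 m : (1 < mdeg m)%N -> J ('X_[m] * g).
Proof.
move=> hm.
have red (i : 'I_3) : i != 0 -> m i != 0%N -> J ('X_[m] * g).
  move=> i0 mi; rewrite -[m](@submK _ U_(i)%MM) ?lep1mP // mpolyXD -mulrA.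
  by apply: jacobianM; exact: jacobian_mul_sat_gen.
have [m1|] := eqVneq (m 1) 0%N; last exact: red.
have [m2|] := eqVneq (m 2) 0%N; last exact: red.
have h2 : (U_(0%R) *+ 2 <= m)%MM.
  apply/mnm_lepP; elim/forall_ord3; rewrite mulmnE mnm1E //=.
  by move: hm; rewrite mdegE sum_ord3 m1 m2 !addr0.
rewrite -[m](submK h2) mpolyXD -mulrA -mpolyXn.
by apply: jacobianM; exact: jacobian_mul_sat_gen_x2.
Qed.

(** From left to right the monomial z^k is enough, as z is regular modulo J + (g). Conversely all
    monomials of degree 2 send g into J. *)
Lemma sat_ideal_saturation q : saturation J q <-> J1 q.
Proof.
split=> [[k hk]|[p [e [hp ->]]]].
  apply: (@sat_ideal_zn _ k); exists (z ^+ k * q), 0; rewrite mul0r addr0.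
  by split=> //; rewrite mpolyXn; apply: hk; rewrite mdegMn mdeg1 mul1n.
exists 2 => m hm; rewrite mulrDr; apply: jacobianD; first exact: jacobianM.
rewrite mulrCA; apply: jacobianM.
by apply: jacobian_mul_sat_gen2; rewrite hm.
Qed.

Definition at_yz0 : 3.-tuple S := [tuple x; 0; 0].

Lemma mod_yz p : exists q r, p = y * q + z * r + (p \mPo at_yz0).
Proof.
have [|s t [u [v ->]] [u' [v' ->]]|s t [u [v ->]]|i|q [r hq]] :=
    @sub_comp_mpoly _ (fun s => exists q r, s = y * q + z * r) at_yz0 p.
- by exists 0, 0; rewrite !mulr0 addr0.
- by exists (u + u'), (v + v'); ring.
- by exists (s * u), (s * v); ring.
- elim/forall_ord3: i; rewrite (tnth_nth 0) /= ?subrr.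
  + by exists 0, 0; rewrite !mulr0 addr0.
  + by exists 1, 0; rewrite subr0 mulr1 mulr0 addr0.
  + by exists 0, 1; rewrite subr0 mulr1 mulr0 add0r.
- by exists q, r; rewrite -hq subrK.
Qed.

Lemma y_dvd_z q r : y * q = z * r -> exists s, q = z * s.
Proof.
move=> h; have [s hs] := mod_z q; exists s.
suff q0 : q \mPo (at_z0 K) = 0 by rewrite {1}hs q0 addr0.
move/(congr1 (comp_mpoly (at_z0 K))): h; rewrite !rmorphM /= !comp_var /= !(tnth_nth 0) /=.
by rewrite mul0r => /eqP; rewrite mulf_eq0 (negPf (mpolyX_neq0 _ _)) => /eqP.
Qed.

(** By [jacobian_syzygy] e lies in (y, z, x^2), and setting y = z = 0 leaves a multiple of x^2. This
    detects that g and x g are nonzero modulo J. *)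
Lemma mul_sat_gen_jacobian e : J (e * g) ->
  exists r, e \mPo at_yz0 = x ^+ 2 * r.
Proof.
move=> /jacobianP[p0 [p1 [p2 /esym h]]].
have [al [be [ga [_ _ _ ->]]]] := jacobian_syzygy h.
exists (845 * 45 * (ga \mPo at_yz0)).
have hy : y \mPo at_yz0 = 0 by rewrite comp_var.
have hz : z \mPo at_yz0 = 0 by rewrite comp_var.
have hx : x \mPo at_yz0 = x by rewrite comp_var.
rewrite !rmorphD !rmorphM /= hy hz hx !mulr0 !add0r.
have hn k : (k%:R : S) \mPo at_yz0 = k%:R by rewrite rmorph_nat.
rewrite !hn; ring.
Qed.


Lemma mcoeff_x2M i p : (mdeg i < 2)%N -> (x ^+ 2 * p)@_i = 0.
Proof.
move=> hi; rewrite mpolyXn; apply: contraTeq hi; rewrite -mcoeff_msupp => /msuppM_le.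
move=> /allpairsP[[u v] /= [hu _ ->]]; rewrite -leqNgt mdegD.
by move: hu; rewrite msuppX inE => /eqP ->; rewrite mdegMn mdeg1.
Qed.

Lemma sat_gen_notin : ~ J g.
Proof.
rewrite -[g]mul1r => /mul_sat_gen_jacobian[r]; rewrite rmorph1 => /(congr1 (mcoeff 0%MM)).
by rewrite mcoeff_x2M ?mdeg0 // mcoeff1 eqxx => /eqP; rewrite oner_eq0.
Qed.

(** Every monomial of degree d other than x^d contains y or z, so its product with g is in J; for d
    > 1 the product x^d g is in J as well. *)
Lemma sat_gen_reduce d e : e \is d.-homog -> exists c : K, J (e * g - c *: (x ^+ d * g)) /\
  ((1 < d)%N -> c = 0).
Proof.
move=> he; exists (if (1 < d)%N then 0 else e@_(U_(0%R) *+ d)).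
split; last by move=> ->.
rewrite [X in X * g]mpolyE mulr_suml.
case: (ltnP 1 d) => [lt1d|led1].
  rewrite scale0r subr0 big_seq; elim/big_ind: _ => [||m hm].
  - exact: jacobian0.
  - exact: jacobianD.
  rewrite -mul_mpolyC -mulrA; apply: jacobianM; apply: jacobian_mul_sat_gen2.
  by rewrite (dhomog_mf he hm).
have -> : e@_(U_(0%R) *+ d) *: (x ^+ d * g) =
    \sum_(m <- msupp e | m == (U_(0%R) *+ d)%MM) e@_m *: 'X_[m] * g.
  have [hm|hm] := boolP ((U_(0%R) *+ d)%MM \in msupp e).
    rewrite -big_filter filter_pred1_uniq ?msupp_uniq // big_seq1 -mpolyXn.
    by rewrite scalerAl.
  rewrite (memN_msupp_eq0 hm) scale0r big1_seq // => i /andP[/eqP ->].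
  by rewrite (negPf hm).
rewrite [X in _ - X]big_mkcond /= -sumrB big_seq; elim/big_ind: _ => [||m hm].
- exact: jacobian0.
- exact: jacobianD.
case: eqP => [_|ne]; first by rewrite subrr; exact: jacobian0.
rewrite subr0 -mul_mpolyC -mulrA; apply: jacobianM.
suff [i i0 mi] : exists2 i : 'I_3, i != 0 & m i != 0%N.
  rewrite -[m](@submK _ U_(i)%MM) ?lep1mP // mpolyXD -mulrA.
  by apply: jacobianM; exact: jacobian_mul_sat_gen.
have [m1|] := eqVneq (m 1) 0%N; last by exists 1.
have [m2|] := eqVneq (m 2) 0%N; last by exists 2.
case: ne; apply/mnmP => i; rewrite mulmnE mnm1E.
have := dhomog_mf he hm; rewrite /= mdegE sum_ord3 m1 m2 !addr0 => m0.
by elim/forall_ord3: i; rewrite //= ?mul0n ?mul1n.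
Qed.

Lemma sat_gen_basis d (c : K) : (d <= 1)%N -> J (c *: (x ^+ d * g)) -> c = 0.
Proof.
move=> hd; rewrite scalerAl => /mul_sat_gen_jacobian[r].
rewrite linearZ rmorphXn /= comp_var => /(congr1 (mcoeff (U_(0%R) *+ d)%MM)).
rewrite mcoeff_x2M ?mdegMn ?mdeg1 ?mul1n //.
by rewrite mcoeffZ (tnth_nth 0) /= mpolyXn mcoeffX eqxx mulr1.
Qed.

Theorem f49gen_nearly_free : nearly_free f.
Proof.
split.
  exists g; last exact: sat_gen_notin.
  by apply/sat_ideal_saturation; exists 0, 1; rewrite add0r mul1r; split=> //; exact: jacobian0.
move=> m.
(* The degree m part of q = p + e g is taken, which makes e homogeneous of degree m - 70, or 0 when
   m < 70. *)
have split_hom q : saturation J q /\ q \is m.-homog ->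
    exists (e : S) , J (q - e * g) /\ ((70 <= m)%N /\ e \is (m - 70).-homog \/ e = 0).
  move=> [/sat_ideal_saturation[p [e [/jacobianP[p0 [p1 [p2 ->]]] hq]]] homq].
  exists (if (70 <= m)%N then pihomog mdeg (m - 70) e else 0); split; last first.
    by case: ifP => h; [left; split=> //; exact: pihomogP|right].
  rewrite -[X in X - _](pihomog_dE homq) hq !pihomogD.
  rewrite (pihomog_mulr m e sat_gen_homog).
  rewrite (pihomog_mulr m p0 (gen_fx_homog K)) (pihomog_mulr m p1 (gen_fy_homog K)).
  rewrite (pihomog_mulr m p2 (gen_fz_homog K)).
  case: (leqP 70 m) => h; rewrite ?mul0r ?subr0 ?addr0 ?addrK;
    (do 2?[apply: jacobianD]);
    by case: ifP => _; [apply: jacobianM; first [exact: jacobian_fx|exact: jacobian_fy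
      |exact: jacobian_fz]|exact: jacobian0].
(* The quotient is spanned by g in degree 70 and by x g in degree 71, and is 0 in all other degrees.
   The test 70 <= m is separate because m - 70 is truncated. *)
have [/andP[h70 h71]|hm] := boolP ((70 <= m) && (m - 70 <= 1))%N.
  exists 1%N => //; exists (fun=> x ^+ (m - 70) * g); split=> [_|c|v].
  - split; last first.
      by have := dhomogM (dhomog_var K 0 (m - 70)) sat_gen_homog; rewrite subnK.
    by apply/sat_ideal_saturation; exists 0, (x ^+ (m - 70)); rewrite add0r; split=> //;
      exact: jacobian0.
  - by rewrite big_ord1 => /(sat_gen_basis h71) hc i; rewrite ord1.
  - move=> /split_hom[e [hJ he]].
    have {}he : e \is (m - 70).-homog by case: he => [[]//|->]; exact: dhomog0.
    have [c [hc _]] := sat_gen_reduce he; exists (fun=> c); rewrite big_ord1.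
    by rewrite -[X in J X](subrKA (e * g)); apply: jacobianD.
exists 0%N => //; exists (fun=> 0); split=> [[]//|c _ []//|v /split_hom[e [hJ he]]].
exists (fun=> 0); rewrite big_ord0 subr0 -[v](subrK (e * g)); apply: jacobianD => //.
case: he => [[h70 he]|->]; last by rewrite mul0r; exact: jacobian0.
have [c [hc c0]] := sat_gen_reduce he.
by move: hc; rewrite c0 ?scale0r ?subr0 //; move: hm; rewrite h70 /= -ltnNge.
Qed.

End NearlyFree.

(** * Minimal generators of the syzygies and the exponents *)

Definition vec3 T (u0 u1 u2 : T) (i : 'I_3) : T :=
  if i == 0 then u0 else if i == 1 then u1 else u2.

Lemma vec3E T (u0 u1 u2 : T) :
  ((vec3 u0 u1 u2 0 = u0) * (vec3 u0 u1 u2 1 = u1) * (vec3 u0 u1 u2 2 = u2))%type.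
Proof. by []. Qed.

Section Exponents.
Variable K : numFieldType.
Local Notation S := {mpoly K[3]}.
Local Notation x := ('X_0 : S).
Local Notation y := ('X_1 : S).
Local Notation z := ('X_2 : S).
Local Notation A := (f1 K).
Local Notation f := (f49gen K).
Local Notation fx := (gen_fx x y z A).
Local Notation fy := (gen_fy x y z A).
Local Notation fz := (gen_fz x y z A).
Local Notation kappa := (hb_kappa S).
Local Notation a0 := (hb_a0 x A).
Local Notation a1 := (hb_a1 x A).
Local Notation a2 := (hb_a2 x A).
Local Notation b0 := (hb_b0 x y A).
Local Notation b1 := (hb_b1 x y A).
Local Notation b2 := (hb_b2 x y z A).
Local Notation c0 := (hb_c0 x y A).
Local Notation c1 := (hb_c1 x y z A).
Local Notation c2 := (hb_c2 x y z A).
Local Notation h := (845 * 45 * x ^+ 2).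

Lemma gen_fz_neq0 : fz != 0.
Proof.
apply/eqP => /(congr1 (comp_mpoly (at_x0 K))); rewrite rmorph0 comp_fz //.
rewrite (tnth_nth 0) /= -exprM => /eqP; rewrite oppr_eq0 expf_eq0 /=.
by rewrite (negPf (mpolyX_neq0 _ _)).
Qed.

Lemma f49gen_neq0 : f != 0.
Proof.
apply: contraNneq gen_fz_neq0 => f0; by rewrite -f49gen_dz f0 mderiv0.
Qed.

Lemma f49gen_msize : msize f = 50.
Proof.
have hd := dhomog_uniq f49gen_neq0 (f49gen_homog K) (dhomog_msize (f49gen_homog K)).
by rewrite (mpolySpred _ f49gen_neq0) -hd.
Qed.

Lemma syzygyP (r : 'rV[S]_3) : syzygy f r <->
  r ord0 0 * fx + r ord0 1 * fy + r ord0 2 * fz = 0.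
Proof. by rewrite /syzygy sum_ord3 f49gen_dx f49gen_dy f49gen_dz. Qed.

(** Exactness of the Koszul complex of the regular sequence y, z, x^2. Setting y = z = 0 puts [ga]
    into (y, z); what remains is y (al + u h) + z (be + v h) = 0, where y is regular modulo z. *)
Lemma koszul_yzh al be ga : al * y + be * z + ga * h = 0 ->
  exists s u v, [/\ al = z * s - u * h, be = - (y * s) - v * h & ga = y * u + z * v].
Proof.
move=> e; have [u [v hg]] := mod_yz ga.
have g0 : ga \mPo (at_yz0 K) = 0.
  have hy : y \mPo (at_yz0 K) = 0 by rewrite comp_var.
  have hz : z \mPo (at_yz0 K) = 0 by rewrite comp_var.
  have hx : x \mPo (at_yz0 K) = x by rewrite comp_var.
  have hn k : (k%:R : S) \mPo (at_yz0 K) = k%:R by rewrite rmorph_nat.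
  move/(congr1 (comp_mpoly (at_yz0 K))): e.
  rewrite rmorph0 2!rmorphD (rmorphM _ al) (rmorphM _ be) (rmorphM _ ga) /= hy hz !mulr0 !add0r.
  rewrite (rmorphM _ (845 * 45)) rmorphXn (rmorphM _ 845) /= !hn hx => /eqP.
  rewrite mulf_eq0 => /orP[/eqP //|]; rewrite !mulf_eq0.
  by rewrite !(negPf (mpolyX_neq0 _ _)) !(negPf (natr_mpoly_neq0 _ _)).
rewrite g0 addr0 in hg.
have [s hs] : exists s, al + u * h = z * s.
  apply: (@y_dvd_z _ _ (- (be + v * h))).
  by apply/eqP; rewrite -subr_eq0; apply/eqP; rewrite -e hg; ring.
exists s, u, v; split=> //; first by rewrite -hs; ring.
have z0 : z != 0 := mpolyX_neq0 _ _.
apply: (mulfI z0); apply/eqP; rewrite -subr_eq0; apply/eqP.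
transitivity (al * y + be * z + ga * h - y * (al + u * h - z * s)).
  by rewrite hg; ring.
by rewrite e hs subrr mulr0 subr0.
Qed.

(** The Koszul relations of (y, z, h) applied to a, b, c. For instance y b - z a is a syzygy because
    its product with the gradient is y (z g) - z (y g). The degrees are 23 + 1, 23 + 2 and 24 +
    1. *)
Definition syzygy_row (i : 'I_3) : 'rV[S]_3 := \row_j
  vec3 (y * vec3 b0 b1 b2 j - z * vec3 a0 a1 a2 j)
       (h * vec3 a0 a1 a2 j - y * vec3 c0 c1 c2 j)
       (h * vec3 b0 b1 b2 j - z * vec3 c0 c1 c2 j) i.

Lemma syzygy_rowE p q r j : (p *: syzygy_row 0 + q *: syzygy_row 1 + r *: syzygy_row 2) ord0 j =
  (q * h - p * z) * vec3 a0 a1 a2 j + (p * y + r * h) * vec3 b0 b1 b2 j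
  - (q * y + r * z) * vec3 c0 c1 c2 j.
Proof.
rewrite !mxE !vec3E.
move: (vec3 a0 _ _ j) (vec3 b0 _ _ j) (vec3 c0 _ _ j) => ? ? ?; ring.
Qed.


Lemma syzygy_span (r : 'rV[S]_3) : syzygy f r <->
  exists c : 'I_3 -> S, r = \sum_i c i *: syzygy_row i.
Proof.
have [ea eb ec] := sat_gen_relations K.
split=> [/syzygyP hr|[c ->]]; last first.
  rewrite sum_ord3; apply/syzygyP; rewrite !syzygy_rowE !vec3E.
  move: (c 0) (c 1) (c 2) => p q r'.
  transitivity ((q * h - p * z) * (a0 * fx + a1 * fy + a2 * fz)
    + (p * y + r' * h) * (b0 * fx + b1 * fy + b2 * fz)
    - (q * y + r' * z) * (c0 * fx + c1 * fy + c2 * fz)); last by rewrite ea eb ec; ring.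
  move: a0 a1 a2 b0 b1 b2 c0 c1 c2 fx fy fz {ea eb ec} => *; ring.
have [|al [be [ga [h0 h1 h2 /esym h3]]]] := @jacobian_syzygy K (r ord0 0) (r ord0 1) (r ord0 2) 0.
  by rewrite hr mul0r.
have [s [u [v [hal hbe hga]]]] := koszul_yzh h3.
exists (vec3 (- s) (- u) (- v)); rewrite sum_ord3; apply/rowP => j.
rewrite syzygy_rowE !vec3E.
elim/forall_ord3: j; rewrite ?h0 ?h1 ?h2 hal hbe hga !vec3E.
- move: a0 b0 c0 => *; ring.
- move: a1 b1 c1 => *; ring.
- move: a2 b2 c2 => *; ring.
Qed.

Lemma syzygy_row_homog i j :
  syzygy_row i ord0 j \is (tnth [tuple 24; 25; 25] i).-homog.
Proof.
have hx : is_dhomog h 2.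
  exact: (is_dhomogM (is_dhomogM (is_dhomog_natr K 845) (is_dhomog_natr K 45))
    (is_dhomogX 2 (is_dhomog_var K 0))).
have [hy hz] := conj (is_dhomog_var K 1) (is_dhomog_var K 2).
have ha l : is_dhomog (vec3 a0 a1 a2 l) 23.
  by elim/forall_ord3: l; rewrite vec3E; [exact: hb_a0_homog|exact: hb_a1_homog
    |exact: hb_a2_homog].
have hb l : is_dhomog (vec3 b0 b1 b2 l) 23.
  by elim/forall_ord3: l; rewrite vec3E; [exact: hb_b0_homog|exact: hb_b1_homog
    |exact: hb_b2_homog].
have hc l : is_dhomog (vec3 c0 c1 c2 l) 24.
  by elim/forall_ord3: l; rewrite vec3E; [exact: hb_c0_homog|exact: hb_c1_homog
    |exact: hb_c2_homog].
rewrite mxE (tnth_nth 0%N); elim/forall_ord3: i; rewrite vec3E /=; apply: rpredB.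
- exact: (is_dhomogM hy (hb j)).
- exact: (is_dhomogM hz (ha j)).
- exact: (is_dhomogM hx (ha j)).
- exact: (is_dhomogM hy (hc j)).
- exact: (is_dhomogM hx (hb j)).
- exact: (is_dhomogM hz (hc j)).
Qed.

(** The rows satisfy a single relation up to multiples, with coefficients (h, z, -y). None of these
    is a nonzero constant at the origin, which is what minimality requires. *)
Lemma syzygy_row_relation p q r :
    p *: syzygy_row 0 + q *: syzygy_row 1 + r *: syzygy_row 2 = 0 ->
  exists s, [/\ p = h * s, q = z * s & r = - (y * s)].
Proof.
move=> e.
have ej j : (q * h - p * z) * vec3 a0 a1 a2 j
  + (p * y + r * h) * vec3 b0 b1 b2 j
  + (- (q * y + r * z)) * vec3 c0 c1 c2 j = 0.
  by rewrite mulNr -syzygy_rowE e mxE.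
have [] := @hb_injective _ x y z (845 * 45) a0 a1 b0 b1 c0 c1 (q * h - p * z) (p * y + r * h)
  (- (q * y + r * z)) (ej 0) (ej 1).
  by ring.
rewrite (hb_identity_z (f1E K)) => e1 _ e3.
have F0 : kappa * fz != 0.
  rewrite mulf_neq0 ?gen_fz_neq0 // hb_kappaE mpolyC_eq0; exact: hb_kappa_neq0.
have {}e1 : q * h - p * z = 0 by move/eqP: e1; rewrite mulf_eq0 (negPf F0) => /eqP.
have {}e3 : q * y + r * z = 0.
  by move/eqP: e3; rewrite mulf_eq0 (negPf F0) oppr_eq0 => /eqP.
have [s hs] : exists s, q = z * s.
  by apply: (@y_dvd_z _ _ (- r)); rewrite mulrN mulrC [z * r]mulrC; apply/eqP;
    rewrite -addr_eq0; apply/eqP.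
have z0 : z != 0 := mpolyX_neq0 _ _.
exists s; split=> //; apply: (mulfI z0); apply/eqP; rewrite -subr_eq0; apply/eqP.
  transitivity (- (q * h - p * z)); last by rewrite e1 oppr0.
  by rewrite hs; ring.
transitivity (q * y + r * z); last by rewrite e3.
by rewrite hs; ring.
Qed.

Theorem f49gen_exponents : exponents f 24 25 25.
Proof.
split=> //; first by rewrite f49gen_msize.
exists syzygy_row; first exact: syzygy_row_homog.
split=> [v|s].
  rewrite syzygy_span; split=> [[c ->]|[c ->]]; exists c; apply: eq_big => // i;
    by rewrite inE.
move=> /properP[_ [i _ is_]] hs.
(* If the rows in s generated, row i would be a combination of the others; this relation has
   coefficient -1 at i, against the vanishing of all coefficients at the origin. *)
have [c hc] : exists c : 'I_3 -> S, syzygy_row i = \sum_(j in s) c j *: syzygy_row j.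
  apply/hs/syzygy_span; exists (fun j => (j == i)%:R).
  rewrite (bigD1 i) //= eqxx scale1r big1 ?addr0 // => j /negbTE ->.
  by rewrite scale0r.
pose d j := (if j \in s then c j else 0) - (j == i)%:R.
have d0 : d 0 *: syzygy_row 0 + d 1 *: syzygy_row 1 + d 2 *: syzygy_row 2 = 0.
  rewrite -(sum_ord3 (fun j => d j *: syzygy_row j)).
  rewrite (eq_bigr (fun j => (if j \in s then c j *: syzygy_row j else 0)
    - (j == i)%:R *: syzygy_row j)) => [|j _]; last first.
    by rewrite /d scalerBl; case: ifP; rewrite ?scale0r.
  rewrite sumrB -big_mkcond -hc (bigD1 i) //= eqxx scale1r big1 ?addr0 ?subrr //.
  by move=> j /negbTE ->; rewrite scale0r.
have [t [t0 t1 t2]] := syzygy_row_relation d0.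
have di : (d i).@[fun=> 0] = -1.
  by rewrite /d (negPf is_) eqxx sub0r mevalN meval1.
suff : (d i).@[fun=> 0] = 0.
  by rewrite di => /eqP; rewrite oppr_eq0 oner_eq0.
elim/forall_ord3: i {is_ hc d0 di} @d t0 t1 t2 => d t0 t1 t2.
- by rewrite t0 (mevalM _ _ t) (mevalM _ _ (x ^+ 2)) rmorphXn /= mevalXU expr0n mulr0 mul0r.
- by rewrite t1 mevalM mevalXU mul0r.
- by rewrite t2 mevalN mevalM mevalXU mul0r oppr0.
Qed.

End Exponents.

(** * Convergent power series *)

Section Germs.
Variable K : numFieldType.
Local Notation O := (cseries2 K).
Local Notation R2 := {mpoly K[2]}.
Implicit Types a b c : O.

Definition coef2 a (i j : nat) : K := csval a i j.

Local Arguments coef2 : simpl never.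
Local Arguments germ : simpl never.

Lemma cseries2P a b : (forall i j, coef2 a i j = coef2 b i j) -> a = b.
Proof. by move=> h; apply/val_inj/funext => i; apply/funext => j; exact: h. Qed.

Lemma cseries2_0 i j : coef2 0 i j = 0. Proof. by []. Qed.

Lemma cseries2_1 i j : coef2 1 i j = ((i == 0%N) && (j == 0%N))%:R. Proof. by []. Qed.

Lemma cseries2D a b i j : coef2 (a + b) i j = coef2 a i j + coef2 b i j. Proof. by []. Qed.

Lemma cseries2N a i j : coef2 (- a) i j = - coef2 a i j. Proof. by []. Qed.

Lemma cseries2B a b i j : coef2 (a - b) i j = coef2 a i j - coef2 b i j. Proof. by []. Qed.

Lemma cseries2M a b i j : coef2 (a * b) i j =
  \sum_(k < i.+1) \sum_(l < j.+1) coef2 a k l * coef2 b (i - k) (j - l).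
Proof. by []. Qed.

Lemma cseries2Z (k : K) a i j : coef2 (k *: a) i j = k * coef2 a i j. Proof. by []. Qed.

Lemma cseries2_sum J (r : seq J) (P : pred J) (F : J -> O) i j :
  coef2 (\sum_(l <- r | P l) F l) i j = \sum_(l <- r | P l) coef2 (F l) i j.
Proof. by elim/big_rec2: _ => // l y1 y2 _ <-. Qed.

Lemma cseries2_scaleAl (k : K) a b : k *: a * b = k *: (a * b).
Proof.
apply: cseries2P => i j; rewrite cseries2Z !cseries2M mulr_sumr.
apply: eq_bigr => l _; rewrite mulr_sumr; apply: eq_bigr => l' _.
by rewrite cseries2Z mulrA.
Qed.

Definition mnm2 (i j : nat) : 'X_{1..2} := [multinom [tuple i; j]].

Lemma mnm2E i j : ((mnm2 i j 0 = i) * (mnm2 i j 1 = j))%type.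
Proof. by rewrite !(mnm_nth 0%N). Qed.

Lemma mnm2_eta (m : 'X_{1..2}) : m = mnm2 (m 0) (m 1).
Proof. by apply/mnmP; elim/forall_ord2; rewrite mnm2E. Qed.

Lemma mnm2D i j k l : (mnm2 i j + mnm2 k l)%MM = mnm2 (i + k) (j + l).
Proof. by apply/mnmP; elim/forall_ord2; rewrite mnmDE !mnm2E. Qed.

Lemma mnm2_eq i j k l : (mnm2 i j == mnm2 k l) = (i == k) && (j == l).
Proof.
apply/eqP/andP => [e|[/eqP -> /eqP ->] //].
by rewrite -(mnm2E i j).1 -{2}(mnm2E i j).2 e !mnm2E.
Qed.

Lemma germE (p : R2) i j : coef2 (germ p) i j = p@_(mnm2 i j). Proof. by []. Qed.

Lemma germ_is_additive : {morph @germ K : p q / p - q}.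
Proof. by move=> p q; apply: cseries2P => i j; rewrite !germE mcoeffB. Qed.

HB.instance Definition _ := GRing.isZmodMorphism.Build R2 O (@germ K) germ_is_additive.

Lemma germZ (k : K) p : germ (k *: p) = k *: germ p.
Proof. by apply: cseries2P => i j; rewrite !germE mcoeffZ. Qed.

Lemma germ_monomM i j a k l : coef2 (germ 'X_[mnm2 i j] * a) k l =
  if (i <= k)%N && (j <= l)%N then coef2 a (k - i) (l - j) else 0.
Proof.
rewrite cseries2M.
under eq_bigr do under eq_bigr do rewrite germE mcoeffX mnm2_eq.
case: (leqP i k) => [le_ik|lt_ki] /=; last first.
  rewrite big1 // => k' _; rewrite big1 // => l' _.
  by rewrite [i == _]gtn_eqF ?mul0r // (leq_trans (ltn_ord k')).
rewrite (bigD1 (Ordinal (le_ik : (i < k.+1)%N))) //= [X in _ + X]big1 ?addr0; last first.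
  move=> k' /eqP ne; rewrite big1 // => l' _; case: eqP => [e|_]; last by rewrite mul0r.
  by case: ne; apply/val_inj; rewrite /= e.
case: (leqP j l) => [le_jl|lt_lj]; last first.
  rewrite big1 // => l' _; rewrite [j == _]gtn_eqF ?andbF ?mul0r //.
  by rewrite (leq_trans (ltn_ord l')).
rewrite (bigD1 (Ordinal (le_jl : (j < l.+1)%N))) //= [X in _ + X]big1 ?addr0.
  by rewrite !eqxx mul1r.
move=> l' /eqP ne; case: (j =P _) => [e|_]; last by rewrite andbF mul0r.
by case: ne; apply/val_inj; rewrite /= e.
Qed.

Lemma germ_monom i j k l : coef2 (germ 'X_[mnm2 i j]) k l = ((i == k) && (j == l))%:R.
Proof. by rewrite germE mcoeffX mnm2_eq. Qed.

Lemma germ_is_multiplicative : monoid_morphism (@germ K).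
Proof.
split; first by apply: cseries2P => i j; rewrite germE mcoeff1 (mnm2_eta 0%MM) mnm2_eq
  !mnm0E cseries2_1.
move=> p q; rewrite [p]mpolyE mulr_suml !raddf_sum mulr_suml.
apply: eq_bigr => m _ /=; rewrite -scalerAl !germZ cseries2_scaleAl; congr (_ *: _).
apply: cseries2P => i j; rewrite [m]mnm2_eta germ_monomM germE.
case: ifP => [/andP[le_i le_j]|/negP h].
  have -> : mnm2 i j = (mnm2 (m 0%R) (m 1%R) + mnm2 (i - m 0%R) (j - m 1%R))%MM.
    by rewrite mnm2D !subnKC.
  by rewrite mulrC mcoeffMX.
apply: contra_notP h => /eqP; rewrite -mcoeff_msupp => /msuppM_le /allpairsP.
move=> [[u v] /= [hu _ e]]; move: hu; rewrite msuppX inE => /eqP hu.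
move/(congr1 (fun m : 'X_{1..2} => (m 0, m 1))): e; rewrite hu !mnmDE !mnm2E.
by move=> [-> ->]; rewrite !leq_addr.
Qed.

HB.instance Definition _ :=
  GRing.isMonoidMorphism.Build R2 O (@germ K) germ_is_multiplicative.

Definition shift_series (N M : nat) (s : series2 K) : series2 K :=
  fun i j => s (i + N)%N (j + M)%N.

Lemma shift_series_conv N M (a : O) : shift_series N M a \in @convergent K.
Proof.
have /convergentP[C [r [C0 r1 h]]] := valP a.
apply/asboolP; exists (C * r ^+ (N + M)), r => i j.
by rewrite -mulrA -exprD [(N + M + _)%N]addnC addnACA; exact: h.
Qed.

Definition shift (N M : nat) (a : O) : O := CSeries2 (shift_series_conv N M a).

Lemma shiftE N M a i j : coef2 (shift N M a) i j = coef2 a (i + N) (j + M). Proof. by []. Qed.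

Definition truncate (N M : nat) (a : O) : R2 :=
  \sum_(i < N) \sum_(j < M) coef2 a i j *: 'X_[mnm2 i j].

Lemma truncateE N M a i j : coef2 (germ (truncate N M a)) i j =
  if (i < N)%N && (j < M)%N then coef2 a i j else 0.
Proof.
rewrite /truncate raddf_sum cseries2_sum.
rewrite (eq_bigr (fun k : 'I_N => \sum_(l < M)
    coef2 a k l * (((k : nat) == i) && ((l : nat) == j))%:R)); last first.
  move=> k _; rewrite raddf_sum cseries2_sum; apply: eq_bigr => l _ /=.
  by rewrite germZ cseries2Z germ_monom.
case: (ltnP i N) => [lt_iN|le_Ni] /=; last first.
  rewrite big1 // => k _; rewrite big1 // => l _.
  by rewrite [_ == i]ltn_eqF ?mulr0 // (leq_trans (ltn_ord k)).
rewrite (bigD1 (Ordinal lt_iN)) //= [X in _ + X]big1 ?addr0; last first.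
  move=> k /eqP ne; rewrite big1 // => l _; case: eqP => [e|_]; last by rewrite mulr0.
  by case: ne; apply/val_inj.
case: (ltnP j M) => [lt_jM|le_Mj]; last first.
  rewrite big1 // => l _.
  by rewrite [_ == j]ltn_eqF ?andbF ?mulr0 // (leq_trans (ltn_ord l)).
rewrite (bigD1 (Ordinal lt_jM)) //= [X in _ + X]big1 ?addr0.
  by rewrite !eqxx mulr1.
move=> l /eqP ne; case: (_ =P j) => [e|_]; last by rewrite andbF mulr0.
by case: ne; apply/val_inj.
Qed.

(** As powers of x and y lie in the Jacobian ideal, this replaces germs by polynomials modulo that
    ideal. *)
Lemma series_truncate N M a : exists b c,
  a = germ (truncate N M a) + germ ('X_0 ^+ N) * b + germ ('X_1 ^+ M) * c.
Proof.
have X0 : 'X_0 ^+ N = 'X_[mnm2 N 0] :> R2.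
  rewrite mpolyXn; congr 'X_[_]; apply/mnmP.
  by elim/forall_ord2; rewrite mulmnE mnm1E mnm2E ?mul1n ?mul0n.
have X1 : 'X_1 ^+ M = 'X_[mnm2 0 M] :> R2.
  rewrite mpolyXn; congr 'X_[_]; apply/mnmP.
  by elim/forall_ord2; rewrite mulmnE mnm1E mnm2E ?mul1n ?mul0n.
pose b := shift N 0 a; exists b.
exists (shift 0 M (a - germ 'X_[mnm2 N 0] * b)).
apply: cseries2P => i j; rewrite X0 X1 !cseries2D !germ_monomM truncateE !leq0n !andbT.
rewrite !shiftE !subn0 !addn0 cseries2B germ_monomM /= leq0n andbT subn0 shiftE addn0.
case: (leqP N i) => [le_Ni|lt_iN] /=.
  by case: (leqP M j) => h; rewrite add0r ?subnK // ?subrr ?addr0.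
by case: (leqP M j) => h; rewrite ?subnK // ?subr0 ?addr0 ?add0r.
Qed.

(* A polynomial in the ideal (u^N, v^M) of the power series ring is in the
   polynomial ideal (u^N, v^M), as the latter is a monomial ideal. *)
Lemma germ_monomial_ideal N M (p : R2) b c :
  germ p = germ ('X_0 ^+ N) * b + germ ('X_1 ^+ M) * c ->
  exists q r, p = 'X_0 ^+ N * q + 'X_1 ^+ M * r.
Proof.
have X0 : 'X_0 ^+ N = 'X_[mnm2 N 0] :> R2.
  rewrite mpolyXn; congr 'X_[_]; apply/mnmP.
  by elim/forall_ord2; rewrite mulmnE mnm1E mnm2E ?mul1n ?mul0n.
have X1 : 'X_1 ^+ M = 'X_[mnm2 0 M] :> R2.
  rewrite mpolyXn; congr 'X_[_]; apply/mnmP.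
  by elim/forall_ord2; rewrite mulmnE mnm1E mnm2E ?mul1n ?mul0n.
rewrite X0 X1 => e.
rewrite [p]mpolyE big_seq.
elim/big_ind: _ => [||m].
- by exists 0, 0; rewrite !mulr0 addr0.
- move=> _ _ [q [r ->]] [q' [r' ->]]; exists (q + q'), (r + r').
  by rewrite !mulrDr addrACA.
move=> hm; have {hm} : (N <= m 0%R)%N || (M <= m 1%R)%N.
  apply: contraTT hm; rewrite negb_or -!ltnNge => /andP[h0 h1].
  rewrite -mcoeff_eq0 [m]mnm2_eta -germE e cseries2D !germ_monomM.
  by rewrite leqNgt h0 [(M <= _)%N]leqNgt h1 /= addr0.
move=> /orP[le_N|le_M].
  exists (p@_m *: 'X_[mnm2 (m 0 - N) (m 1)]), 0.
  by rewrite mulr0 addr0 -scalerAr -mpolyXD mnm2D subnKC // add0n -mnm2_eta.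
exists 0, (p@_m *: 'X_[mnm2 (m 0) (m 1 - M)]).
by rewrite mulr0 add0r -scalerAr -mpolyXD mnm2D subnKC // add0n -mnm2_eta.
Qed.

End Germs.

Arguments coef2 : simpl never.
Arguments germ : simpl never.

Lemma sum_ord2 (V : nmodType) (F : 'I_2 -> V) : \sum_i F i = F 0 + F 1.
Proof.
rewrite !big_ord_recl big_ord0 addr0.
by congr (_ + F _); apply/val_inj.
Qed.

(** * Dehomogenization at P *)

Section Dehomogenization.
Variable K : numFieldType.
Local Notation S := {mpoly K[3]}.
Local Notation R2 := {mpoly K[2]}.
Implicit Types (p q : S) (m : 'X_{1..3}).

Definition dehom : S -> R2 := comp_mpoly [tuple 'X_0; 'X_1; 1].

Arguments dehom : simpl never.

HB.instance Definition _ := GRing.RMorphism.on dehom.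
HB.instance Definition _ := GRing.Linear.on dehom.

Definition mnm3 (i j k : nat) : 'X_{1..3} := [multinom [tuple i; j; k]].

Lemma mnm3E i j k :
  ((mnm3 i j k 0%R = i) * (mnm3 i j k 1%R = j) * (mnm3 i j k 2%R = k))%type.
Proof. by rewrite !(mnm_nth 0%N). Qed.

Lemma mnm3_eta m : m = mnm3 (m 0%R) (m 1%R) (m 2%R).
Proof. by apply/mnmP; elim/forall_ord3; rewrite mnm3E. Qed.

Lemma mdeg3 m : mdeg m = (m 0%R + m 1%R + m 2%R)%N.
Proof. by rewrite mdegE sum_ord3. Qed.

Lemma mdeg2 (m : 'X_{1..2}) : mdeg m = (m 0%R + m 1%R)%N.
Proof. by rewrite mdegE sum_ord2. Qed.

Lemma dehom_var : ((dehom 'X_0 = 'X_0) * (dehom 'X_1 = 'X_1) * (dehom 'X_2 = 1))%type.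
Proof. by rewrite /dehom !comp_mpolyXU. Qed.

Lemma dehom_monom m : dehom 'X_[m] = 'X_[mnm2 (m 0%R) (m 1%R)].
Proof.
have vX (i : 'I_3) : dehom 'X_i = tnth [tuple 'X_0; 'X_1; 1] i.
  by rewrite /dehom comp_mpolyXU (tnth_nth 0).
rewrite /dehom comp_mpolyX !big_ord_recl big_ord0 mulr1 !(tnth_nth 0) /=.
rewrite expr1n mulr1 !mpolyXn -mpolyXD; congr 'X_[_]; apply/mnmP.
elim/forall_ord2; rewrite mnmDE !mulmnE !mnm1E mnm2E /= ?mul1n ?mul0n ?addn0 ?add0n;
  by congr (m _); apply/val_inj.
Qed.

(** In a fixed degree the exponent of z is determined by those of x and y, so distinct monomials
    stay distinct. *)
Lemma dehom_homog_inj n p : p \is n.-homog -> dehom p = 0 -> p = 0.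
Proof.
move=> hp p0; apply/mpolyP => m; rewrite mcoeff0.
have [hm|hm] := boolP (m \in msupp p); last exact: memN_msupp_eq0.
have := congr1 (mcoeff (mnm2 (m 0%R) (m 1%R))) p0; rewrite mcoeff0 => <-.
rewrite [p in RHS]mpolyE (raddf_sum dehom) (raddf_sum (mcoeff _)) /= (bigD1_seq m) ?msupp_uniq //=.
rewrite linearZ /= mcoeffZ dehom_monom mcoeffX eqxx mulr1 big1_seq ?addr0 //.
move=> m' /andP[ne hm']; rewrite linearZ /= mcoeffZ dehom_monom mcoeffX mnm2_eq.
case: andP => [[/eqP e0 /eqP e1]|_]; last by rewrite mulr0.
have := dhomog_mf hp hm; rewrite -(dhomog_mf hp hm') /= !mdeg3 e0 e1 => /addnI e2.
by case/eqP: ne; rewrite [m]mnm3_eta [m']mnm3_eta e0 e1 e2.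
Qed.

Lemma dehom_surj n (r : R2) : (msize r <= n)%N -> exists2 p, p \is n.-homog & dehom p = r.
Proof.
move=> hn.
exists (\sum_(m <- msupp r) r@_m *: 'X_[mnm3 (m 0%R) (m 1%R) (n - mdeg m)]).
  rewrite big_seq; apply: rpred_sum => m /msize_mdeg_lt hm; apply: rpredZ.
  by rewrite dhomogX /= mdeg3 !mnm3E -mdeg2 subnKC // ltnW // (leq_trans hm).
rewrite raddf_sum [RHS]mpolyE; apply: eq_bigr => m _ /=.
by rewrite linearZ /= dehom_monom !mnm3E -mnm2_eta.
Qed.

Lemma dehom_mderiv (i : 'I_3) (j : 'I_2) p : (i = j :> nat) ->
  (dehom p)^`M(j) = dehom p^`M(i).
Proof.
move=> ij; rewrite [p]mpolyE (raddf_sum dehom) (raddf_sum (mderiv j)).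
rewrite (raddf_sum (mderiv i)) (raddf_sum dehom); apply: eq_bigr => m _ /=.
rewrite mderivZ !linearZ /= mderivX linearZ /= !dehom_monom mderivX.
congr (_ *: (_ *: 'X_[_])).
  by congr (_%:R); move: i j ij; elim/forall_ord3; elim/forall_ord2 => //= _; rewrite mnm2E.
apply/mnmP; move: i j ij; elim/forall_ord3; elim/forall_ord2 => //= _;
  by elim/forall_ord2; rewrite mnmBE !mnm1E !mnm2E mnmBE mnm1E.
Qed.

Lemma pivot001 : pivot (point001 K) = ord_max.
Proof.
rewrite /pivot; case: pickP => [k /andP[h _]|/(_ ord_max)] /=.
  by apply/eqP; apply: contraNT h => /negbTE; rewrite !mxE eqxx /= => ->.
rewrite !mxE !eqxx oner_eq0 /= => /negbT /forallPn[j].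
by rewrite negb_imply ltnNge -ltnS ltn_ord.
Qed.

Lemma local_equation001 p : local_equation p (point001 K) = dehom p.
Proof.
rewrite /local_equation /dehom; congr (_ \mPo _); apply: eq_from_tnth => i.
rewrite tnth_mktuple pivot001.
have u0 : unlift ord_max (0 : 'I_3) = Some (0 : 'I_2).
  by rewrite (_ : 0 = lift ord_max (0 : 'I_2)) ?liftK //; apply/val_inj.
have u1 : unlift ord_max (1 : 'I_3) = Some (1 : 'I_2).
  by rewrite (_ : 1 = lift ord_max (1 : 'I_2)) ?liftK //; apply/val_inj.
have u2 : unlift ord_max (2 : 'I_3) = None :> option 'I_2.
  by rewrite (_ : 2 = ord_max) ?unlift_none //; apply/val_inj.
elim/forall_ord3: i; rewrite ?u0 ?u1 ?u2 (tnth_nth 0) //= !mxE /=;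
  by rewrite mpolyC0 add0r.
Qed.

End Dehomogenization.

Arguments dehom : simpl never.

(** * The Tjurina number *)

Section LinearAlgebra.
Variables (K : fieldType) (U V W X : vectType K).

Lemma dim_prod : dim (U * V)%type = (dim U + dim V)%N. Proof. by []. Qed.

Lemma dim_regular : dim K^o = 1%N. Proof. by []. Qed.

Lemma dim_compl_limg (T : {linear U -> V}) : (forall w, T w = 0 -> w = 0) ->
  \dim (limg (linfun T))^C = (dim V - dim U)%N.
Proof.
move=> inj; rewrite dimv_compl dimvf limg_dim_eq ?dimvf //.
apply/eqP; rewrite -subv0 capfv; apply/subvP => w.
by rewrite memv_ker lfunE memv0 => /eqP/inj ->.
Qed.

(** [F] embeds the kernel of [T] into the image of [H], so the kernel has dimension at most dim X
    and the rank of [T] is at least dim U - dim X. An upper bound on the kernel thus proves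
    surjectivity. *)
Lemma linear_surj_of_dim (T : {linear U -> V}) (F : {linear U -> W}) (H : {linear X -> W}) :
    (forall w, T w = 0 -> F w = 0 -> w = 0) ->
    (forall w, T w = 0 -> exists v, F w = H v) ->
  (dim X + dim V <= dim U)%N -> forall p, exists w, T w = p.
Proof.
move=> inj im le_dim p.
have kF : (lker (linfun T) :&: lker (linfun F) = 0)%VS.
  apply/eqP; rewrite -subv0; apply/subvP => w; rewrite memv_cap !memv_ker !lfunE /=.
  by rewrite memv0 => /andP[/eqP e /eqP eF]; rewrite (inj w).
have dk : (\dim (lker (linfun T)) <= dim X)%N.
  rewrite -(limg_ker_dim (linfun F) (lker _)) kF dimv0 add0n.
  rewrite -(dimvf X) -(limg_ker_dim (linfun H) fullv); apply: leq_trans (leq_addl _ _).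
  apply: dimvS; apply/subvP => _ /memv_imgP[w hw ->].
  move: hw; rewrite memv_ker lfunE /= => /eqP/im[v hv].
  by rewrite lfunE /= hv -lfunE memv_img // memvf.
have : limg (linfun T) = fullv.
  apply/eqP; rewrite eqEdim subvf /= -(leq_add2l (\dim (lker (linfun T)))).
  have := limg_ker_dim (linfun T) fullv; rewrite capfv => ->.
  by rewrite !dimvf; apply: leq_trans le_dim; rewrite leq_add2r.
move=> full; have : p \in limg (linfun T) by rewrite full memvf.
by move=> /memv_imgP[w _ ->]; exists w; rewrite lfunE.
Qed.

End LinearAlgebra.

(** * Dimension counts in degrees 70 and 71 *)

Section HilbertFunction.
Variable K : numFieldType.
Local Notation S := {mpoly K[3]}.
Local Notation x := ('X_0 : S).
Local Notation y := ('X_1 : S).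
Local Notation z := ('X_2 : S).
Local Notation A := (f1 K).
Local Notation f := (f49gen K).
Local Notation fx := (gen_fx x y z A).
Local Notation fy := (gen_fy x y z A).
Local Notation fz := (gen_fz x y z A).
Local Notation J := (jacobian_ideal f).
Local Notation g := (sat_gen K).
Variables (E : nat -> vectType K) (toS : forall d, {linear E d -> S}).
Variable ofS : forall d (p : S), p \is d.-homog -> E d.
Local Notation mp := (toS _).
Hypothesis mp_inj : forall d, injective (toS d).
Hypothesis mp_homog : forall d (u : E d), toS d u \is d.-homog.
Hypothesis ofSK : forall d p (h : p \is d.-homog), toS d (ofS h) = p.
Hypothesis dim_dhomog : forall d, dim (E d) = (d.+2 * d.+1)./2.
Local Notation a0 := (hb_a0 x A).
Local Notation a1 := (hb_a1 x A).
Local Notation a2 := (hb_a2 x A).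
Local Notation b0 := (hb_b0 x y A).
Local Notation b1 := (hb_b1 x y A).
Local Notation b2 := (hb_b2 x y z A).
Local Notation c0 := (hb_c0 x y A).
Local Notation c1 := (hb_c1 x y z A).
Local Notation c2 := (hb_c2 x y z A).

Lemma grad_combination_homog d (p0 p1 p2 : S) :
  p0 \is d.-homog -> p1 \is d.-homog -> p2 \is d.-homog ->
  p0 * fx + p1 * fy + p2 * fz \is (d + 48).-homog.
Proof.
move=> h0 h1 h2; apply: rpredD; [apply: rpredD|].
- exact: dhomogM h0 (gen_fx_homog K).
- exact: dhomogM h1 (gen_fy_homog K).
- exact: dhomogM h2 (gen_fz_homog K).
Qed.

Lemma relations70_homog (w : (E 22 * E 22 * E 22 * K^o)%type) :
  mp w.1.1.1 * fx + mp w.1.1.2 * fy + mp w.1.2 * fz + w.2 *: g \is 70.-homog.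
Proof.
apply: rpredD; last by apply: dhomogZ; exact: sat_gen_homog.
by apply: (@grad_combination_homog 22); exact: mp_homog.
Qed.

(** The image of this map is the degree 70 part of J + (g). *)
Definition relations70 w : E 70 := ofS (relations70_homog w).

Lemma relations70_linear : linear relations70.
Proof.
move=> k u v; apply: mp_inj; rewrite linearP /= !ofSK /= !linearP /=.
by rewrite -!mul_mpolyC !rmorphD !rmorphM /=; ring.
Qed.

HB.instance Definition _ := GRing.isLinear.Build K _ _ _ relations70 relations70_linear.

(** A relation would be a combination of a, b, c, whose degrees 23, 23, 24 exceed 22; so the first
    three entries vanish, and then g <> 0 kills the last one. *)
Lemma relations70_inj w : relations70 w = 0 -> w = 0.
Proof.
move=> /(congr1 mp); rewrite ofSK linear0 => e.
have [|al [be [ga [h0 h1 h2 _]]]] := @jacobian_syzygy K (mp w.1.1.1) (mp w.1.1.2) (mp w.1.2) (- (w.2 : K)%:MP).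
  by rewrite mulNr mul_mpolyC; apply/eqP; rewrite -addr_eq0; apply/eqP.
have z22 (p : E 22) (q0 q1 q2 : S) : is_dhomog q0 23 -> is_dhomog q1 23 -> is_dhomog q2 24 ->
    mp p = al * q0 + be * q1 + ga * q2 -> p = 0.
  move=> i0 i1 i2 hp; apply: mp_inj; rewrite linear0 -(pihomog_dE (mp_homog p)) hp !pihomogD.
  by rewrite (pihomog_mulr _ _ i0) (pihomog_mulr _ _ i1) (pihomog_mulr _ _ i2) !addr0.
move/z22: h0 => /(_ (hb_a0_homog K) (hb_b0_homog K) (hb_c0_homog K)) h0.
move/z22: h1 => /(_ (hb_a1_homog K) (hb_b1_homog K) (hb_c1_homog K)) h1.
move/z22: h2 => /(_ (hb_a2_homog K) (hb_b2_homog K) (hb_c2_homog K)) h2.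
move: e; rewrite h0 h1 h2 !linear0 !mul0r !add0r => /eqP; rewrite mscalerI.
have g0 : g != 0.
  by apply/eqP => g0; apply: (@sat_gen_notin K); rewrite g0; exact: jacobian0.
rewrite (negPf g0) orbF => /eqP h3.
by move: h0 h1 h2 h3; case: w => [[[w0 w1] w2] w3] /= -> -> -> ->.
Qed.

Definition standard70 : {vspace E 70} := (limg (linfun relations70))^C%VS.

(** 72 * 71 / 2 - 3 * (24 * 23 / 2) - 1 = 2556 - 828 - 1. *)
Lemma dim_standard70 : \dim standard70 = 1727.
Proof.
rewrite /standard70 (dim_compl_limg relations70_inj) !dim_prod dim_regular !dim_dhomog.
by vm_compute.
Qed.

Local Notation D71 := (E 70 * (E 23 * E 23 * E 23) * E 1)%type.

Lemma relations71_homog (w : D71) :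
  z * mp w.1.1 + (mp w.1.2.1.1 * fx + mp w.1.2.1.2 * fy + mp w.1.2.2 * fz) + mp w.2 * g \is 71.-homog.
Proof.
apply: rpredD; last exact: dhomogM (mp_homog w.2) (sat_gen_homog K).
apply: rpredD; first exact: dhomogM (dhomog_var K 2 1) (mp_homog w.1.1).
by apply: (@grad_combination_homog 23); exact: mp_homog.
Qed.

(** Surjectivity of this map means that multiplication by z from degree 70 to degree 71 is onto
    modulo J + (g). *)
Definition relations71 w : E 71 := ofS (relations71_homog w).

Lemma relations71_linear : linear relations71.
Proof.
move=> k u v; apply: mp_inj; rewrite linearP /= !ofSK /= !linearP /=.
by rewrite -!mul_mpolyC; ring.
Qed.

HB.instance Definition _ := GRing.isLinear.Build K _ _ _ relations71 relations71_linear.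

Local Notation D23 := (K^o * K^o * (E 22 * E 22 * E 22) * K^o)%type.

Lemma syzygies23_homog (q0 q1 : S) (s t : K) (r : E 22) :
  is_dhomog q0 23 -> is_dhomog q1 23 -> s *: q0 + t *: q1 + z * mp r \is 23.-homog.
Proof.
move=> h0 h1; apply: rpredD; last exact: dhomogM (dhomog_var K 2 1) (mp_homog r).
by apply: rpredD; apply: dhomogZ.
Qed.

Lemma syzygies1_homog (s t r : K) : - (s *: y + t *: z + r *: z) \is 1.-homog.
Proof.
rewrite rpredN; apply: rpredD; [apply: rpredD|]; apply: dhomogZ;
  exact: (dhomog_var K _ 1).
Qed.

(** Parametrizes the relations modulo z in degree 23: constant multiples of a and b, no multiple of
    c for reasons of degree, and z times arbitrary entries. The last component is the matching
    coefficient of g. *)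
Definition syzygies23 (w : D23) : E 23 * E 23 * E 23 * E 1 :=
  (ofS (syzygies23_homog w.1.1.1 w.1.1.2 w.1.2.1.1 (hb_a0_homog K) (hb_b0_homog K)),
   ofS (syzygies23_homog w.1.1.1 w.1.1.2 w.1.2.1.2 (hb_a1_homog K) (hb_b1_homog K)),
   ofS (syzygies23_homog w.1.1.1 w.1.1.2 w.1.2.2 (hb_a2_homog K) (hb_b2_homog K)),
   ofS (syzygies1_homog w.1.1.1 w.1.1.2 w.2)).

Lemma syzygies23_linear : linear syzygies23.
Proof.
move=> k u v; congr (_, _, _, _); apply: mp_inj; rewrite linearP /= !ofSK /= ?linearP /=;
  rewrite !ofSK -!mul_mpolyC !rmorphD !rmorphM /=; ring.
Qed.

HB.instance Definition _ := GRing.isLinear.Build K _ _ _ syzygies23 syzygies23_linear.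

Definition forget70 (w : D71) : E 23 * E 23 * E 23 * E 1 := (w.1.2, w.2).

Lemma forget70_linear : linear forget70. Proof. by []. Qed.

HB.instance Definition _ := GRing.isLinear.Build K _ _ _ forget70 forget70_linear.

Lemma dhomog0_const (p : S) : p \is 0.-homog -> p = (p@_0%MM)%:MP.
Proof.
move=> hp; apply/mpolyP => m; rewrite mcoeffC.
have [->|ne] := eqVneq m 0%MM; first by rewrite mulr1.
by rewrite mulr0; apply: (dhomog_nemf_coeff hp); rewrite /= mdeg_eq0.
Qed.

(** [jacobian_syzygy_z] describes the kernel, and taking the parts of degree 23 and 1 leaves only
    the constant terms of [al], [be] and [r]. *)
Lemma relations71_kernel w : relations71 w = 0 -> exists v, forget70 w = syzygies23 v.
Proof.
move=> /(congr1 mp); rewrite ofSK linear0 => e.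
have [|al [be [ga [r0 [r1 [r2 [r [h0 h1 h2 h3]]]]]]]] :=
    @jacobian_syzygy_z K (mp w.1.2.1.1) (mp w.1.2.1.2) (mp w.1.2.2) (- mp w.2) (- mp w.1.1).
  apply/eqP; rewrite -subr_eq0; apply/eqP; rewrite -[RHS]e; ring.
pose cst (p : S) := (pihomog mdeg 0 p)@_0%MM.
have cstE p : pihomog mdeg 0 p = (cst p)%:MP by apply: dhomog0_const; exact: pihomogP.
pose hom22 (p : S) : E 22 := ofS (pihomogP mdeg 22 p).
exists (cst al, cst be, (hom22 r0, hom22 r1, hom22 r2), cst r).
have red (p : E 23) (q0 q1 q2 r' : S) : is_dhomog q0 23 -> is_dhomog q1 23 -> is_dhomog q2 24 ->
    mp p = al * q0 + be * q1 + ga * q2 + z * r' ->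
    mp p = cst al *: q0 + cst be *: q1 + z * pihomog mdeg 22 r'.
  move=> i0 i1 i2 hp; rewrite -(pihomog_dE (mp_homog p)) hp !pihomogD.
  rewrite (pihomog_mulr _ _ i0) (pihomog_mulr _ _ i1) (pihomog_mulr _ _ i2) /= addr0.
  rewrite [z * _]mulrC (pihomog_mulr _ _ (dhomog_var K 2 1)) /= [_ * z]mulrC !subnn.
  by rewrite !cstE !mul_mpolyC.
rewrite /forget70 /syzygies23 [w.1.2]surjective_pairing [w.1.2.1]surjective_pairing.
congr (_, _, _, _); apply: mp_inj; rewrite !ofSK.
- exact: red (hb_a0_homog K) (hb_b0_homog K) (hb_c0_homog K) h0.
- exact: red (hb_a1_homog K) (hb_b1_homog K) (hb_c1_homog K) h1.
- exact: red (hb_a2_homog K) (hb_b2_homog K) (hb_c2_homog K) h2.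
have -> : mp w.2 = - pihomog mdeg 1 (- mp w.2).
  by rewrite pihomogN opprK pihomog_dE //; exact: mp_homog.
have i2 : is_dhomog (845 * 45 * x ^+ 2) 2.
  exact: (is_dhomogM (is_dhomogM (is_dhomog_natr K 845) (is_dhomog_natr K 45))
    (is_dhomogX 2 (is_dhomog_var K 0))).
rewrite h3 !pihomogD [z * _]mulrC (pihomog_mulr _ _ i2).
rewrite (pihomog_mulr _ al (dhomog_var K 1 1)) !(pihomog_mulr _ _ (dhomog_var K 2 1)) /=.
by rewrite !subnn addr0 !cstE !mul_mpolyC.
Qed.

Lemma relations71_inj w : relations71 w = 0 -> forget70 w = 0 -> w = 0.
Proof.
move=> /(congr1 mp); rewrite ofSK linear0 => + eF.
rewrite (congr1 fst eF : w.1.2 = 0) (congr1 snd eF : w.2 = 0) !linear0 !mul0r !addr0.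
move=> /eqP; rewrite mulf_eq0 (negPf (mpolyX_neq0 _ _)) /= => /eqP e.
have e1 : w.1.1 = 0 by apply: mp_inj; rewrite linear0.
rewrite [w]surjective_pairing [w.1]surjective_pairing e1.
by rewrite (congr1 snd eF : w.2 = 0) (congr1 fst eF : w.1.2 = 0).
Qed.

(** The source has dimension 2556 + 3 * 300 + 3 = 3459, [D23] has dimension 831, and the target 3459
    - 831 = 2628. *)
Lemma relations71_surj (p : E 71) : exists w, relations71 w = p.
Proof.
have h := @linear_surj_of_dim K D71 (E 71) (E 23 * E 23 * E 23 * E 1)%type D23
  relations71 forget70 syzygies23 relations71_inj relations71_kernel.
apply: h => {p}.
by rewrite !dim_prod !dim_regular !dim_dhomog; vm_compute.
Qed.

(** Representatives of a basis of S_70 modulo J + (g), with the elements of J + (g) written out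
    through coefficients of degree 22 and a scalar. *)
Definition standard_basis n (e : 'I_n -> S) : Prop :=
  [/\ forall i, e i \is 70.-homog,
      forall (c : 'I_n -> K) p0 p1 p2 (s : K),
        p0 \is 22.-homog -> p1 \is 22.-homog -> p2 \is 22.-homog ->
        \sum_i c i *: e i = p0 * fx + p1 * fy + p2 * fz + s *: g -> forall i, c i = 0
    & forall q, q \is 70.-homog -> exists (c : 'I_n -> K) p0 p1 p2 (s : K),
        q = \sum_i c i *: e i + (p0 * fx + p1 * fy + p2 * fz + s *: g)].

Lemma ex_standard_basis_dim : exists e : 'I_(\dim standard70) -> S, standard_basis e.
Proof.
exists (fun i => mp (vbasis standard70)`_i); split=> [i||q hq]; first exact: mp_homog.
  move=> c p0 p1 p2 s h0 h1 h2 hc.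
  pose w : (E 22 * E 22 * E 22 * K^o)%type := (ofS h0, ofS h1, ofS h2, s).
  have hw : \sum_i c i *: (vbasis standard70)`_i = relations70 w.
    apply: mp_inj; rewrite !ofSK /= -hc linear_sum.
    by apply: eq_bigr => i _; rewrite linearZ.
  have /freeP fr := basis_free (vbasisP standard70); apply: fr.
  apply/eqP; rewrite -memv0 -(capv_compl (limg (linfun relations70))) memv_cap.
  apply/andP; split; first by rewrite hw -(lfunE relations70) memv_img // memvf.
  apply: memv_suml => i _; apply/memvZ/vbasis_mem/mem_nth; by rewrite size_tuple.
have : ofS hq \in (limg (linfun relations70) + standard70)%VS.
  by rewrite addv_complf memvf.
move=> /memv_addP[_ /memv_imgP[w _ ->] [v hv e]].
exists (fun i => coord (vbasis standard70) i v), (mp w.1.1.1), (mp w.1.1.2), (mp w.1.2), w.2.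
rewrite -(ofSK hq) e lfunE linearD /= ofSK addrC; congr (_ + _).
rewrite [v in LHS](coord_vbasis hv) linear_sum; apply: eq_bigr => i _.
by rewrite linearZ.
Qed.

Lemma ex_standard_basis : exists e : 'I_1727 -> S, standard_basis e.
Proof. by have := ex_standard_basis_dim; rewrite dim_standard70. Qed.

Lemma degree71 p : p \is 71.-homog -> exists q v0 v1 v2 e,
  q \is 70.-homog /\ p = z * q + (v0 * fx + v1 * fy + v2 * fz) + e * g.
Proof.
move=> hp; have [w /(congr1 mp)] := relations71_surj (ofS hp).
rewrite !ofSK => <-; exists (mp w.1.1), (mp w.1.2.1.1), (mp w.1.2.1.2), (mp w.1.2.2), (mp w.2).
by split.
Qed.

End HilbertFunction.

Section Instance.
Variable K : numFieldType.

Lemma dim_dhomog3 d : dim (dhomog 3 K d) = (d.+2 * d.+1)./2.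
Proof.
have -> : dim (dhomog 3 K d) = 'C(d + 2, d) by [].
by rewrite -[X in 'C(_, X)](addnK 2) bin_sub ?leq_addl // bin2 addn2.
Qed.

Let toS d : {linear dhomog 3 K d -> {mpoly K[3]}} := @mpoly_of_dhomog 3 K d.

Let toS_homog d (u : dhomog 3 K d) : toS d u \is d.-homog.
Proof. exact: dhomog_is_dhomog. Qed.

Lemma f49gen_standard_basis : exists e : 'I_1727 -> {mpoly K[3]}, standard_basis e.
Proof.
exact: (@ex_standard_basis K (dhomog 3 K) toS (@DHomog 3 K) (fun d => val_inj) toS_homog
  (fun _ _ _ => erefl) dim_dhomog3).
Qed.

Lemma f49gen_degree71 (p : {mpoly K[3]}) : p \is 71.-homog -> exists q v0 v1 v2 e,
  q \is 70.-homog /\ p = 'X_2 * q + (v0 * gen_fx 'X_0 'X_1 'X_2 (f1 K)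
    + v1 * gen_fy 'X_0 'X_1 'X_2 (f1 K) + v2 * gen_fz 'X_0 'X_1 'X_2 (f1 K))
    + e * sat_gen K.
Proof.
exact: (@degree71 K (dhomog 3 K) toS (@DHomog 3 K) (fun d => val_inj) toS_homog
  (fun _ _ _ => erefl) dim_dhomog3).
Qed.

End Instance.

Lemma rmorph_dot3 (R T : comNzRingType) (phi : {rmorphism R -> T}) a b c u v w :
  phi (a * u + b * v + c * w) = phi a * phi u + phi b * phi v + phi c * phi w.
Proof. by rewrite !rmorphD !rmorphM. Qed.

Lemma dot3_decompose (T : comNzRingType) (X Y p0 p1 p2 b0 b1 b2 c0 c1 c2 u v w : T) :
  (p0 + X * b0 + Y * c0) * u + (p1 + X * b1 + Y * c1) * v + (p2 + X * b2 + Y * c2) * w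
    - (p0 * u + p1 * v + p2 * w)
  = X * (b0 * u + b1 * v + b2 * w) + Y * (c0 * u + c1 * v + c2 * w).
Proof. ring. Qed.

(** * Comparison of the Tjurina algebra with forms of degree 70 *)

Section Tjurina.
Variable K : numFieldType.
Local Notation S := {mpoly K[3]}.
Local Notation R2 := {mpoly K[2]}.
Local Notation O := (cseries2 K).
Local Notation x := ('X_0 : S).
Local Notation y := ('X_1 : S).
Local Notation z := ('X_2 : S).
Local Notation f := (f49gen K).
Local Notation fx := (gen_fx x y z (f1 K)).
Local Notation fy := (gen_fy x y z (f1 K)).
Local Notation fz := (gen_fz x y z (f1 K)).
Local Notation J := (jacobian_ideal f).
Local Notation g := (sat_gen K).
Local Notation h := (local_equation f (point001 K)).
Local Notation I := (ideal_gen (tnth [tuple germ h; germ h^`M(0); germ h^`M(1)])).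

Lemma x_nilpotent : exists N, J (x ^+ N).
Proof. by eexists; exact: jacobian_x. Qed.

Lemma y_nilpotent : exists N, J (y ^+ N).
Proof. by eexists; exact: jacobian_y. Qed.

Lemma local_equation_dx : h^`M(0) = dehom fx.
Proof. by rewrite local_equation001 (@dehom_mderiv _ 0) // f49gen_dx. Qed.

Lemma local_equation_dy : h^`M(1) = dehom fy.
Proof. by rewrite local_equation001 (@dehom_mderiv _ 1) // f49gen_dy. Qed.

Lemma local_euler : 49 * h = 'X_0 * dehom fx + 'X_1 * dehom fy + dehom fz.
Proof.
have := congr1 (@dehom K) (euler K).
rewrite (rmorphM (@dehom K)) rmorph_nat /= -local_equation001 => ->.
by rewrite (rmorph_dot3 (@dehom K)) /= !dehom_var mul1r.
Qed.

(** Euler's relation at z = 1, together with the invertibility of 49, exchanges the equation itself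
    for the third partial derivative. *)
Lemma tjurina_idealP (s : O) : I s <-> exists s0 s1 s2,
  s = s0 * germ (dehom fx) + s1 * germ (dehom fy) + s2 * germ (dehom fz).
Proof.
have ge := congr1 (@germ K) local_euler.
rewrite (rmorphM (@germ K) 49) rmorph_nat -(mul1r (dehom fz)) in ge.
rewrite (rmorph_dot3 (@germ K)) rmorph1 mul1r /= in ge.
have i0 : tnth [tuple germ h; germ h^`M(0); germ h^`M(1)] 0 = germ h by [].
have i1 : tnth [tuple germ h; germ h^`M(0); germ h^`M(1)] 1 = germ (dehom fx).
  by rewrite (tnth_nth 0) /= local_equation_dx.
have i2 : tnth [tuple germ h; germ h^`M(0); germ h^`M(1)] 2 = germ (dehom fy).
  by rewrite (tnth_nth 0) /= local_equation_dy.
split=> [[c ->]|[s0 [s1 [s2 ->]]]].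
  rewrite sum_ord3 i0 i1 i2.
  have c49 : germ (49^-1)%:MP * 49 = 1 :> O.
    rewrite -(rmorph_nat (@germ K)) -(rmorphM (@germ K)) /= -mpolyC_nat -mpolyCM.
    by rewrite (mulVf (natr_neq0 K 48)) mpolyC1 rmorph1.
  rewrite -[germ h]mul1r -c49 -(mulrA _ 49).
  rewrite ge; move: (germ (dehom fx)) (germ (dehom fy)) (germ (dehom fz)) => u v w.
  exists (c 0 * germ (49^-1)%:MP * germ 'X_0 + c 1).
  exists (c 0 * germ (49^-1)%:MP * germ 'X_1 + c 2).
  by exists (c 0 * germ (49^-1)%:MP); ring.
exists (vec3 (49 * s2) (s0 - s2 * germ 'X_0) (s1 - s2 * germ 'X_1)).
rewrite sum_ord3 i0 i1 i2 !vec3E.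
have -> : 49 * s2 * germ h = s2 * (49 * germ h) by ring.
by rewrite ge; move: (germ (dehom fx)) (germ (dehom fy)) (germ (dehom fz)) => *; ring.
Qed.

Lemma jacobian_germ p : J p -> I (germ (dehom p)).
Proof.
move=> /jacobianP[p0 [p1 [p2 ->]]]; apply/tjurina_idealP.
exists (germ (dehom p0)), (germ (dehom p1)), (germ (dehom p2)).
by rewrite (rmorph_dot3 (@dehom K)) (rmorph_dot3 (@germ K)).
Qed.

(** g is locally in the Jacobian ideal, because z g is in J and z becomes 1. *)
Lemma sat_germ e p : J p -> I (germ (dehom (p + e * g))).
Proof.
move=> hp; rewrite (rmorphD (@dehom K)) (rmorphD (@germ K)) /=.
apply: ideal_genD; first exact: jacobian_germ.
have -> : dehom (e * g) = dehom (e * (z * g)).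
  by rewrite (rmorphM (@dehom K) e) (rmorphM (@dehom K) e (z * g)) (rmorphM (@dehom K) z) /= dehom_var mul1r.
by apply: jacobian_germ; apply: jacobianM; exact: jacobian_mul_sat_gen.
Qed.

(** Truncating the power series coefficients modulo powers of x and y gives a polynomial identity;
    homogenizing it shows that z^k q is in J for some k, and z can be cancelled modulo J + (g). *)
Lemma germ_sat q : q \is 70.-homog -> I (germ (dehom q)) -> sat_ideal q.
Proof.
move=> hq /tjurina_idealP[s0 [s1 [s2 e]]].
have [N JX] := x_nilpotent; have [M JY] := y_nilpotent.
have [b0 [c0]] := series_truncate N M s0; move: (truncate N M s0) => p0 e0.
have [b1 [c1]] := series_truncate N M s1; move: (truncate N M s1) => p1 e1.
have [b2 [c2]] := series_truncate N M s2; move: (truncate N M s2) => p2 e2.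
have [|r [r' hr]] := @germ_monomial_ideal K N M
   (dehom q - (p0 * dehom fx + p1 * dehom fy + p2 * dehom fz))
   (b0 * germ (dehom fx) + b1 * germ (dehom fy) + b2 * germ (dehom fz))
   (c0 * germ (dehom fx) + c1 * germ (dehom fy) + c2 * germ (dehom fz)).
  rewrite (rmorphB (@germ K)) /= e e0 e1 e2 (rmorph_dot3 (@germ K)) /=.
  exact: dot3_decompose.
have lift (s : R2) : exists t, dehom t = s.
  by have [t _ <-] := dehom_surj (leqnn (msize s)); exists t.
have [P0 hP0] := lift p0; have [P1 hP1] := lift p1; have [P2 hP2] := lift p2.
have [Rr hRr] := lift r; have [Rr' hRr'] := lift r'.
have [T hT Tq] : exists2 T, J T & dehom T = dehom q.
  exists (P0 * fx + P1 * fy + P2 * fz + (Rr * x ^+ N + Rr' * y ^+ M)).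
    apply: jacobianD; first by apply/jacobianP; exists P0, P1, P2.
    by apply: jacobianD; apply: jacobianM.
  rewrite (rmorphD (@dehom K) (_ + _ + _)) (rmorph_dot3 (@dehom K)) /=.
  rewrite (rmorphD (@dehom K) (Rr * _)) (rmorphM (@dehom K) Rr) (rmorphM (@dehom K) Rr') /=.
  rewrite !(rmorphXn (@dehom K)) /=.
  rewrite !dehom_var hP0 hP1 hP2 hRr hRr' [r * _]mulrC [r' * _]mulrC -hr.
  by rewrite addrC subrK.
have [t0 [t1 [t2 eT]]] := iffLR (jacobianP _) hT.
(* A common degree n for the homogenized coefficients; n >= 22 makes the exponent of z in n + 48 =
   (n - 22) + 70 nonnegative. *)
pose n := maxn 22 (maxn (msize (dehom t0)) (maxn (msize (dehom t1)) (msize (dehom t2)))).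
have n22 : (22 <= n)%N by rewrite leq_max leqnn.
have [|q0 hq0 eq0] := @dehom_surj K n (dehom t0); first by rewrite !leq_max leqnn ?orbT.
have [|q1 hq1 eq1] := @dehom_surj K n (dehom t1); first by rewrite !leq_max leqnn ?orbT.
have [|q2 hq2 eq2] := @dehom_surj K n (dehom t2); first by rewrite !leq_max leqnn ?orbT.
apply: (@sat_ideal_zn _ (n - 22)); exists (z ^+ (n - 22) * q), 0.
rewrite mul0r addr0; split=> //; apply/jacobianP; exists q0, q1, q2.
apply/eqP; rewrite -subr_eq0; apply/eqP; apply: (@dehom_homog_inj _ (n + 48)).
  apply: rpredB.
    have := dhomogM (dhomog_var K 2 (n - 22)) hq.
    by rewrite (_ : (n - 22 + 70 = n + 48)%N) // (addnA _ 22 48) subnK.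
  apply: rpredD; [apply: rpredD|].
  - exact: dhomogM hq0 (gen_fx_homog K).
  - exact: dhomogM hq1 (gen_fy_homog K).
  - exact: dhomogM hq2 (gen_fz_homog K).
rewrite (rmorphB (@dehom K)) (rmorph_dot3 (@dehom K)) /=.
rewrite (rmorphM (@dehom K) _ q) rmorphXn /= dehom_var expr1n mul1r eq0 eq1 eq2.
by rewrite -Tq eT (rmorph_dot3 (@dehom K)) subrr.
Qed.

(** By [f49gen_degree71] a variable times a form of degree 70 is z times such a form modulo J + (g).
    As z becomes 1, each extra degree is absorbed. *)
Lemma dehom_reduce_monom n m : mdeg m = (70 + n)%N ->
  exists q p e, [/\ q \is 70.-homog, J p & dehom 'X_[m] = dehom q + dehom (p + e * g)].
Proof.
elim: n m => [|n IHn] m hm.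
  exists 'X_[m], 0, 0; rewrite mul0r addr0 rmorph0 addr0; split=> //; last exact: jacobian0.
  by rewrite dhomogX /= hm addn0.
have [i mi] : exists i, m i != 0%N.
  have [i|h0] := pickP (fun i => m i != 0%N); first by exists i.
  move: hm; rewrite mdegE big1 ?addnS // => i _.
  by apply/eqP; move: (h0 i) => /negbFE.
have mE : m = (U_(i) + (m - U_(i)))%MM by rewrite addmC submK // lep1mP.
have [|q [p [e [hq hp hE]]]] := IHn (m - U_(i))%MM.
  by have := congr1 mdeg mE; rewrite hm mdegD mdeg1 addnS add1n => -[].
have [q' [v0 [v1 [v2 [e' [hq' e71]]]]]] :
    exists q' v0 v1 v2 e', q' \is 70.-homog /\
     'X_i * q = z * q' + (v0 * fx + v1 * fy + v2 * fz) + e' * g.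
  by apply: f49gen_degree71; exact: dhomogM (dhomog_var K i 1) hq.
exists q', ('X_i * p + (v0 * fx + v1 * fy + v2 * fz)), ('X_i * e + e'); split=> //.
  by apply: jacobianD; [exact: jacobianM|apply/jacobianP; exists v0, v1, v2].
rewrite mE mpolyXD (rmorphM (@dehom K)) /= hE -(rmorphD (@dehom K)) -(rmorphM (@dehom K)) /=.
have -> : 'X_i * (q + (p + e * g)) = 'X_i * q + ('X_i * p + 'X_i * e * g).
  by move: fx fy fz g {hE e71} => *; ring.
rewrite e71.
have -> : z * q' + (v0 * fx + v1 * fy + v2 * fz) + e' * g + ('X_i * p + 'X_i * e * g)
  = z * q' + ('X_i * p + (v0 * fx + v1 * fy + v2 * fz) + ('X_i * e + e') * g).
  by move: fx fy fz g {hE e71} => *; ring.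
by rewrite (rmorphD (@dehom K)) (rmorphM (@dehom K)) /= dehom_var mul1r.
Qed.

Lemma dehom_reduce (r : R2) : exists q p e,
  [/\ q \is 70.-homog, J p & r = dehom q + dehom (p + e * g)].
Proof.
have [|p hp <-] := @dehom_surj K (70 + msize r) r; first exact: leq_addl.
rewrite [p]mpolyE big_seq.
elim/big_ind: _ => [|u v [q [p' [e [hq hp' hu]]]] [q2 [p2 [e2 [hq2 hp2 hv]]]]|m hm].
- exists 0, 0, 0; rewrite mul0r addr0 !rmorph0 addr0; split=> //; first exact: dhomog0.
  exact: jacobian0.
- exists (q + q2), (p' + p2), (e + e2); split; [exact: rpredD|exact: jacobianD|].
  rewrite (rmorphD (@dehom K) u) /= hu hv mulrDl (addrACA p') (rmorphD (@dehom K) q) (rmorphD (@dehom K) (p' + _)) /=.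
  by rewrite addrACA.
have [q [p' [e [hq hp' hE]]]] := dehom_reduce_monom (dhomog_mf hp hm).
exists (p@_m *: q), (p@_m *: p'), (p@_m *: e); split.
- exact: dhomogZ.
- by rewrite -mul_mpolyC; exact: jacobianM.
- by rewrite linearZ /= hE -scalerAl -scalerDr !linearZ /= scalerDr.
Qed.

Theorem f49gen_tjurina : tjurina f (point001 K) 1727.
Proof.
have [e [he ind sp]] := f49gen_standard_basis K.
have germ_sum (c : 'I_1727 -> K) :
    \sum_i c i *: germ (dehom (e i)) = germ (dehom (\sum_i c i *: e i)).
  rewrite (raddf_sum (@dehom K)) (raddf_sum (@germ K)); apply: eq_bigr => i _.
  by rewrite /= (linearZ_LR (@dehom K)) /= germZ.
exists (fun i => germ (dehom (e i))); split=> // [c|v _].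
  rewrite germ_sum => /germ_sat[|p [d [/jacobianP[p0 [p1 [p2 ->]]] hE]]].
    by apply: rpred_sum => i _; exact: dhomogZ.
  have hom70 : \sum_i c i *: e i \is 70.-homog.
    by apply: rpred_sum => i _; exact: dhomogZ.
  (* Independence was stated for homogeneous coefficients, so the parts of degree 22 and 0 are
     extracted from the membership in degree 70. *)
  apply: (ind c (pihomog mdeg 22 p0) (pihomog mdeg 22 p1) (pihomog mdeg 22 p2)
    (pihomog mdeg 0 d)@_0%MM); do ?exact: pihomogP.
  rewrite -(pihomog_dE hom70) hE !pihomogD (pihomog_mulr _ _ (gen_fx_homog K)).
  rewrite (pihomog_mulr _ _ (gen_fy_homog K)) (pihomog_mulr _ _ (gen_fz_homog K)).
  rewrite (pihomog_mulr _ _ (sat_gen_homog K)) /= subnn.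
  by rewrite {1}(dhomog0_const (pihomogP mdeg 0 d)) mul_mpolyC.
have [N JX] := x_nilpotent; have [M JY] := y_nilpotent.
have [b [c hv]] := series_truncate N M v.
have [q [p [d [hq hp hE]]]] := dehom_reduce (truncate N M v).
have [k [p0 [p1 [p2 [s hk]]]]] := sp q hq.
exists k; rewrite germ_sum {1}hv hE hk (rmorphD (@germ K)) (rmorphD (@dehom K)).
rewrite (rmorphD (@germ K)) /=.
set u := germ (dehom (\sum_i _)).
have IX : I (germ ('X_0 ^+ N)).
  by have := jacobian_germ JX; rewrite rmorphXn /= dehom_var.
have IY : I (germ ('X_1 ^+ M)).
  by have := jacobian_germ JY; rewrite rmorphXn /= dehom_var.
set w1 := germ (dehom (_ + s *: g)); set w2 := germ (dehom (p + _)).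
have -> : u + w1 + w2 + germ ('X_0 ^+ N) * b
    + germ ('X_1 ^+ M) * c - u =
  w1 + w2 + b * germ ('X_0 ^+ N) + c * germ ('X_1 ^+ M).
  move: u w1 w2 (germ ('X_0 ^+ _)) (germ ('X_1 ^+ _)) => *; ring.
apply: ideal_genD; last exact: ideal_genM.
apply: ideal_genD; last exact: ideal_genM.
apply: ideal_genD; last exact: sat_germ.
rewrite /w1 -mul_mpolyC; apply: sat_germ; apply/jacobianP; by exists p0, p1, p2.
Qed.

End Tjurina.

(** * The rational parametrization *)

Section Parametrization.
Variables (R : comNzRingType) (s t : R).

Definition par_u : R := t ^+ 4 + 13 * (t * s ^+ 3).

(** With A = u^49, B = t u^159 and x = s u^12 prescribed, y is (B - x^13) / A^3, and z comes from
    [f49genE], which is linear in z once A and B are given. *)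
Definition par_x : R := s * par_u ^+ 12.

Definition par_y : R := par_u ^+ 9 * (t * par_u ^+ 3 - s ^+ 13).

Definition par_z : R := 13 * (t * par_u ^+ 12) + 4 * (t ^+ 3 * (s ^+ 10 * par_u ^+ 9))
  - 6 * (t ^+ 2 * (s ^+ 23 * par_u ^+ 6)) + 4 * (t * (s ^+ 36 * par_u ^+ 3)) - s ^+ 49.

Lemma par_f1 : par_x ^+ 3 * par_z + par_y ^+ 4 = par_u ^+ 49.
Proof.
have -> : par_u ^+ 49 = par_u ^+ 48 * (t ^+ 4 + 13 * (t * s ^+ 3)) by rewrite exprSr.
rewrite /par_x /par_z /par_y; move: par_u => u; ring.
Qed.

Lemma par_f13 : (par_u ^+ 49) ^+ 3 * par_y + par_x ^+ 13 = t * par_u ^+ 159.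
Proof. rewrite /par_x /par_y; move: par_u => u; ring. Qed.

Lemma par_f49gen A B : A = par_u ^+ 49 -> B = t * par_u ^+ 159 ->
  13 * B * A ^+ 9 + 4 * B ^+ 3 * par_x ^+ 10 - 6 * B ^+ 2 * par_x ^+ 23
    + 4 * B * par_x ^+ 36 - par_x ^+ 49 - A ^+ 12 * par_z = 0.
Proof. by move=> -> ->; rewrite /par_x /par_z; move: par_u => u; ring. Qed.

End Parametrization.

Lemma par_at_infinity (R : comNzRingType) :
  ((par_x 0 1 = 0 :> R) * (par_y 0 1 = 1 :> R) * (par_z 0 1 = 13 :> R))%type.
Proof. by rewrite /par_x /par_y /par_z /par_u; split; [split|]; ring. Qed.

Section ParametrizationMorphism.
Variables (R T : comNzRingType) (phi : {rmorphism R -> T}).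

(** A relation, so that [compute_image] can build the image of an expression structurally, taking
    the images of named subexpressions from the context. *)
Definition is_image (p : R) (q : T) : Prop := phi p = q.

Lemma is_imageD p q p' q' : is_image p p' -> is_image q q' -> is_image (p + q) (p' + q').
Proof. by rewrite /is_image rmorphD => -> ->. Qed.

Lemma is_imageN p p' : is_image p p' -> is_image (- p) (- p').
Proof. by rewrite /is_image rmorphN => ->. Qed.

Lemma is_imageM p q p' q' : is_image p p' -> is_image q q' -> is_image (p * q) (p' * q').
Proof. by rewrite /is_image rmorphM => -> ->. Qed.

Lemma is_imageX p p' n : is_image p p' -> is_image (p ^+ n) (p' ^+ n).
Proof. by rewrite /is_image rmorphXn => ->. Qed.

Lemma is_image_nat n : is_image n%:R n%:R.
Proof. exact: rmorph_nat. Qed.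

Lemma is_image_eq p q q' : is_image p q -> q = q' -> is_image p q'.
Proof. by move=> hq <-. Qed.

Lemma is_image_refl p : is_image p (phi p).
Proof. by []. Qed.

End ParametrizationMorphism.

Ltac compute_image := lazymatch goal with
  | |- is_image _ (_ + _) _ => apply: is_imageD; compute_image
  | |- is_image _ (- _) _ => apply: is_imageN; compute_image
  | |- is_image _ (_ * _) _ => apply: is_imageM; compute_image
  | |- is_image _ (_ ^+ _) _ => apply: is_imageX; compute_image
  | |- is_image _ (_%:R) _ => exact: is_image_nat
  | H : is_image _ ?p _ |- is_image _ ?p _ => exact H
  | |- _ => exact: is_image_refl
  end.

Section ParametrizationImages.
Variables (R T : comNzRingType) (phi : {rmorphism R -> T}).

Lemma rmorph_par_u s t : phi (par_u s t) = par_u (phi s) (phi t).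
Proof. rewrite -/(is_image _ _ _) /par_u; compute_image. Qed.

Lemma rmorph_par_x s t : phi (par_x s t) = par_x (phi s) (phi t).
Proof.
have hu : is_image phi (par_u s t) (par_u (phi s) (phi t)) := rmorph_par_u s t.
rewrite -/(is_image _ _ _) /par_x; compute_image.
Qed.

Lemma rmorph_par_y s t : phi (par_y s t) = par_y (phi s) (phi t).
Proof.
have hu : is_image phi (par_u s t) (par_u (phi s) (phi t)) := rmorph_par_u s t.
rewrite -/(is_image _ _ _) /par_y; compute_image.
Qed.

Lemma rmorph_par_z s t : phi (par_z s t) = par_z (phi s) (phi t).
Proof.
have hu : is_image phi (par_u s t) (par_u (phi s) (phi t)) := rmorph_par_u s t.
rewrite -/(is_image _ _ _) /par_z; compute_image.
Qed.

End ParametrizationImages.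

Section InverseParametrization.
Variables (R : comNzRingType) (x y z A B f : R).
Hypothesis HA : A = x ^+ 3 * z + y ^+ 4.
Hypothesis HB : B = A ^+ 3 * y + x ^+ 13.
Hypothesis Hf : f = 13 * B * A ^+ 9 + 4 * B ^+ 3 * x ^+ 10 - 6 * B ^+ 2 * x ^+ 23
  + 4 * B * x ^+ 36 - x ^+ 49 - A ^+ 12 * z.

(** At s = x A^3, t = B the form u equals B^4 + 13 x^3 B A^9 = A^13 + x^3 f. Hence the composite map
    multiplies each coordinate by A^159 modulo f, with 159 = 3 + 12 * 13. *)
Lemma par_u_inverse n : exists c, par_u (x * A ^+ 3) B ^+ n = (A ^+ 13) ^+ n + f * c.
Proof.
have hu : par_u (x * A ^+ 3) B = A ^+ 13 + f * x ^+ 3.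
  rewrite /par_u Hf HB. ring: HA.
move: (par_u _ _) (A ^+ 13) hu => u v hu.
have [c hc] : exists c, u ^+ n - v ^+ n = (u - v) * c by eexists; exact: subrXX.
exists (x ^+ 3 * c); rewrite -[LHS](subrK (v ^+ n)) hc hu.
by move: (v ^+ n) => w; ring.
Qed.

Lemma par_x_inverse : exists c, par_x (x * A ^+ 3) B - A ^+ 159 * x = f * c.
Proof.
have [c hc] := par_u_inverse 12; exists (x * A ^+ 3 * c).
rewrite /par_x hc; ring.
Qed.

Lemma par_y_inverse : exists c, par_y (x * A ^+ 3) B - A ^+ 159 * y = f * c.
Proof.
have [c3 h3] := par_u_inverse 3; have [c9 h9] := par_u_inverse 9.
exists ((A ^+ 117 + f * c9) * (B * c3) + c9 * (B * A ^+ 39 - (x * A ^+ 3) ^+ 13)).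
rewrite /par_y h3 h9 HB; ring.
Qed.

Lemma par_z_inverse : exists c, par_z (x * A ^+ 3) B - A ^+ 159 * z = f * c.
Proof.
have [c3 h3] := par_u_inverse 3; have [c6 h6] := par_u_inverse 6.
have [c9 h9] := par_u_inverse 9; have [c12 h12] := par_u_inverse 12.
exists (A ^+ 147 + 13 * B * c12 + 4 * B ^+ 3 * (x * A ^+ 3) ^+ 10 * c9
  - 6 * B ^+ 2 * (x * A ^+ 3) ^+ 23 * c6 + 4 * B * (x * A ^+ 3) ^+ 36 * c3).
have -> : A ^+ 159 * z = A ^+ 147 * (A ^+ 12 * z) by ring.
have -> : A ^+ 12 * z = 13 * B * A ^+ 9 + 4 * B ^+ 3 * x ^+ 10 - 6 * B ^+ 2 * x ^+ 23
  + 4 * B * x ^+ 36 - x ^+ 49 - f by rewrite Hf; ring.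
rewrite /par_z h3 h6 h9 h12; ring.
Qed.

End InverseParametrization.

(** * Singular points, irreducibility and rationality *)

Section GlobalGeometry.
Variable K : numFieldType.
Local Notation S := {mpoly K[3]}.
Local Notation R2 := {mpoly K[2]}.
Local Notation x := ('X_0 : S).
Local Notation y := ('X_1 : S).
Local Notation z := ('X_2 : S).
Local Notation A := (f1 K).
Local Notation B := (f13 K).
Local Notation f := (f49gen K).
Local Notation J := (jacobian_ideal f).
Local Notation P := (point001 K).

Lemma point001E : ((P ord0 0 = 0) * (P ord0 1 = 0) * (P ord0 2 = 1))%type.
Proof. by rewrite !mxE. Qed.

Lemma meval_f1 (v : 'I_3 -> K) : A.@[v] = v 0 ^+ 3 * v 2 + v 1 ^+ 4.
Proof. by rewrite f1E mevalD mevalM !rmorphXn /= !mevalXU. Qed.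

(** f lies in the ideal (A^2, x^2), and both A and x vanish at P. *)
Lemma singular_001 : singular f P.
Proof.
have A0 : A.@[P ord0] = 0 by rewrite meval_f1 !point001E !expr0n mul0r addr0.
have x0 : x.@[P ord0] = 0 by rewrite mevalXU point001E.
have dbl (u w : S) i : u.@[P ord0] = 0 -> (u * (u * w))^`M(i).@[P ord0] = 0.
  move=> u0; rewrite mderivM mevalD (mevalM _ u) (mevalM _ _ (u * w)) (mevalM _ u) u0.
  by rewrite !mul0r mulr0 addr0.
have [M [w ->]] : exists M w, f = A * (A * M) + x * (x * w).
  exists (A ^+ 10 * (13 * y - z) + A ^+ 7 * (4 * x ^+ 10 * y ^+ 3 + 13 * x ^+ 13)
    + 6 * A ^+ 4 * y ^+ 2 * x ^+ 23 + 4 * A * y * x ^+ 36), (x ^+ 47).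
  by rewrite f49gen_expand; ring.
split=> [|i]; first by rewrite mevalD (mevalM _ A) (mevalM _ x) A0 x0 !mul0r addr0.
by rewrite mderivD mevalD !dbl ?addr0.
Qed.

Lemma singular_f49gen (p : point K) : singular f p <-> p = P.
Proof.
split=> [[_ d0]|->]; last exact: singular_001.
have J0 q : J q -> q.@[p ord0] = 0.
  move=> [c ->]; rewrite (raddf_sum (meval _)) big1 // => i _ /=.
  by rewrite mevalM d0 mulr0.
have p0 : p ord0 0 = 0.
  by have /J0/eqP := jacobian_x K; rewrite rmorphXn /= mevalXU expf_eq0 /= => /eqP.
have p1 : p ord0 1 = 0.
  by have /J0/eqP := jacobian_y K; rewrite rmorphXn /= mevalXU expf_eq0 /= => /eqP.
have p2 : p ord0 2 = 1.
  have /eqP := valP p; move: (pivot p); elim/forall_ord3 => //=;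
    by rewrite ?p0 ?p1 => /esym/eqP; rewrite oner_eq0.
apply/val_inj/rowP => i; elim/forall_ord3: i; rewrite point001E ?p0 ?p1 ?p2 //.
Qed.

Lemma f49gen_total_tjurina : total_tjurina f 1727.
Proof.
exists [:: P], (fun=> 1727); split=> // [p|p|]; last by rewrite big_seq1.
  by rewrite inE; split=> [/eqP/singular_f49gen//|/singular_f49gen ->].
by rewrite inE => /eqP ->; exact: f49gen_tjurina.
Qed.

Definition param : 3.-tuple R2 :=
  [tuple par_x 'X_0 'X_1; par_y 'X_0 'X_1; par_z 'X_0 'X_1].

Definition param_inv : 2.-tuple S := [tuple x * A ^+ 3; B].

Lemma f49gen_param : f \mPo param = 0.
Proof.
have v (i : 'I_3) : 'X_i \mPo param = tnth param i.
  by rewrite comp_mpolyXU (tnth_nth 0).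
have hx : is_image (comp_mpoly param) x (par_x 'X_0 'X_1) := v 0.
have hy : is_image (comp_mpoly param) y (par_y 'X_0 'X_1) := v 1.
have hz : is_image (comp_mpoly param) z (par_z 'X_0 'X_1) := v 2.
have hA : is_image (comp_mpoly param) A (par_u 'X_0 'X_1 ^+ 49).
  by rewrite f1E -(par_f1 'X_0 'X_1); compute_image.
have hB : is_image (comp_mpoly param) B ('X_1 * par_u 'X_0 'X_1 ^+ 159).
  by rewrite f13E -(par_f13 'X_0 'X_1); compute_image.
suff: is_image (comp_mpoly param) f 0 by [].
rewrite f49genE; apply: is_image_eq (@par_f49gen R2 'X_0 'X_1 _ _ (erefl _) (erefl _)).
by compute_image.
Qed.

Let F := fun q : S => exists r, q = f * r.

Lemma F0 : F 0. Proof. by exists 0; rewrite mulr0. Qed.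

Lemma FD p q : F p -> F q -> F (p + q).
Proof. by move=> [r ->] [s ->]; exists (r + s); rewrite mulrDr. Qed.

Lemma FM p q : F q -> F (p * q).
Proof. by move=> [r ->]; exists (p * r); rewrite mulrCA. Qed.

Lemma x_dvd_f1 q r : x * q = A * r -> exists s, q = A * s.
Proof.
move=> h; have [s hs] := mod_x r.
suff r0 : r \mPo at_x0 K = 0.
  have x0 : x != 0 := mpolyX_neq0 _ _.
  exists s; apply: (mulfI x0); rewrite h hs r0 addr0; exact: mulrCA.
move/(congr1 (comp_mpoly (at_x0 K))): h; rewrite !rmorphM /= comp_f1 comp_var /=.
rewrite !(tnth_nth 0) /= !mul0r expr0n mul0r add0r => /esym/eqP.
by rewrite mulf_eq0 expf_eq0 /= (negPf (mpolyX_neq0 _ _)) => /eqP.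
Qed.

Lemma f1_neq0 : A != 0.
Proof.
apply/eqP => /(congr1 (meval (fun=> 1))); rewrite meval_f1 meval0 !expr1n mul1r => /eqP.
by rewrite -(natrD _ 1 1) pnatr_eq0.
Qed.

(** If A q = f r then A divides x^49 r, as f is x^49 modulo A. Since A is y^4 modulo x, the powers
    of x can be removed and A divides r. *)
Lemma cancel_f1 n q : F (A ^+ n * q) -> F q.
Proof.
elim: n q => [|n IHn] q; first by rewrite mul1r.
rewrite exprS -mulrA => -[r hr]; apply: IHn.
have [s hs] : exists s, x ^+ 49 * r = A * s.
  exists (A ^+ n * q - f49gen_mod_f1 K * r); rewrite mulrBr hr {1}f49gen_mod_f1E; ring.
have {s hs} [s hs] : exists s, r = A * s.
  elim: 49%N r s hs {hr} => [|k IHk] r s; first by rewrite mul1r; exists s.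
  by rewrite exprSr -mulrA => /IHk[s' /x_dvd_f1].
exists s; apply: (mulfI f1_neq0); rewrite hr hs; exact: mulrCA.
Qed.

Lemma comp_scale_homog d c a : a \is d.-homog ->
  a \mPo [tuple c * x; c * y; c * z] = c ^+ d * a.
Proof.
move=> ha; rewrite [a in LHS]mpolyE [a in RHS]mpolyE.
rewrite (raddf_sum (comp_mpoly _)) mulr_sumr big_seq [RHS]big_seq.
apply: eq_bigr => m /(dhomog_mf ha) /= hm; rewrite comp_mpolyZ -scalerAr; congr (_ *: _).
rewrite comp_mpolyX (mpolyXE_id _ m) -hm mdegE -prodrXr -big_split /=.
apply: eq_bigr => i _; rewrite -exprMn; congr (_ ^+ _).
by elim/forall_ord3: i; rewrite (tnth_nth 0).
Qed.

Lemma comp_mpolyA (lq : 3.-tuple R2) (lr : 2.-tuple S) p :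
  (p \mPo lq) \mPo lr = p \mPo [tuple (tnth lq i) \mPo lr | i < 3].
Proof.
rewrite [p in LHS]mpolyE [p in RHS]mpolyE (raddf_sum (comp_mpoly lq)).
rewrite (raddf_sum (comp_mpoly lr)) (raddf_sum (comp_mpoly _)); apply: eq_bigr => m _ /=.
rewrite !comp_mpolyZ !comp_mpolyX (rmorph_prod (comp_mpoly lr)); congr (_ *: _).
by apply: eq_bigr => i _; rewrite tnth_mktuple rmorphXn.
Qed.

Lemma F_pihomog d q : F q -> F (pihomog mdeg d q).
Proof.
move=> [r ->]; rewrite mulrC (pihomog_mulr d r (f49gen_homog K)).
case: ifP => _; last exact: F0.
by exists (pihomog mdeg (d - 49) r); rewrite mulrC.
Qed.

(** Modulo f, following the parametrization after its inverse only scales the coordinates by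
    A^159. *)
Lemma F_sigma a : a \mPo param = 0 ->
  F (a \mPo [tuple A ^+ 159 * x; A ^+ 159 * y; A ^+ 159 * z]).
Proof.
move=> a0; have := congr1 (comp_mpoly param_inv) a0; rewrite comp_mpolyA comp_mpoly0 => e.
rewrite -[_ \mPo _]subr0 -e.
apply: (@congr_mmap _ F F0 FD FM _ _ (@mpolyC 3 K)) => i; rewrite tnth_mktuple -opprB.
have v0 : 'X_0 \mPo param_inv = x * A ^+ 3 by rewrite comp_mpolyXU.
have v1 : 'X_1 \mPo param_inv = B by rewrite comp_mpolyXU.
have FN q : F q -> F (- q) by rewrite -mulN1r; exact: FM.
apply: FN; elim/forall_ord3: i.
- have := rmorph_par_x (comp_mpoly param_inv) 'X_0 'X_1; rewrite /= v0 v1 => h.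
  rewrite [tnth param 0](tnth_nth 0) h; exact: (par_x_inverse (f1E K) (f13E K) (f49genE K)).
- have := rmorph_par_y (comp_mpoly param_inv) 'X_0 'X_1; rewrite /= v0 v1 => h.
  rewrite [tnth param 1](tnth_nth 0) h; exact: (par_y_inverse (f1E K) (f13E K) (f49genE K)).
- have := rmorph_par_z (comp_mpoly param_inv) 'X_0 'X_1; rewrite /= v0 v1 => h.
  rewrite [tnth param 2](tnth_nth 0) h; exact: (par_z_inverse (f1E K) (f13E K) (f49genE K)).
Qed.

(** The scaling by A^159 turns the component of degree d into A^(159 d) times itself. These products
    have different degrees, so each one is a multiple of the form f, and the power of A cancels. *)
Lemma param_kernel a : a \mPo param = 0 -> F a.
Proof.
move=> /F_sigma; pose n := msize a.
rewrite (pihomog_partitionE (leqnn (msize a))) -/n.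
rewrite (raddf_sum (comp_mpoly _)) => hF.
apply: (ideal_sum F0 FD) => d; apply: (@cancel_f1 (159 * d)).
(* 637 = 4 * 159 + 1. *)
have hom e : A ^+ (159 * e) * pihomog mdeg e a \is (637 * e).-homog.
  have := dhomogM (f1_homog K (159 * e)) (pihomogP mdeg e a).
  by rewrite (_ : (4 * (159 * e) + e = 637 * e)%N) // mulnA -[X in (_ + X)%N]mul1n -mulnDl.
suff -> : A ^+ (159 * d) * pihomog mdeg d a =
    pihomog mdeg (637 * d) (\sum_(e < n) (pihomog mdeg e a \mPo
      [tuple A ^+ 159 * x; A ^+ 159 * y; A ^+ 159 * z])) by exact: F_pihomog.
rewrite (raddf_sum (pihomog _ _)) (bigD1 d) //= [X in _ + X]big1 ?addr0 => [|e ne].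
  by rewrite (comp_scale_homog _ (pihomogP mdeg d a)) -exprM (pihomog_dE (hom d)).
rewrite (comp_scale_homog _ (pihomogP mdeg e a)) -exprM (pihomog_ne0 _ (hom e)) //.
by rewrite eqn_pmul2l.
Qed.

(** The parametrization maps into a domain, so one factor of f is in its kernel; by [param_kernel]
    it is a multiple of f and the other factor is a unit. *)
Theorem f49gen_irreducible : irreducible_elt f.
Proof.
have half (a b : S) : f = a * b -> a \mPo param = 0 -> invertible b.
  move=> hf /param_kernel[q hq]; exists q.
  apply: (mulfI (f49gen_neq0 K)); rewrite mulr1 {2}hf hq; ring.
split; first exact/eqP/f49gen_neq0.
  move=> [q hq]; have [e _] := singular_001.
  by have := congr1 (meval (P ord0)) hq; rewrite mevalM e mul0r meval1 => /esym/eqP;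
    rewrite oner_eq0.
move=> a b hf; have := f49gen_param; rewrite hf rmorphM /= => /eqP.
rewrite mulf_eq0 => /orP[/eqP h|/eqP h]; first by right; exact: half hf h.
by left; apply: half h; rewrite hf; exact: mulrC.
Qed.

Lemma param_homog j : tnth param j \is 49.-homog.
Proof.
have s1 : ('X_0 : R2) \is 1.-homog by rewrite dhomogX /= mdeg1.
have t1 : ('X_1 : R2) \is 1.-homog by rewrite dhomogX /= mdeg1.
have nat0 k (p : R2) d : p \is d.-homog -> k%:R * p \is d.-homog.
  by rewrite -mpolyC_nat mul_mpolyC; exact: dhomogZ.
have sk k : ('X_0 : R2) ^+ k \is k.-homog by have := dhomogMn k s1; rewrite mul1n.
have tk k : ('X_1 : R2) ^+ k \is k.-homog by have := dhomogMn k t1; rewrite mul1n.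
have uk k : (par_u 'X_0 'X_1 : R2) ^+ k \is (4 * k).-homog.
  apply: dhomogMn; apply: rpredD; first exact: tk.
  by apply: nat0; exact: (dhomogM t1 (sk 3)).
elim/forall_ord3: j; rewrite (tnth_nth 0) /=.
- exact: (dhomogM s1 (uk 12)).
- apply: (@dhomogM _ _ _ 36 _ 13); first exact: uk.
  by apply: rpredB; [exact: (dhomogM t1 (uk 3))|exact: sk].
apply: rpredB; last exact: sk.
apply: rpredD; [apply: rpredB; [apply: rpredD|]|]; apply: nat0.
- exact: (dhomogM t1 (uk 12)).
- exact: (dhomogM (tk 3) (dhomogM (sk 10) (uk 9))).
- exact: (dhomogM (tk 2) (dhomogM (sk 23) (uk 6))).
- exact: (dhomogM t1 (dhomogM (sk 36) (uk 3))).
Qed.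

Lemma meval_param (v : 'rV[K]_2) : peval param v =
  \row_j tnth [tuple par_x (v ord0 0) (v ord0 1); par_y (v ord0 0) (v ord0 1);
    par_z (v ord0 0) (v ord0 1)] j.
Proof.
have v0 : ('X_0 : R2).@[v ord0] = v ord0 0 by rewrite mevalXU.
have v1 : ('X_1 : R2).@[v ord0] = v ord0 1 by rewrite mevalXU.
apply/rowP => j; rewrite !mxE; elim/forall_ord3: j; rewrite !(tnth_nth 0) /=.
- by rewrite (rmorph_par_x (meval _)) /= v0 v1.
- by rewrite (rmorph_par_y (meval _)) /= v0 v1.
- by rewrite (rmorph_par_z (meval _)) /= v0 v1.
Qed.

Lemma meval_param_inv (v : 'rV[K]_3) : peval param_inv v =
  \row_j tnth [tuple v ord0 0 * A.@[v ord0] ^+ 3; B.@[v ord0]] j.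
Proof.
apply/rowP => j; rewrite !mxE; elim/forall_ord2: j; rewrite !(tnth_nth 0) /= //.
by rewrite mevalM rmorphXn /= mevalXU.
Qed.

Lemma meval_f13 (v : 'I_3 -> K) : B.@[v] = A.@[v] ^+ 3 * v 1 + v 0 ^+ 13.
Proof. by rewrite f13E mevalD mevalM !rmorphXn /= !mevalXU. Qed.

Lemma meval_f49gen (v : 'I_3 -> K) : f.@[v] =
  13 * B.@[v] * A.@[v] ^+ 9 + 4 * B.@[v] ^+ 3 * v 0 ^+ 10 - 6 * B.@[v] ^+ 2 * v 0 ^+ 23
  + 4 * B.@[v] * v 0 ^+ 36 - v 0 ^+ 49 - A.@[v] ^+ 12 * v 2.
Proof.
have hx : is_image (meval v) x (v 0) by rewrite /is_image /= mevalXU.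
have hz : is_image (meval v) z (v 2) by rewrite /is_image /= mevalXU.
have hA : is_image (meval v) A A.@[v] by [].
have hB : is_image (meval v) B B.@[v] by [].
apply: (_ : is_image (meval v) f _); rewrite f49genE.
compute_image.
Qed.

Lemma proportional_scale n (v w : 'rV[K]_n) (c : K) :
  (forall j, v ord0 j = c * w ord0 j) -> proportional v w.
Proof. by move=> h i j; rewrite !h mulrAC. Qed.

(** The image of (0 : 1). Both maps are nonzero at these two points, which serve as witnesses that
    they and their composites do not vanish identically. *)
Definition inflection : 'rV[K]_3 := \row_j tnth [tuple 0; 1; 13] j.

Lemma inflectionE :
  ((inflection ord0 0 = 0) * (inflection ord0 1 = 1) * (inflection ord0 2 = 13))%type.
Proof. by rewrite !mxE !(tnth_nth 0). Qed.

Lemma peval_param_inv_inflection : peval param_inv inflection = \row_j (j == 1)%:R.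
Proof.
rewrite meval_param_inv meval_f13 meval_f1 !inflectionE.
by apply/rowP => j; rewrite !mxE; elim/forall_ord2: j; rewrite !(tnth_nth 0) /=;
  rewrite !expr0n !expr1n !mul0r ?add0r ?expr1n ?mulr1 ?addr0.
Qed.

Lemma peval_param_infinity : peval param (\row_j (j == 1)%:R) = inflection.
Proof.
rewrite meval_param !mxE /=; apply/rowP => j; rewrite !mxE.
by elim/forall_ord3: j; rewrite !(tnth_nth 0) /= par_at_infinity.
Qed.

Lemma inflection_neq0 : inflection != 0.
Proof.
apply/eqP => /rowP/(_ 1); rewrite inflectionE !mxE => /eqP.
by rewrite oner_eq0.
Qed.

Lemma infinity_neq0 : (\row_j (j == 1)%:R : 'rV[K]_2) != 0.
Proof. by apply/eqP => /rowP/(_ 1); rewrite !mxE => /eqP; rewrite oner_eq0. Qed.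

Lemma inflection_on_curve : f.@[inflection ord0] = 0.
Proof.
rewrite meval_f49gen meval_f13 meval_f1 !inflectionE; ring.
Qed.

Theorem f49gen_rational : rational_curve f.
Proof.
exists param_inv, param; split.
- split=> [|| //].
    exists 13; elim/forall_ord2; rewrite (tnth_nth 0) /=.
      exact: (dhomogM (dhomog_var K 0 1) (f1_homog K 3)).
    exact: (f13_homog K 1).
  exists inflection; first exact: inflection_on_curve.
  by rewrite peval_param_inv_inflection infinity_neq0.
- split; first by exists 49; exact: param_homog.
    by exists (\row_j (j == 1)%:R) => //; rewrite peval_param_infinity inflection_neq0.
  move=> v _; rewrite -[RHS](meval0 (v ord0)) -f49gen_param comp_mpoly_meval.
  by apply: meval_eq => i; rewrite mxE.
- split.
    exists inflection; first exact: inflection_on_curve.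
    by rewrite peval_param_inv_inflection peval_param_infinity inflection_neq0.
  move=> v fv; apply: (@proportional_scale _ _ _ (A.@[v ord0] ^+ 159)).
  set a := A.@[v ord0]; set b := B.@[v ord0].
  have HA : a = v ord0 0 ^+ 3 * v ord0 2 + v ord0 1 ^+ 4 := meval_f1 _.
  have HB : b = a ^+ 3 * v ord0 1 + v ord0 0 ^+ 13 := meval_f13 _.
  have Hf := meval_f49gen (v ord0); rewrite fv -/a -/b in Hf.
  (* At a point of the curve f has value 0, so the error terms f c of the inverse formulas
     vanish. *)
  have cancel0 p q : (exists c : K, p - q = 0 * c) -> p = q.
    by move=> [c]; rewrite mul0r => /eqP; rewrite subr_eq0 => /eqP.
  have e0 : peval param_inv v ord0 0 = v ord0 0 * a ^+ 3.
    by rewrite meval_param_inv mxE (tnth_nth 0).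
  have e1 : peval param_inv v ord0 1 = b by rewrite meval_param_inv mxE (tnth_nth 0).
  rewrite meval_param e0 e1; elim/forall_ord3; rewrite mxE (tnth_nth 0) /=; apply: cancel0.
  - exact: par_x_inverse HA HB Hf.
  - exact: par_y_inverse HA HB Hf.
  - exact: par_z_inverse HA HB Hf.
- split.
    exists (\row_j (j == 1)%:R) => //.
    by rewrite peval_param_infinity peval_param_inv_inflection infinity_neq0.
  move=> v _; set s := v ord0 0; set t := v ord0 1.
  apply: (@proportional_scale _ _ _ (par_u s t ^+ 159)).
  have c0 : peval param v ord0 0 = par_x s t by rewrite meval_param mxE (tnth_nth 0).
  have c1 : peval param v ord0 1 = par_y s t by rewrite meval_param mxE (tnth_nth 0).
  have c2 : peval param v ord0 2 = par_z s t by rewrite meval_param mxE (tnth_nth 0).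
  have hA : A.@[peval param v ord0] = par_u s t ^+ 49.
    by rewrite meval_f1 c0 c1 c2 par_f1.
  have hB : B.@[peval param v ord0] = t * par_u s t ^+ 159.
    by rewrite meval_f13 hA c0 c1 par_f13.
  rewrite meval_param_inv hA hB c0; elim/forall_ord2; rewrite mxE (tnth_nth 0) /=.
    by rewrite /par_x -/s; move: (par_u s t) => u; ring.
  exact: mulrC.
Qed.

End GlobalGeometry.

(** * Weierstrass division and Hensel's lemma *)

Section Divisibility.
Variable R : comNzRingType.
Implicit Types a b p : R.

Definition divides a b : Prop := exists q, b = a * q.

Definition prime_elt p : Prop := forall a b, divides p (a * b) -> divides p a \/ divides p b.

Lemma prime_divides_prod (I : eqType) (s : seq I) (F : I -> R) p :
  prime_elt p -> ~ divides p 1 -> divides p (\prod_(i <- s) F i) ->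
  exists2 i, i \in s & divides p (F i).
Proof.
move=> pp p1; elim: s => [|i s IHs]; first by rewrite big_nil.
rewrite big_cons => /pp[h|/IHs[j js h]]; first by exists i; rewrite ?mem_head.
by exists j; rewrite // inE js orbT.
Qed.

Lemma prod_divides (I : eqType) (s : seq I) (F : I -> R) a : uniq s ->
  (forall i, i \in s -> [/\ prime_elt (F i), ~ divides (F i) 1 & divides (F i) a]) ->
  (forall i j, i \in s -> j \in s -> divides (F i) (F j) -> i = j) ->
  divides (\prod_(i <- s) F i) a.
Proof.
elim: s => [|i s IHs] /=; first by exists a; rewrite big_nil mul1r.
move=> /andP[nis us] h dis; have si j : j \in s -> j \in i :: s by rewrite inE orbC => ->.
have [||q e] := IHs us; first by move=> j js; exact/h/si.
  by move=> j k js ks; apply: dis; exact: si.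
have [pp p1 da] := h i (mem_head i s).
have [|[c eq]] : divides (F i) (\prod_(j <- s) F j) \/ divides (F i) q by apply: pp; rewrite -e.
  move=> /(prime_divides_prod pp p1)[j js /(dis _ _ (mem_head i s) (si _ js)) eij].
  by rewrite eij js in nis.
by exists c; rewrite e eq big_cons mulrA; congr (_ * _); exact: mulrC.
Qed.

End Divisibility.

Section SeriesAlgebra.
Variable K : numFieldType.
Local Notation O := (cseries2 K).
Implicit Types a b c q xi : O.

(** The lexicographically lowest coefficient of a product is the product of the lowest coefficients
    of the factors. *)
Lemma cseries2_domain a b : a * b = 0 -> a = 0 \/ b = 0.
Proof.
have lowest c : c != 0 -> exists i j, [/\ coef2 c i j != 0,
    forall i' j', (i' < i)%N -> coef2 c i' j' = 0
    & forall j', (j' < j)%N -> coef2 c i j' = 0].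
  move=> c0.
  have ex : exists i, `[< exists j, coef2 c i j != 0 >].
    apply: contrapT => h; case/eqP: c0; apply: cseries2P => i j; rewrite cseries2_0.
    apply/eqP; apply: contrapT => /negP ne; apply: h; exists i; apply/asboolP.
    by exists j.
  case: (ex_minnP ex) => i /asboolP ex' mini; case: (ex_minnP ex') => j cij minj.
  exists i, j; split=> // [i' j' lt_i|j' lt_j].
    apply/eqP; apply: contraTT lt_i => ne; rewrite -leqNgt; apply: mini.
    by apply/asboolP; exists j'.
  by apply/eqP; apply: contraTT lt_j => ne; rewrite -leqNgt; apply: minj.
move=> ab0; have [->|/lowest[i [j [aij a1 a2]]]] := eqVneq a 0; first by left.
have [->|/lowest[i' [j' [bij b1 b2]]]] := eqVneq b 0; first by right.
have := congr1 (fun c => coef2 c (i + i') (j + j')) ab0; rewrite cseries2_0 cseries2M.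
have lt_i : (i < (i + i').+1)%N by rewrite ltnS leq_addr.
have lt_j : (j < (j + j').+1)%N by rewrite ltnS leq_addr.
rewrite (bigD1 (Ordinal lt_i)) //= [X in _ + X]big1 ?addr0; last first.
  move=> k ne; rewrite big1 // => l _; have [lt|gt|e] := ltngtP k i.
  - by rewrite a1 // mul0r.
  - rewrite b1 ?mulr0 //; have hk := ltn_ord k; rewrite ltnS in hk.
    by rewrite ltn_subLR // ltn_add2r.
  - by case/eqP: ne; apply/val_inj.
rewrite (bigD1 (Ordinal lt_j)) //= [X in _ + X]big1 ?addr0; last first.
  move=> l ne; have [lt|gt|e] := ltngtP l j.
  - by rewrite a2 // mul0r.
  - rewrite addKn b2 ?mulr0 //; have hl := ltn_ord l; rewrite ltnS in hl.
    by rewrite ltn_subLR // ltn_add2r.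
  - by case/eqP: ne; apply/val_inj.
by rewrite !addKn => /eqP; rewrite mulf_eq0 (negPf aij) (negPf bij).
Qed.

Lemma cseries2_mulfI a b c : a != 0 -> a * b = a * c -> b = c.
Proof.
move=> a0 e; have [|/eqP|/eqP] := @cseries2_domain a (b - c).
- by rewrite mulrBr e subrr.
- by rewrite (negPf a0).
- by rewrite subr_eq0 => /eqP.
Qed.

Lemma cseries2_mulf_neq0 a b : a != 0 -> b != 0 -> a * b != 0.
Proof. by move=> /eqP a0 /eqP b0; apply/eqP => /cseries2_domain[]. Qed.

Lemma cseries2_expf_neq0 a n : a != 0 -> a ^+ n != 0.
Proof.
move=> a0; elim: n => [|n IHn]; first by rewrite oner_eq0.
by rewrite exprS cseries2_mulf_neq0.
Qed.

Definition const_coef a : K := coef2 a 0 0.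

Lemma const_coef_is_additive : {morph const_coef : a b / a - b}.
Proof. by []. Qed.

HB.instance Definition _ :=
  GRing.isZmodMorphism.Build O K const_coef const_coef_is_additive.

Lemma const_coef_is_multiplicative : monoid_morphism const_coef.
Proof.
split=> [|a b]; first by rewrite /const_coef cseries2_1.
by rewrite /const_coef cseries2M !big_ord1.
Qed.

HB.instance Definition _ :=
  GRing.isMonoidMorphism.Build O K const_coef const_coef_is_multiplicative.

(** Membership in the n-th power of the maximal ideal, read on coefficients. *)
Definition vanishes_to n a : Prop := forall i j, (i + j < n)%N -> coef2 a i j = 0.

Lemma vanishes_toD n a b : vanishes_to n a -> vanishes_to n b -> vanishes_to n (a + b).
Proof. by move=> ha hb i j h; rewrite cseries2D ha ?hb ?addr0. Qed.

Lemma vanishes_toN n a : vanishes_to n a -> vanishes_to n (- a).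
Proof. by move=> ha i j h; rewrite cseries2N ha ?oppr0. Qed.

Lemma vanishes_toM m n a b :
  vanishes_to m a -> vanishes_to n b -> vanishes_to (m + n) (a * b).
Proof.
move=> ha hb i j h; rewrite cseries2M big1 // => k _; rewrite big1 // => l _.
have [lt|ge] := ltnP (k + l) m; first by rewrite ha ?mul0r.
have hk := ltn_ord k; have hl := ltn_ord l; rewrite !ltnS in hk hl.
rewrite hb ?mulr0 // -(ltn_add2l m); apply: leq_ltn_trans h.
apply: leq_trans (leq_add ge (leqnn _)) _.
by rewrite addnACA !subnKC.
Qed.

Lemma vanishes_to_leq m n a : (m <= n)%N -> vanishes_to n a -> vanishes_to m a.
Proof. by move=> mn h i j lt; apply: h; exact: leq_trans mn. Qed.

Lemma vanishes_to1 a : vanishes_to 1 a <-> const_coef a = 0.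
Proof.
split=> [h|h i j]; first exact: h.
by rewrite ltnS leqn0 addn_eq0 => /andP[/eqP -> /eqP ->].
Qed.

Lemma vanishes_all a : (forall n, vanishes_to n a) -> a = 0.
Proof. by move=> h; apply: cseries2P => i j; apply: (h (i + j).+1). Qed.

Local Notation u := (germ ('X_0 : {mpoly K[2]})).
Local Notation T := (shift 1 0).

Lemma germ_uM a i j : coef2 (u * a) i j = if i is i'.+1 then coef2 a i' j else 0.
Proof.
have -> : 'X_0 = 'X_[mnm2 1 0] :> {mpoly K[2]}.
  by congr 'X_[_]; apply/mnmP; elim/forall_ord2; rewrite mnm1E mnm2E.
by rewrite germ_monomM; case: i => [|i] //=; rewrite subSS !subn0.
Qed.

Lemma shift1E a i j : coef2 (T a) i j = coef2 a i.+1 j.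
Proof. by rewrite shiftE addn1 addn0. Qed.

Lemma shift1B a b : T (a - b) = T a - T b.
Proof. by apply: cseries2P. Qed.

Lemma shift1_uM a : T (u * a) = a.
Proof. by apply: cseries2P => i j; rewrite shift1E germ_uM. Qed.

Lemma vanishes_shift1 n a : vanishes_to n.+1 a -> vanishes_to n (T a).
Proof. by move=> h i j lt; rewrite shift1E; apply: h; rewrite addSn. Qed.

(* The series in the second variable alone. *)
Definition v_series : {pred O} := fun a => T a == 0.

Lemma v_seriesE a : (a \in v_series) = (T a == 0). Proof. by []. Qed.

Lemma v_seriesP a : reflect (forall i j, coef2 a i.+1 j = 0) (a \in v_series).
Proof.
rewrite v_seriesE; apply: (iffP eqP) => [h i j|h]; first by rewrite -shift1E h.
by apply: cseries2P => i j; rewrite shift1E h.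
Qed.

Lemma shift1_vM xi a : xi \in v_series -> T (xi * a) = xi * T a.
Proof.
move=> /v_seriesP h; apply: cseries2P => i j; rewrite shift1E !cseries2M.
rewrite big_ord_recl [RHS]big_ord_recl; congr (_ + _).
  by apply: eq_bigr => l _; rewrite shift1E subn0 subn0.
by rewrite !big1 // => k _; rewrite big1 // => l _; rewrite h mul0r.
Qed.

Lemma v_series_subring : subring_closed v_series.
Proof.
split=> [|a b|a b ha]; rewrite !v_seriesE.
- by apply/eqP/cseries2P => i j; rewrite shift1E cseries2_1 cseries2_0.
- by rewrite shift1B => /eqP -> /eqP ->; rewrite subr0.
- by rewrite shift1_vM // => /eqP ->; rewrite mulr0.
Qed.

HB.instance Definition _ := GRing.isSubringClosed.Build O v_series v_series_subring.

(** Uniqueness of the remainder in Weierstrass division. Applying [T] gives q = xi T q, where xi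
    raises the order by 2 and [T] lowers it by at most 1; so q vanishes to every order. *)
Lemma u_sub_regular xi q : xi \in v_series -> vanishes_to 2 xi ->
  (u - xi) * q \in v_series -> q = 0.
Proof.
move=> hv h2; rewrite v_seriesE mulrBl shift1B shift1_uM shift1_vM //.
rewrite subr_eq0 => /eqP e; apply: vanishes_all; elim=> [|n IHn] //.
case: n IHn => [|n] IHn; rewrite e.
  exact: (@vanishes_to_leq _ 2) (@vanishes_toM 2 0 _ _ h2 _).
by apply: (@vanishes_to_leq _ (2 + n)) => //; apply: vanishes_toM => //; exact: vanishes_shift1.
Qed.

Lemma u_sub_neq0 xi : xi \in v_series -> u - xi != 0.
Proof.
move=> /v_seriesP h; apply/eqP => /(congr1 (fun a => coef2 a 1 0)).
rewrite cseries2B h subr0 cseries2_0 -[u]mulr1 germ_uM cseries2_1 => /eqP.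
by rewrite oner_eq0.
Qed.

End SeriesAlgebra.

Arguments const_coef : simpl never.
Arguments v_series : clear implicits.

(** * Norms on polydiscs and fixed points of contractions *)

Section SeriesNorms.
Variable K : numFieldType.
Local Notation O := (cseries2 K).
Implicit Types (a b c q xi : O) (r s M : K).
Local Notation u := (germ ('X_0 : {mpoly K[2]})).
Local Notation T := (shift 1 0).

(* The norm of the Banach algebra of series on the polydisc of radii [r], [s],
   for a series truncated to exponents less than [n]. *)
Definition nrm n r s a : K := \sum_(i < n) \sum_(j < n) `|coef2 a i j| * r ^+ i * s ^+ j.

Lemma triangular_sum n (f g : nat -> K) :
  \sum_(i < n) \sum_(k < i.+1) f k * g (i - k)%N = \sum_(k < n) f k * \sum_(j < n - k) g j.
Proof.
elim: n => [|n IHn]; first by rewrite !big_ord0.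
rewrite big_ord_recr /= IHn [RHS]big_ord_recr /= subSnn big_ord1 big_ord_recr /=.
rewrite subnn addrA -big_split /=; congr (_ + _); apply: eq_bigr => k _.
by rewrite subSn 1?ltnW // big_ord_recr /= mulrDr.
Qed.

Lemma convolution_le n (f g : nat -> K) : (forall k, 0 <= f k) -> (forall k, 0 <= g k) ->
  \sum_(i < n) \sum_(k < i.+1) f k * g (i - k)%N <= (\sum_(k < n) f k) * (\sum_(k < n) g k).
Proof.
move=> f0 g0; rewrite triangular_sum mulr_suml; apply: ler_sum => k _.
apply: ler_wpM2l => //; rewrite -[in X in _ <= X](subnK (ltnW (ltn_ord k))).
by rewrite big_split_ord /= lerDl sumr_ge0.
Qed.

Lemma nrm_ge0 n r s a : 0 <= r -> 0 <= s -> 0 <= nrm n r s a.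
Proof.
by move=> r0 s0; do 2!apply: sumr_ge0 => ? _; rewrite !mulr_ge0 ?exprn_ge0.
Qed.

Lemma nrmM n r s a b : 0 <= r -> 0 <= s -> nrm n r s (a * b) <= nrm n r s a * nrm n r s b.
Proof.
move=> r0 s0; pose A c k := \sum_(l < n) `|coef2 c k l| * s ^+ l.
have A0 c k : 0 <= A c k by apply: sumr_ge0 => l _; rewrite mulr_ge0 ?exprn_ge0.
have nE c : nrm n r s c = \sum_(k < n) A c k * r ^+ k.
  by apply: eq_bigr => k _; rewrite mulr_suml; apply: eq_bigr => l _; rewrite mulrAC.
have Ar0 c k : 0 <= A c k * r ^+ k by rewrite mulr_ge0 ?exprn_ge0.
rewrite !nE; apply: le_trans (convolution_le n (Ar0 a) (Ar0 b)).
apply: ler_sum => i _.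
have -> : \sum_(k < i.+1) A a k * r ^+ k * (A b (i - k)%N * r ^+ (i - k)) =
    (\sum_(k < i.+1) A a k * A b (i - k)%N) * r ^+ i.
  rewrite mulr_suml; apply: eq_bigr => k _.
  by rewrite mulrACA -exprD subnKC // -ltnS.
apply: ler_wpM2r; first exact: exprn_ge0.
apply: (@le_trans _ _ (\sum_(k < i.+1) \sum_(j < n) \sum_(l < j.+1)
   (`|coef2 a k l| * s ^+ l) * (`|coef2 b (i - k) (j - l)| * s ^+ (j - l)))); last first.
  apply: ler_sum => k _; apply: (convolution_le n (f := fun l => `|coef2 a k l| * s ^+ l)
    (g := fun l => `|coef2 b (i - k) l| * s ^+ l)) => l; by rewrite mulr_ge0 ?exprn_ge0.
rewrite exchange_big /=; apply: ler_sum => j _; rewrite cseries2M.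
apply: (@le_trans _ _ ((\sum_(k < i.+1) \sum_(l < j.+1)
  `|coef2 a k l| * `|coef2 b (i - k) (j - l)|) * s ^+ j)).
  apply: ler_wpM2r; first exact: exprn_ge0.
  apply: le_trans (ler_norm_sum _ _ _) _; apply: ler_sum => k _.
  apply: le_trans (ler_norm_sum _ _ _) _; apply: ler_sum => l _.
  by rewrite normrM.
rewrite mulr_suml; apply: ler_sum => k _; rewrite mulr_suml; apply: ler_sum => l _.
by rewrite mulrACA -exprD subnKC // -ltnS.
Qed.

(** A uniform bound on the truncations stands for a bound on the infinite sum, over a field that may
    lack limits. *)
Definition bounded r s M a : Prop := forall n, nrm n r s a <= M.

Lemma bounded_ge0 r s M a : bounded r s M a -> 0 <= M.
Proof. by move=> /(_ 0%N); rewrite /nrm big_ord0. Qed.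

Lemma bounded_coef r s M a i j : 0 <= r -> 0 <= s ->
  bounded r s M a -> `|coef2 a i j| * r ^+ i * s ^+ j <= M.
Proof.
move=> r0 s0 /(_ (maxn i j).+1); apply: le_trans.
have hi : (i < (maxn i j).+1)%N by rewrite ltnS leq_maxl.
have hj : (j < (maxn i j).+1)%N by rewrite ltnS leq_maxr.
have t0 k l : 0 <= `|coef2 a k l| * r ^+ k * s ^+ l by rewrite !mulr_ge0 ?exprn_ge0.
rewrite /nrm (bigD1 (Ordinal hi)) //= (bigD1 (Ordinal hj)) //= -addrA lerDl.
by rewrite addr_ge0 //; do ?[apply: sumr_ge0 => ? _].
Qed.

Lemma bounded_le r s M N a : M <= N -> bounded r s M a -> bounded r s N a.
Proof. by move=> MN h n; exact: le_trans (h n) MN. Qed.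

Lemma boundedD r s M N a b :
  bounded r s M a -> bounded r s N b -> 0 <= r -> 0 <= s -> bounded r s (M + N) (a + b).
Proof.
move=> ha hb r0 s0 n; apply: le_trans (lerD (ha n) (hb n)).
rewrite -big_split; apply: ler_sum => i _; rewrite -big_split; apply: ler_sum => j _ /=.
by rewrite cseries2D -!mulrDl; rewrite !ler_wpM2r ?exprn_ge0 ?ler_normD.
Qed.

Lemma boundedM r s M N a b :
  bounded r s M a -> bounded r s N b -> 0 <= r -> 0 <= s -> bounded r s (M * N) (a * b).
Proof.
move=> ha hb r0 s0 n; apply: le_trans (nrmM _ _ _ r0 s0) _.
by apply: ler_pM (ha n) (hb n); exact: nrm_ge0.
Qed.

Lemma bounded_scale r s M lam mu nu a : 0 <= r -> 0 <= s -> 0 <= lam -> 0 <= mu -> 0 <= nu ->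
  (forall i j, coef2 a i j != 0 -> lam ^+ i * mu ^+ j <= nu) ->
  bounded r s M a -> bounded (lam * r) (mu * s) (nu * M) a.
Proof.
move=> r0 s0 l0 m0 n0 h ha n; apply: le_trans (ler_wpM2l n0 (ha n)).
rewrite mulr_sumr; apply: ler_sum => i _; rewrite mulr_sumr; apply: ler_sum => j _.
have [->|/h hij] := eqVneq (coef2 a i j) 0; first by rewrite normr0 !mul0r mulr0.
rewrite !exprMn.
have -> : `|coef2 a i j| * (lam ^+ i * r ^+ i) * (mu ^+ j * s ^+ j) =
  (lam ^+ i * mu ^+ j) * (`|coef2 a i j| * r ^+ i * s ^+ j) by ring.
by apply: ler_wpM2r => //; rewrite !mulr_ge0 ?exprn_ge0.
Qed.

Lemma bounded_mono r s r' s' M a : 0 <= r' <= r -> 0 <= s' <= s ->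
  bounded r s M a -> bounded r' s' M a.
Proof.
move=> /andP[r0 rr] /andP[s0 ss] h n; apply: le_trans (h n).
apply: ler_sum => i _; apply: ler_sum => j _.
have rp : 0 <= r by exact: le_trans rr. have sp : 0 <= s by exact: le_trans ss.
by apply: ler_pM; rewrite ?mulr_ge0 ?exprn_ge0 ?ler_wpM2l ?lerXn2r ?nnegrE.
Qed.

Lemma geometric_le n : \sum_(i < n) (2^-1 : K) ^+ i <= 2.
Proof.
suff -> : \sum_(i < n) (2^-1 : K) ^+ i = 2 - 2 * 2^-1 ^+ n.
  by rewrite gerBl mulr_ge0 ?exprn_ge0 ?invr_ge0.
elim: n => [|n IHn]; first by rewrite big_ord0 expr0 mulr1 subrr.
rewrite big_ord_recr /= IHn exprS mulVKf ?pnatr_eq0 //; ring.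
Qed.

Lemma series_bounded a : exists r M, 0 < r /\ bounded r r M a.
Proof.
have /convergentP[C [rho [C0 rho1 h]]] := valP a.
have rho0 : 0 < rho by exact: lt_le_trans rho1.
(* Half of the radius given by the geometric majorant leaves two geometric series of ratio 1/2, each
   bounded by 2. *)
exists (2 * rho)^-1, (4 * C); split; first by rewrite invr_gt0 mulr_gt0.
move=> n; apply: (@le_trans _ _ (\sum_(i < n) \sum_(j < n) C * (2^-1 ^+ i * 2^-1 ^+ j))).
  apply: ler_sum => i _; apply: ler_sum => j _.
  rewrite -mulrA -!exprD invfM exprMn mulrCA [leRHS]mulrC.
  apply: ler_wpM2l; first by rewrite exprn_ge0 ?invr_ge0.
  by rewrite exprVn ler_pdivrMr ?exprn_gt0 //; exact: h.
have -> : \sum_(i < n) \sum_(j < n) C * (2^-1 ^+ i * 2^-1 ^+ j) =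
    C * ((\sum_(i < n) 2^-1 ^+ i) * (\sum_(i < n) 2^-1 ^+ i)).
  rewrite mulr_suml mulr_sumr; apply: eq_bigr => i _.
  by rewrite mulr_sumr mulr_sumr.
rewrite mulrC; apply: ler_wpM2r => //.
have -> : 4 = 2 * 2 :> K by ring.
by apply: ler_pM; rewrite ?geometric_le // sumr_ge0 // => i _; rewrite exprn_ge0 ?invr_ge0.
Qed.

Lemma bounded_near a : exists r M, 0 < r /\
  forall r' s', 0 <= r' <= r -> 0 <= s' <= r -> bounded r' s' M a.
Proof.
have [r [M [r0 h]]] := series_bounded a.
by exists r, M; split=> // r' s' hr hs; exact: bounded_mono h.
Qed.

Lemma bounded_convergent (f : series2 K) r s M : 0 < r -> 0 < s ->
  (forall i j, `|f i j| * r ^+ i * s ^+ j <= M) -> f \in @convergent K.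
Proof.
move=> r0 s0 h; apply/asboolP; exists M, (r^-1 + s^-1) => i j.
have M0 : 0 <= M by apply: le_trans (h 0%N 0%N); rewrite !mulr_ge0.
have {}h : `|f i j| <= M * (r^-1 ^+ i * s^-1 ^+ j).
  by rewrite !exprVn -invfM -ler_pdivrMr ?invr_gt0 ?mulr_gt0 ?exprn_gt0 // invrK mulrA.
apply: le_trans h _; rewrite ler_wpM2l // exprD.
by apply: ler_pM; rewrite ?exprn_ge0 ?invr_ge0 ?(ltW r0) ?(ltW s0) ?lerXn2r ?nnegrE
  ?addr_ge0 ?invr_ge0 ?(ltW r0) ?(ltW s0) // ?lerDl ?lerDr invr_ge0 ltW.
Qed.

(** Closedness for the topology given by the order of vanishing. *)
Definition stable_limits (S : O -> Prop) : Prop :=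
  forall a, (forall n, exists2 b, S b & vanishes_to n (a - b)) -> S a.

(** Iterating from 0, the contraction for the order makes each coefficient stationary, and the
    invariant ball bounds all iterates in norm. The series of final coefficients therefore converges
    and is fixed. *)
Lemma contraction_fixpoint (S : O -> Prop) (F : O -> O) r s M : stable_limits S ->
  0 < r -> 0 < s -> 0 <= M -> S 0 ->
  (forall a, S a -> S (F a)) ->
  (forall n a b, S a -> S b -> vanishes_to n (a - b) -> vanishes_to n.+1 (F a - F b)) ->
  (forall a, S a -> bounded r s M a -> bounded r s M (F a)) ->
  exists2 a, S a & F a = a.
Proof.
move=> lim r0 s0 M0 S0 FS Fc Fb; pose x n := iter n F 0.
have Sx n : S (x n) by elim: n => //= n; exact: FS.
have bx n : bounded r s M (x n).
  elim: n => [m|n IHn] /=; last exact: Fb.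
  by rewrite /nrm big1 // => i _; rewrite big1 // => j _; rewrite cseries2_0 normr0 !mul0r.
have cx n : vanishes_to n (x n.+1 - x n) by elim: n => [|n IHn] //; exact: Fc (Sx _) (Sx _) IHn.
have cxn n m : vanishes_to n (x (m + n)%N - x n).
  elim: m => [|m IHm]; first by rewrite subrr.
  rewrite addSn -[_ - _](subrKA (x (m + n)%N)); apply: vanishes_toD => //.
  by apply: vanishes_to_leq (cx _); exact: leq_addl.
(* The coefficient (i, j) no longer changes from iterate i + j + 1 on. *)
pose f : series2 K := fun i j => coef2 (x (i + j).+1) i j.
have fc : f \in @convergent K.
  by apply: (@bounded_convergent _ r s M) => // i j; apply: bounded_coef; rewrite // ltW.
pose y : O := CSeries2 fc.
have yx n : vanishes_to n (y - x n).
  move=> i j lt; rewrite cseries2B; apply/eqP; rewrite subr_eq0 -subr_eq0 -opprB oppr_eq0.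
  have -> : coef2 y i j = coef2 (x (i + j).+1) i j by [].
  rewrite -cseries2B -(subnK lt); apply/eqP.
  by apply: (cxn (i + j).+1).
have Sy : S y by apply: lim => n; exists (x n).
exists y => //; apply/eqP; rewrite -subr_eq0; apply/eqP/vanishes_all => n.
rewrite -[_ - _](subrKA (x n.+1)); apply: vanishes_toD.
  by apply: (@vanishes_to_leq _ _ n.+1) => //; apply: Fc.
by rewrite -opprB; apply/vanishes_toN/(vanishes_to_leq _ (yx n.+1)).
Qed.

End SeriesNorms.

Lemma taylor_shift (R : comNzRingType) (p : {poly R}) c : exists q : {poly R},
  [/\ q = p \Po ('X + c%:P), q`_0 = p.[c], q`_1 = p^`().[c] & forall a, q.[a] = p.[a + c]].
Proof.
exists (p \Po ('X + c%:P)); split=> // [||a]; last by rewrite horner_comp !hornerE.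
  by rewrite -horner_coef0 horner_comp !hornerE.
have <- : ((p \Po ('X + c%:P))^`())`_0 = (p \Po ('X + c%:P))`_1 by rewrite coef_deriv mulr1n.
rewrite -horner_coef0 deriv_comp derivD derivX derivC addr0 mulr1.
by rewrite horner_comp !hornerE.
Qed.

(** * Solving equations in convergent power series *)

Section SeriesEquations.
Variable K : numFieldType.
Local Notation O := (cseries2 K).
Implicit Types (a b c q xi : O) (r s M : K) (P Q : {poly O}).
Local Notation u := (germ ('X_0 : {mpoly K[2]})).
Local Notation T := (shift 1 0).

Lemma positive_min r s : 0 < r -> 0 < s -> exists m : K, [/\ 0 < m, m <= r & m <= s].
Proof.
move=> r0 s0; case: (real_leP (gtr0_real r0) (gtr0_real s0)) => h; first by exists r.
by exists s; rewrite s0 lexx ltW.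
Qed.

Lemma horner_bounded Q : exists r C, [/\ 0 < r, 0 <= C & forall t a, 0 < t <= r ->
  bounded t t 1 a -> bounded t t C Q.[a]].
Proof.
elim/poly_ind: Q => [|Q c [r [C [r0 C0 h]]]].
  exists 1, 0; split=> // t a _ _ n; rewrite horner0 /nrm big1 // => i _.
  by rewrite big1 // => j _; rewrite cseries2_0 normr0 !mul0r.
have [r' [M [r'0 hc]]] := bounded_near c.
have [m [m0 mr mr']] := positive_min r0 r'0.
have M0 : 0 <= M.
  by apply: (@bounded_ge0 K 0 0 M c); apply: hc; rewrite lexx ltW.
exists m, (C + M); split; rewrite ?addr_ge0 // => t a /andP[t0 tm] ha.
rewrite hornerMXaddC; apply: boundedD; rewrite ?(ltW t0) //; last first.
  by apply: hc; rewrite ltW //= (le_trans tm).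
rewrite -[C]mulr1; apply: boundedM; rewrite ?(ltW t0) //.
by apply: h; rewrite // t0 (le_trans tm).
Qed.

Lemma horner_difference Q a b : exists D, Q.[a] - Q.[b] = (a - b) * D /\
  (const_coef a = 0 -> const_coef b = 0 -> const_coef D = const_coef Q`_1).
Proof.
elim/poly_ind: Q => [|Q c [D [hD _]]].
  by exists 0; rewrite !horner0 subrr mulr0 coef0.
exists (D * a + Q.[b]); rewrite !hornerMXaddC; split.
  rewrite mulrDr mulrA -hD; ring.
move=> ha hb; rewrite coefD coefMX coefC /= addr0 rmorphD rmorphM /= ha mulr0 add0r.
by rewrite -horner_map /= hb horner_coef0 coef_map.
Qed.

Lemma small_bounded a e : const_coef a = 0 -> 0 < e ->
  exists2 r, 0 < r & forall t, 0 < t <= r -> bounded t t e a.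
Proof.
move=> a0 e0; have [r [M [r0 h]]] := series_bounded a.
have M0 := bounded_ge0 h; have eM : 0 < e + M by rewrite ltr_wpDr.
(* Chosen so that l <= 1 and l M <= e; every monomial of positive degree shrinks at least by l. *)
pose l := e / (e + M); have l0 : 0 < l by rewrite divr_gt0.
have l1 : l <= 1 by rewrite ler_pdivrMr // mul1r lerDl.
have hs : bounded (l * r) (l * r) e a.
  apply: (@bounded_le _ _ _ (l * M)).
    by rewrite mulrAC ler_pdivrMr // ler_wpM2l ?(ltW e0) // lerDr ltW.
  apply: bounded_scale h; rewrite ?(ltW r0) ?(ltW l0) // => i j.
  rewrite -exprD; case: (i + j)%N (addn_eq0 i j) => [|n _ _].
    by move=> /esym/andP[/eqP -> /eqP ->]; rewrite [coef2 _ _ _]a0 eqxx.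
  by rewrite exprS ler_piMr ?exprn_ile1 ?(ltW l0).
exists (l * r) => [|t /andP[t0 tl]]; first by rewrite mulr_gt0.
by apply: bounded_mono hs; rewrite (ltW t0).
Qed.

(** Split Q(a) = q0 + a (q1 + a R(a)). As q0 and q1 vanish at the origin, a small ball is mapped
    into itself on a small polydisc, and the order of a difference increases. *)
Lemma small_fixpoint (S : O -> Prop) Q : stable_limits S -> S 0 ->
  (forall a, S a -> S Q.[a]) -> const_coef Q`_0 = 0 -> const_coef Q`_1 = 0 ->
  exists2 a, S a & const_coef a = 0 /\ Q.[a] = a.
Proof.
move=> lim S0 SQ q0 q1.
have Qe a : Q.[a] = Q`_0 + a * (Q`_1 + a * (drop_poly 2 Q).[a]).
  rewrite -[in LHS](poly_take_drop 2 Q) hornerD hornerM hornerXn.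
  rewrite horner_poly !big_ord_recl big_ord0 /= expr0 expr1; ring.
have [r1 [C [r10 C0 hC]]] := horner_bounded (drop_poly 2 Q).
(* With d C <= 1/4, |q0| <= d/4 and |q1| <= 1/4, the ball of radius d is preserved: the total is at
   most 3 d / 4. *)
pose d : K := (4 * (C + 1))^-1.
have C1 : 0 < C + 1 by rewrite ltr_wpDl.
have d0 : 0 < d by rewrite invr_gt0 mulr_gt0.
have d4 : d * C <= 4^-1.
  by rewrite /d invfM -mulrA ler_piMr ?invr_ge0 // mulrC ler_pdivrMr // mul1r lerDl.
have d1 : d <= 1.
  rewrite invf_le1 ?mulr_gt0 //; apply: (@le_trans _ _ 4); first by rewrite ler1n.
  by rewrite ler_peMr // lerDr.
have d40 : 0 < d / 4 by rewrite divr_gt0.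
have i40 : (0 : K) < 4^-1 by rewrite invr_gt0.
have [r2 r20 h2] := small_bounded q0 d40; have [r3 r30 h3] := small_bounded q1 i40.
have [m [m0 m1 m2]] := positive_min r10 r20; have [t [t0 tm t3]] := positive_min m0 r30.
have t1 := le_trans tm m1; have t2 := le_trans tm m2.
pose S' a := S a /\ const_coef a = 0.
have [|||||a [Sa a0] Qa] := @contraction_fixpoint K S' (horner Q) t t d _ t0 t0 (ltW d0).
- move=> a h; split; first by apply: lim => n; have [b []] := h n; exists b.
  have [b [_ b0]] := h 1%N; rewrite vanishes_to1 rmorphB /= b0 subr0; exact.
- by split=> //; rewrite rmorph0.
- move=> a [Sa a0]; split; first exact: SQ.
  by rewrite Qe rmorphD rmorphM /= q0 a0 mul0r addr0.
- move=> n a b [Sa a0] [Sb b0] hab; have [D [-> hD]] := horner_difference Q a b.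
  by rewrite -addn1; apply: vanishes_toM => //; apply/vanishes_to1; rewrite hD.
- move=> a _ ha; have tt0 := ltW t0.
  have hG : bounded t t C (drop_poly 2 Q).[a].
    by apply: hC; rewrite ?t0 //; exact: bounded_le ha.
  rewrite Qe; apply: (@bounded_le _ _ _ (d / 4 + d * (4^-1 + d * C))).
    have -> : d / 4 + d * (4^-1 + d * C) = d * (4^-1 + 4^-1 + d * C) by ring.
    rewrite ler_piMr ?(ltW d0) //; apply: (@le_trans _ _ (4^-1 + 4^-1 + 4^-1)).
      by rewrite lerD2l.
    have -> : 4^-1 + 4^-1 + 4^-1 = 3 / 4 :> K by ring.
    by rewrite ler_pdivrMr // mul1r ler_nat.
  apply: boundedD => //; first by apply: h2; rewrite t0.
  apply: boundedM => //; apply: boundedD => //; first by apply: h3; rewrite t0.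
  exact: boundedM.
by exists a.
Qed.

Lemma v_series_stable : stable_limits (fun a => a \in v_series K).
Proof.
move=> a h; apply/v_seriesP => i j; have [b /v_seriesP hb] := h (i.+1 + j).+1.
by move=> /(_ i.+1 j (ltnSn _)); rewrite cseries2B hb subr0.
Qed.

Definition cst (k : K) : O := germ k%:MP.

HB.instance Definition _ := GRing.RMorphism.copy cst (@germ K \o @mpolyC 2 K).

Lemma const_coef_cst k : const_coef (cst k) = k.
Proof.
rewrite /const_coef germE mcoeffC; case: eqP => [_|[]]; first by rewrite mulr1.
by apply/mnmP; elim/forall_ord2; rewrite mnm2E mnm0E.
Qed.

Lemma cst_v_series k : cst k \in v_series K.
Proof.
apply/v_seriesP => i j; rewrite germE mcoeffC; case: eqP => [/mnmP/(_ 0%R)|_].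
  by rewrite mnm2E mnm0E.
by rewrite mulr0.
Qed.

(** After scaling, a is 1 - b with b zero at the origin; a solution of x = b + b x makes 1 + x the
    inverse. *)
Lemma invertible_series a : const_coef a != 0 -> invertible a.
Proof.
move=> a0; pose b := 1 - cst (const_coef a)^-1 * a.
have b0 : const_coef b = 0 by rewrite rmorphB rmorphM rmorph1 /= const_coef_cst mulVf ?subrr.
have Qx x : (b%:P + b%:P * 'X).[x] = b + b * x by rewrite !hornerE.
have [//|//|//|||x _ [_ hx]] := @small_fixpoint (fun=> True) (b%:P + b%:P * 'X).
- by rewrite coefD coefMX !coefC addr0.
- by rewrite coefD coefMX !coefC add0r.
exists (cst (const_coef a)^-1 * (1 + x)); rewrite Qx in hx.
have -> : a * (cst (const_coef a)^-1 * (1 + x)) = (1 - b) * (1 + x).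
  by rewrite /b subKr mulrA [a * _]mulrC.
transitivity (1 + x - (b + b * x)); first by ring.
by rewrite hx addrK.
Qed.

Lemma v_series_inverse a b : a \in v_series K -> a * b = 1 -> b \in v_series K.
Proof.
move=> va ab1; rewrite v_seriesE; apply/eqP.
have : T (a * b) = 0 by apply/eqP; rewrite -v_seriesE ab1 rpred1.
by rewrite shift1_vM // => /(congr1 ( *%R b)); rewrite mulr0 mulrA [b * a]mulrC ab1 mul1r.
Qed.

(** After moving the root to 0, a Newton step with fixed slope, a - d P'(a), has no linear term at
    the origin. It preserves the closed subring of series in v, which therefore contains the
    root. *)
Lemma hensel P x0 : P \is a polyOver (v_series K) ->
  root (map_poly (@const_coef K) P) x0 -> ~~ root (map_poly (@const_coef K) P^`()) x0 ->
  exists2 a, a \in v_series K & const_coef a = x0 /\ P.[a] = 0.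
Proof.
move=> vP /rootP P0 P1.
have [P' [P'E P'c0 P'1 P'x]] := taylor_shift P (cst x0).
have vP' : P' \is a polyOver (v_series K).
  by rewrite P'E polyOver_comp // rpredD ?polyOverX ?polyOverC ?cst_v_series.
have P'0 : const_coef P'`_0 = 0 by rewrite P'c0 -horner_map /= const_coef_cst.
have [d dP] : invertible P'`_1.
  by apply: invertible_series; rewrite P'1 -horner_map /= const_coef_cst.
have vd : d \in v_series K by apply: v_series_inverse dP; exact: (polyOverP vP').
have Qx a : ('X - d%:P * P').[a] = a - d * P'.[a] by rewrite !hornerE.
have [|||||a va [a0 ha]] := @small_fixpoint (fun a => a \in v_series K) ('X - d%:P * P').
- exact: v_series_stable.
- exact: rpred0.
- by move=> a va; rewrite Qx rpredB // rpredM // rpred_horner.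
- by rewrite coefB coefX coefCM sub0r rmorphN rmorphM /= P'0 mulr0 oppr0.
- by rewrite coefB coefX coefCM mulrC dP subrr rmorph0.
exists (a + cst x0); first by rewrite rpredD ?cst_v_series.
split; first by rewrite rmorphD /= a0 add0r const_coef_cst.
move: ha; rewrite Qx P'x => /eqP; rewrite -subr_eq0 addrAC subrr add0r oppr_eq0 => /eqP.
by move=> /(congr1 ( *%R P'`_1)); rewrite mulrA dP mul1r mulr0.
Qed.

Lemma shift1_bounded r s M a : 0 < r -> 0 <= s -> bounded r s M a -> bounded r s (M / r) (T a).
Proof.
move=> r0 s0 h n; rewrite ler_pdivlMr //; apply: le_trans (h n.+1).
rewrite /nrm big_ord_recl -[leLHS]add0r; apply: lerD.
  by apply: sumr_ge0 => j _; rewrite !mulr_ge0 ?exprn_ge0 // ltW.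
rewrite mulr_suml; apply: ler_sum => i _; rewrite big_ord_recr /= mulr_suml.
rewrite -[leLHS]addr0; apply: lerD; last by rewrite !mulr_ge0 ?exprn_ge0 // ltW.
by apply: ler_sum => j _; rewrite shift1E /bump /= add1n exprSr mulrAC mulrA.
Qed.

(** Weierstrass division by u - xi. The quotient solves q = T a + xi T q, which says that [T] kills
    the remainder a - (u - xi) q. *)
Lemma division xi a : xi \in v_series K -> vanishes_to 2 xi ->
  exists q c, c \in v_series K /\ a = (u - xi) * q + c.
Proof.
move=> vxi h2; have [r1 [M [r10 ha]]] := bounded_near a.
have [r2 [N [r20 hxi]]] := bounded_near xi.
have [r [r0 rr1 rr2]] := positive_min r10 r20.
have {}ha : bounded r r M a by apply: ha; rewrite (ltW r0).
have {}hxi : bounded r r N xi by apply: hxi; rewrite (ltW r0).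
have M0 := bounded_ge0 ha; have N0 := bounded_ge0 hxi.
have r20' : 0 < r / 2 by rewrite divr_gt0.
have rN : 0 < r / 2 + N by rewrite ltr_wpDr.
(* The monomials of xi are positive powers of v, so shrinking only the radius in v to l r brings its
   norm down to r/2, while the radius r in u, which governs [T], is kept. *)
pose l := (r / 2) / (r / 2 + N); have l0 : 0 < l by rewrite divr_gt0.
have l1 : l <= 1 by rewrite ler_pdivrMr // mul1r lerDl.
have lr0 : 0 < l * r by rewrite mulr_gt0.
have {}hxi : bounded r (l * r) (r / 2) xi.
  apply: (@bounded_le _ _ _ (l * N)).
    by rewrite mulrAC ler_pdivrMr // ler_wpM2l ?(ltW r20') // lerDr ltW.
  rewrite -[X in bounded X](mul1r r); apply: bounded_scale hxi; rewrite ?(ltW r0) ?(ltW l0) //.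
  move=> [|i] [|j]; rewrite ?expr1n ?mul1r.
  - by rewrite h2 ?eqxx.
  - by move=> _; rewrite exprS ler_piMr ?exprn_ile1 ?(ltW l0).
  - by rewrite (v_seriesP _ vxi) eqxx.
  - by rewrite (v_seriesP _ vxi) eqxx.
have {}ha : bounded r (l * r) (M / r) (T a).
  apply: shift1_bounded; rewrite ?(ltW lr0) //; apply: bounded_mono ha.
    by rewrite lexx ltW.
  by rewrite (ltW lr0) ler_piMl // ltW.
(* [T] costs a factor 1/r, so xi T has norm at most 1/2, and twice the norm of T a bounds an
   invariant ball. *)
pose M' := M / r * 2; have M'0 : 0 <= M' by rewrite !mulr_ge0 ?invr_ge0 ?(ltW r0).
have [|||||q _ hq] := @contraction_fixpoint K (fun=> True) (fun q => T a + xi * T q)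
    r (l * r) M' _ r0 lr0 M'0.
- by [].
- by [].
- by [].
- move=> n b c _ _ hbc; rewrite opprD addrACA subrr add0r -mulrBr -shift1B.
  case: n hbc => [|n] hbc.
    exact: (@vanishes_to_leq _ 1 (2 + 0)) (vanishes_toM h2 _).
  exact: vanishes_toM h2 (vanishes_shift1 hbc).
- move=> b _ hb; have -> : M' = M / r + r / 2 * (M' / r).
    rewrite /M'; have -> : r / 2 * (M / r * 2 / r) = (2 / 2) * (r / r) * (M / r) by ring.
    by rewrite !divff ?(gt_eqF r0) ?pnatr_eq0 // !mul1r mulr_natr.
  apply: boundedD; rewrite ?(ltW r0) ?(ltW lr0) //.
  apply: boundedM; rewrite ?(ltW r0) ?(ltW lr0) //.
  by apply: shift1_bounded; rewrite ?(ltW lr0).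
exists q, (a - (u - xi) * q); split; last by rewrite addrC subrK.
by rewrite v_seriesE shift1B mulrBl shift1B shift1_uM shift1_vM // opprB addrA hq subrr.
Qed.

(** The remainders of a and b are series in v; their product is a multiple of u - xi free of u,
    hence 0, and one remainder is 0. *)
Lemma u_sub_prime xi : xi \in v_series K -> vanishes_to 2 xi -> prime_elt (u - xi).
Proof.
move=> hv h2 a b [q hq]; have [q1 [c1 [hc1 ha]]] := division a hv h2.
have [q2 [c2 [hc2 hb]]] := division b hv h2.
have e : c1 * c2 = (u - xi) * (q - (q1 * b + c1 * q2)).
  by rewrite mulrBr -hq ha hb; ring.
have c0 : c1 * c2 = 0.
  rewrite e (@u_sub_regular K xi (q - (q1 * b + c1 * q2))) ?mulr0 //.
  by rewrite -e rpredM.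
have [h|h] := cseries2_domain c0.
- by left; exists q1; rewrite ha h addr0.
- by right; exists q2; rewrite hb h addr0.
Qed.

End SeriesEquations.

(** * Puiseux series and branches *)

Section Ramification.
Variable K : numFieldType.
Local Notation O := (cseries2 K).
Implicit Types (a b c q xi N : O) (z w : K).
Local Notation u := (germ ('X_0 : {mpoly K[2]})).
Local Notation T := (shift 1 0).

Lemma twist_convergent z a : (fun i j => coef2 a i j * z ^+ j) \in @convergent K.
Proof.
have /convergentP[C [r [C0 r1 h]]] := valP a; have r0 := le_trans ler01 r1.
apply/asboolP; exists C, (r * (1 + `|z|)) => i j.
rewrite normrM normrX exprMn mulrA; apply: ler_pM; rewrite ?exprn_ge0 //; first exact: h.
apply: (@le_trans _ _ ((1 + `|z|) ^+ j)).
  by rewrite lerXn2r ?nnegrE ?addr_ge0 // lerDr.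
by rewrite exprD ler_peMl ?exprn_ge0 ?addr_ge0 // exprn_ege1 // lerDl.
Qed.

(** The series a(u, z v): the Galois action for z a root of unity, and the restriction to v = 0 for
    z = 0. *)
Definition twist z a : O := CSeries2 (twist_convergent z a).

Lemma twistE z a i j : coef2 (twist z a) i j = coef2 a i j * z ^+ j. Proof. by []. Qed.

Lemma twist_is_additive z : {morph twist z : a b / a - b}.
Proof. by move=> a b; apply: cseries2P => i j; rewrite cseries2B !twistE cseries2B mulrBl. Qed.

HB.instance Definition _ z :=
  GRing.isZmodMorphism.Build O O (twist z) (twist_is_additive z).

Lemma twist_is_multiplicative z : monoid_morphism (twist z).
Proof.
split=> [|a b]; apply: cseries2P => i j.
  rewrite twistE cseries2_1; case: j => [|j]; first by rewrite mulr1.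
  by rewrite andbF mul0r.
rewrite twistE !cseries2M mulr_suml; apply: eq_bigr => k _.
rewrite mulr_suml; apply: eq_bigr => l _.
by rewrite !twistE mulrACA -exprD subnKC // -ltnS.
Qed.

HB.instance Definition _ z :=
  GRing.isMonoidMorphism.Build O O (twist z) (twist_is_multiplicative z).

Lemma twist_comp z w a : twist z (twist w a) = twist (w * z) a.
Proof. by apply: cseries2P => i j; rewrite !twistE exprMn mulrA. Qed.

Lemma twist1 a : twist 1 a = a.
Proof. by apply: cseries2P => i j; rewrite twistE expr1n mulr1. Qed.

Lemma twist_v_series z a : a \in v_series K -> twist z a \in v_series K.
Proof. by move=> /v_seriesP h; apply/v_seriesP => i j; rewrite twistE h mul0r. Qed.

Lemma twist_vanishes z n a : vanishes_to n a -> vanishes_to n (twist z a).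
Proof. by move=> h i j lt; rewrite twistE h ?mul0r. Qed.

Lemma twist_germ0 z : twist z u = u.
Proof.
apply: cseries2P => i [|j]; rewrite twistE ?mulr1 //.
by rewrite -[u]mulr1 germ_uM; case: i => [|i]; rewrite ?cseries2_1 ?andbF mul0r.
Qed.

Lemma const_coef_twist z a : const_coef (twist z a) = const_coef a.
Proof. by rewrite /const_coef twistE mulr1. Qed.

Lemma twist0_v_series xi : xi \in v_series K -> const_coef xi = 0 -> twist 0 xi = 0.
Proof.
move=> /v_seriesP h h0; apply: cseries2P => -[|i] [|j]; rewrite twistE cseries2_0.
- by rewrite [coef2 _ _ _]h0 mul0r.
- by rewrite expr0n mulr0.
- by rewrite h mul0r.
- by rewrite h mul0r.
Qed.

Lemma ramify_convergent n a :
  (fun i j => if (n %| j)%N then coef2 a i (j %/ n) else 0) \in @convergent K.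
Proof.
have /convergentP[C [r [C0 r1 h]]] := valP a; have r0 := le_trans ler01 r1.
apply/asboolP; exists C, r => i j; case: ifP => _; last first.
  by rewrite normr0 mulr_ge0 ?exprn_ge0.
apply: le_trans (h i (j %/ n)%N) _; rewrite ler_wpM2l // ler_weXn2l //.
by rewrite leq_add2l leq_div.
Qed.

(* The series [a(u, v ^ n)]. *)
Definition ramify n a : O := CSeries2 (ramify_convergent n a).

Lemma ramifyE n a i j :
  coef2 (ramify n a) i j = if (n %| j)%N then coef2 a i (j %/ n) else 0.
Proof. by []. Qed.

Lemma ramify_is_additive n : {morph ramify n : a b / a - b}.
Proof.
move=> a b; apply: cseries2P => i j; rewrite cseries2B !ramifyE.
by case: ifP => _; rewrite ?subr0 // cseries2B.
Qed.

HB.instance Definition _ n :=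
  GRing.isZmodMorphism.Build O O (ramify n) (ramify_is_additive n).

Lemma sum_multiples (V : zmodType) n m (f : nat -> V) : (0 < n)%N ->
  (forall l, ~~ (n %| l)%N -> f l = 0) ->
  \sum_(l < (m * n).+1) f l = \sum_(l < m.+1) f (l * n)%N.
Proof.
move=> n0 h; elim: m => [|m IHm]; first by rewrite mul0n !big_ord1.
rewrite mulSnr -addSn big_split_ord /= IHm [RHS]big_ord_recr /=; congr (_ + _).
case: n n0 h {IHm} => // n _ h; rewrite big_ord_recr /= big1 ?add0r => [|i _].
  by rewrite addSn mulSnr addnS.
rewrite h // addSnnS dvdn_addr ?dvdn_mull //.
by rewrite gtnNdvd // ltnS.
Qed.

Lemma u_sub_divides a b : a \in v_series K -> vanishes_to 2 a -> b \in v_series K ->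
  divides (u - a) (u - b) -> a = b.
Proof.
move=> va a2 vb [q hq].
have e : a - b = (u - a) * (q - 1) by rewrite mulrBr mulr1 -hq; ring.
apply/eqP; rewrite -subr_eq0 e (@u_sub_regular K a (q - 1)) ?mulr0 //.
by rewrite -e rpredB.
Qed.

Lemma germ0_const : const_coef u = 0.
Proof. by rewrite -[u]mulr1 /const_coef germ_uM. Qed.

Lemma u_sub_not_unit a : const_coef a = 0 -> ~ divides (u - a) 1.
Proof.
move=> a0 [q /(congr1 (@const_coef K))].
rewrite rmorph1 rmorphM rmorphB /= germ0_const a0 subr0 mul0r => /eqP.
by rewrite oner_eq0.
Qed.

Section RamificationIndex.
Variable m : nat.
Local Notation n := m.+1.
Let n0 : (0 < n)%N := isT.

Lemma ramify_is_multiplicative : monoid_morphism (ramify n).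
Proof.
split=> [|a b]; apply: cseries2P => i j; rewrite ramifyE.
  rewrite !cseries2_1; case: ifP => [/dvdnP[k' ->]|]; first by rewrite mulnK // muln_eq0 [n == _]eqn0Ngt n0 orbF.
  by case: j => [|j]; rewrite ?dvdn0 // andbF.
rewrite !cseries2M; case: ifP => [/dvdnP[k' ->]|nj].
  rewrite mulnK //; apply: eq_bigr => k _.
  rewrite (sum_multiples k' (f := fun l => coef2 (ramify n a) k l *
    coef2 (ramify n b) (i - k) (k' * n - l)) n0) => [|l hl]; last first.
    by rewrite ramifyE (negPf hl) mul0r.
  by apply: eq_bigr => l _; rewrite !ramifyE -mulnBl !dvdn_mull // !mulnK.
rewrite big1 // => k _; rewrite big1 // => l _; rewrite !ramifyE.
case: ifP => [hl|]; last by rewrite mul0r.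
case: ifP => [hjl|]; last by rewrite mulr0.
have lj : (l <= j)%N by rewrite -ltnS.
by rewrite -(subnKC lj) dvdn_add in nj.
Qed.

HB.instance Definition _ :=
  GRing.isMonoidMorphism.Build O O (ramify n) ramify_is_multiplicative.

Lemma ramify_inj : injective (ramify n).
Proof.
move=> a b e; apply: cseries2P => i j.
have := congr1 (fun c => coef2 c i (j * n)) e.
by rewrite !ramifyE dvdn_mull // mulnK.
Qed.

Lemma twist_ramify z a : z ^+ n = 1 -> twist z (ramify n a) = ramify n a.
Proof.
move=> zn; apply: cseries2P => i j; rewrite twistE ramifyE.
by case: ifP => [/dvdnP[k' ->]|]; rewrite ?mul0r // mulnC exprM zn expr1n mulr1.
Qed.

Lemma twist0_ramify a : twist 0 (ramify n a) = twist 0 a.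
Proof.
apply: cseries2P => i [|j]; rewrite !twistE; first by rewrite ramifyE dvdn0 div0n.
by rewrite expr0n !mulr0.
Qed.

Lemma ramify_germ0 : ramify n u = u.
Proof.
apply: cseries2P => i j; rewrite ramifyE -[u]mulr1 !germ_uM.
case: i => [|i]; first by case: ifP.
rewrite !cseries2_1; case: ifP => [/dvdnP[k' ->]|].
  by rewrite mulnK // muln_eq0 [n == _]eqn0Ngt n0 orbF.
by case: j => [|j]; rewrite ?dvdn0 // andbF.
Qed.

(** Invariance multiplies the coefficient of v^j by z^j, so only exponents divisible by n
    survive. *)
Lemma ramify_fixed z a : n.-primitive_root z -> twist z a = a -> exists b, a = ramify n b.
Proof.
move=> hz ha; have /convergentP[C [r [C0 r1 h]]] := valP a.
have bc : (fun i j => coef2 a i (j * n)) \in @convergent K.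
  apply/asboolP; exists C, (r ^+ n) => i j; apply: le_trans (h i (j * n)%N) _.
  rewrite ler_wpM2l // -exprM ler_weXn2l // mulnDr leq_add ?leq_pmull // mulnC //.
exists (CSeries2 bc); apply: cseries2P => i j; rewrite ramifyE.
case: ifP => [/dvdnP[k' ->]|nj]; first by rewrite mulnK.
have /eqP := congr1 (fun c => coef2 c i j) ha.
rewrite /= twistE -subr_eq0 -{2}[coef2 a i j]mulr1 -mulrBr mulf_eq0 subr_eq0.
by rewrite -(prim_order_dvd hz) nj orbF => /eqP.
Qed.

Section ConjugateProduct.
Variables (z : K) (xi : O).
Hypothesis hz : n.-primitive_root z.
Hypothesis vxi : xi \in v_series K.
Hypothesis xi2 : vanishes_to 2 xi.
Hypothesis xi_fixed : forall w, w ^+ n = 1 -> twist w xi = xi -> w = 1.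

Local Notation F k := (u - twist (z ^+ k) xi).

Lemma conjugate_product_twist : twist z (\prod_(k < n) F k) = \prod_(k < n) F k.
Proof.
rewrite rmorph_prod /=.
transitivity (\prod_(k < n) F k.+1).
  by apply: eq_bigr => k _; rewrite rmorphB /= twist_germ0 twist_comp exprSr.
by rewrite big_ord_recr [RHS]big_ord_recl /= (prim_expr_order hz) mulrC.
Qed.

Lemma exists_norm : exists N, ramify n N = \prod_(k < n) F k.
Proof. by have [N ->] := ramify_fixed hz conjugate_product_twist; exists N. Qed.

Lemma conjugate_v_series k : twist (z ^+ k) xi \in v_series K.
Proof. exact: twist_v_series. Qed.

Lemma conjugate_eq (i j : 'I_n) : twist (z ^+ i) xi = twist (z ^+ j) xi -> i = j.
Proof.
move=> /(congr1 (twist (z ^+ i)^-1)); rewrite !twist_comp.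
have zi0 : z ^+ i != 0.
  apply: expf_neq0; apply/eqP => z0; have /eqP := prim_expr_order hz.
  by rewrite z0 expr0n gtn_eqF // eq_sym oner_eq0.
rewrite divff // twist1 => /esym/xi_fixed e.
have {}e : z ^+ j = z ^+ i.
  rewrite -[LHS](divfK zi0) e ?mul1r // expr_div_n ![(z ^+ _) ^+ n]exprAC.
  by rewrite (prim_expr_order hz) !expr1n divr1.
by move/eqP: e; rewrite (eq_prim_root_expr hz) !modn_small // => /eqP/val_inj.
Qed.

Variable N : O.
Hypothesis hN : ramify n N = \prod_(k < n) F k.

Lemma xi_const : const_coef xi = 0. Proof. exact: xi2. Qed.

(** a(u, v^n) is invariant under the twists, so divisibility by u - xi spreads to all conjugates.
    These are distinct primes, hence their product divides; the cofactor is invariant too and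
    descends to a series in v^n. *)
Lemma norm_divides a : divides N a <-> divides (u - xi) (ramify n a).
Proof.
split=> [[q ->]|[q hq]].
  rewrite rmorphM /= hN.
  by rewrite big_ord_recl expr0 twist1 -mulrA; eexists.
have [c hc] : divides (\prod_(k < n) F k) (ramify n a).
  apply: prod_divides; first exact: index_enum_uniq.
    move=> k _; split.
    - by apply: u_sub_prime; [exact: conjugate_v_series|exact: twist_vanishes].
    - by apply: u_sub_not_unit; rewrite const_coef_twist xi_const.
    exists (twist (z ^+ k) q); rewrite -(@twist_ramify (z ^+ k)); last first.
      by rewrite exprAC (prim_expr_order hz) expr1n.
    by rewrite hq rmorphM rmorphB /= twist_germ0.
  move=> i j _ _ /u_sub_divides h; apply: conjugate_eq; apply: h.
  - exact: conjugate_v_series.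
  - exact: twist_vanishes.
  - exact: conjugate_v_series.
have P0 : \prod_(k < n) F k != 0.
  apply/eqP => P0; suff : ramify n N = 0 -> False by apply; rewrite hN.
  move: P0; elim/big_ind: _ => [/eqP|x y hx hy /cseries2_domain[]//|k _ /eqP h].
  - by rewrite oner_eq0.
  - by case/negP: (u_sub_neq0 (conjugate_v_series k)).
have tc : twist z c = c.
  apply: (cseries2_mulfI P0); rewrite -hc -[in LHS]conjugate_product_twist.
  by rewrite -rmorphM /= -hc twist_ramify // (prim_expr_order hz).
have [d hd] := ramify_fixed hz tc; exists d.
by apply: ramify_inj; rewrite hc rmorphM /= hN hd.
Qed.

End ConjugateProduct.
End RamificationIndex.
End Ramification.

Section Branches.
Variables (K : numFieldType) (m k : nat) (z : K) (xi : 'I_k -> cseries2 K).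
Local Notation O := (cseries2 K).
Local Notation n := m.+1.
Local Notation u := (germ ('X_0 : {mpoly K[2]})).
Hypothesis hz : n.-primitive_root z.
Hypothesis vxi : forall i, xi i \in v_series K.
Hypothesis xi2 : forall i, vanishes_to 2 (xi i).
Hypothesis xi_fixed : forall i w, w ^+ n = 1 -> twist w (xi i) = xi i -> w = 1.
Hypothesis xi_distinct : forall i j w, w ^+ n = 1 -> xi i = twist w (xi j) -> i = j.

(* The norms [N i] of the factors [u - xi i] are irreducible power series, and
   the last hypothesis says that the cofactor of their product in [h] is a unit. *)
Lemma puiseux_branches (h c : O) :
  (forall i, divides (u - xi i) (ramify n h)) ->
  twist 0 h = u ^+ (n * k) * c -> const_coef c != 0 ->
  exists (g : 'I_k -> O) (w : O),
    [/\ forall i, irreducible_elt (g i), forall i j, associated (g i) (g j) -> i = j,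
        invertible w & h = w * \prod_i g i].
Proof.
move=> dh h0 c0.
have [g hg] := choice (fun i => exists_norm (xi i) hz).
have gP i a : divides (g i) a <-> divides (u - xi i) (ramify n a).
  exact: (norm_divides hz (vxi i) (xi2 i) (@xi_fixed i) (hg i)).
have xi0 i : const_coef (xi i) = 0 by exact: xi2.
have g1 i : ~ divides (g i) 1.
  by rewrite gP rmorph1; exact: u_sub_not_unit.
(* Primality is pulled back from u - xi through the equivalence [gP]; irreducibility follows in a
   domain. *)
have pg i : prime_elt (g i).
  move=> a b /gP; rewrite rmorphM /= => /(u_sub_prime (vxi i) (@xi2 i))[/gP|/gP]; by [left|right].
have dg i j : divides (g i) (g j) -> i = j.
  move=> /gP; rewrite hg => h'.
  have [l _] := prime_divides_prod (u_sub_prime (vxi i) (@xi2 i)) (u_sub_not_unit (xi0 i)) h'.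
  move=> /(u_sub_divides (vxi i) (@xi2 i) (twist_v_series _ (vxi j))).
  by move=> /xi_distinct; apply; rewrite exprAC (prim_expr_order hz) expr1n.
have g_neq0 i : g i <> 0.
  move=> gi0; have : ramify n (g i) = 0 by rewrite gi0 rmorph0.
  rewrite hg; elim/big_ind: _ => [/eqP|a b ha hb /cseries2_domain[]//|l _ /eqP].
    by rewrite oner_eq0.
  by apply/negP/u_sub_neq0/twist_v_series.
have [w hw] : divides (\prod_i g i) h.
  apply: prod_divides; first exact: index_enum_uniq.
    by move=> i _; split=> //; apply/gP.
  by move=> i j _ _; exact: dg.
exists g, w; split=> //; last by rewrite mulrC.
- move=> i; split=> // [[b hb]|a b e]; first by apply: (g1 i); exists b.
  have cancel d : g i = g i * d -> d = 1.
    by move=> e'; apply: (@cseries2_mulfI _ (g i)); [exact/eqP/g_neq0|rewrite -e' mulr1].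
  have [] : divides (g i) a \/ divides (g i) b by apply: pg; exists 1; rewrite -e mulr1.
    move=> [d hd]; right; exists d; apply: cancel.
    by rewrite {1}e hd -!mulrA [d * b]mulrC.
  move=> [d hd]; left; exists d; apply: cancel.
  by rewrite {1}e hd mulrCA.
- by move=> i j [w' _ e]; apply: dg; exists w'; rewrite mulrC.
(* At v = 0 each norm becomes u^n, so comparison with h(u, 0) = u^(n k) c shows that the cofactor
   restricts to c, a unit. *)
- have tg i : twist 0 (g i) = u ^+ n.
    rewrite -(twist0_ramify m) hg rmorph_prod /=.
    rewrite (eq_bigr (fun=> u)) ?prodr_const ?card_ord // => l _.
    rewrite rmorphB /= twist_germ0 twist0_v_series ?subr0 ?twist_v_series //.
    by rewrite const_coef_twist.
  apply: invertible_series; rewrite -(const_coef_twist 0).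
  suff -> : twist 0 w = c by [].
  apply: (@cseries2_mulfI _ (u ^+ (n * k))); last first.
    rewrite -h0 hw rmorphM rmorph_prod /= (eq_bigr (fun=> u ^+ n)) //.
    by rewrite prodr_const card_ord -exprM.
  by rewrite cseries2_expf_neq0 // -[u]subr0 u_sub_neq0 ?rpred0.
Qed.

End Branches.

(** * The four branches *)

Section LocalParametrization.
Variable R : comNzRingType.
Implicit Types (s t v x y : R).

(** The difference quotient of u(1, t) at t0; at s = 0 it is the derivative 4 t0^3 + 13. *)
Definition par_unit t0 s : R :=
  s ^+ 3 + 4 * (t0 * s ^+ 2) + 6 * (t0 ^+ 2 * s) + (4 * t0 ^+ 3 + 13).

Lemma par_u_local t0 s : t0 ^+ 4 + 13 * t0 = 0 -> par_u 1 (t0 + s) = s * par_unit t0 s.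
Proof. by move=> h; rewrite -[RHS]addr0 -h /par_u /par_unit; ring. Qed.

(* At the parameter [t = t0 + v * x], this is the equation [y = v ^ 9] divided
   by [v ^ 9], in the affine coordinate [y] of the plane. *)
Definition branch_eq v t0 x : R :=
  (x * par_unit t0 (v * x)) ^+ 9 * ((t0 + v * x) * par_u 1 (t0 + v * x) ^+ 3 - 1)
    - par_z 1 (t0 + v * x).

Lemma par_z_at_root t0 : t0 ^+ 4 + 13 * t0 = 0 -> par_z 1 t0 = - 1.
Proof.
move=> h; rewrite /par_z; have -> : par_u 1 t0 = 0 by rewrite -h /par_u; ring.
ring.
Qed.

(** At v = 0 the equation has the simple root 1 / (4 t0^3 + 13), from which Hensel's lemma
    starts. *)
Lemma branch_eq0 t0 x : t0 ^+ 4 + 13 * t0 = 0 ->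
  branch_eq 0 t0 x = 1 - (4 * t0 ^+ 3 + 13) ^+ 9 * x ^+ 9.
Proof.
move=> h; rewrite /branch_eq mul0r addr0 par_z_at_root //.
have -> : par_u 1 t0 = 0 by rewrite -h /par_u; ring.
rewrite /par_unit; ring.
Qed.

Definition aff_f1 x y : R := x ^+ 3 + y ^+ 4.

Definition aff_f13 x y : R := aff_f1 x y ^+ 3 * y + x ^+ 13.

Definition aff_f49gen x y : R :=
  13 * aff_f13 x y * aff_f1 x y ^+ 9 + 4 * aff_f13 x y ^+ 3 * x ^+ 10
    - 6 * aff_f13 x y ^+ 2 * x ^+ 23 + 4 * aff_f13 x y * x ^+ 36 - x ^+ 49 - aff_f1 x y ^+ 12.

Lemma aff_par t (c : R) (x := par_x 1 t * c) (y := par_y 1 t * c) : par_z 1 t * c = 1 ->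
  [/\ aff_f1 x y = par_u 1 t ^+ 49 * c ^+ 4, aff_f13 x y = t * x * aff_f1 x y ^+ 3
    & aff_f49gen x y = 0].
Proof.
move=> hc.
have eA : aff_f1 x y = par_u 1 t ^+ 49 * c ^+ 4.
  (* The affine equation has z = 1; the factor z c = 1 restores homogeneity, so that the projective
     identity applies. *)
  have hx : x ^+ 3 = x ^+ 3 * (par_z 1 t * c) by rewrite hc mulr1.
  rewrite -par_f1 /aff_f1 hx /x /y; ring.
have eB : aff_f13 x y = t * par_u 1 t ^+ 159 * c ^+ 13.
  rewrite -par_f13 /aff_f13 eA /x /y; ring.
split=> //; first by rewrite eA eB /x /par_x; move: (par_u 1 t) => U; ring.
have hA : aff_f1 x y ^+ 12 = aff_f1 x y ^+ 12 * (par_z 1 t * c) by rewrite hc mulr1.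
rewrite /aff_f49gen hA.
have := par_f49gen (s := 1) (t := t) erefl erefl => /(congr1 ( *%R^~ (c ^+ 49))).
rewrite mul0r => <-; rewrite eA eB /x; move: (par_u 1 t) => U; ring.
Qed.

(** The order 36 = 9 * 4 on the line y = 0 is exactly used up by nine conjugates for each of four
    branches. *)
Lemma aff_f49gen_x x : aff_f49gen x 0 = x ^+ 36 * (x ^+ 13 + 13 * x ^+ 4 - 1).
Proof. rewrite /aff_f49gen /aff_f13 /aff_f1; ring. Qed.

End LocalParametrization.

Section LocalParametrizationImages.
Variables (R T : comNzRingType) (phi : {rmorphism R -> T}).

Lemma rmorph_par_unit t0 s : phi (par_unit t0 s) = par_unit (phi t0) (phi s).
Proof. rewrite -/(is_image _ _ _) /par_unit; compute_image. Qed.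

Lemma rmorph_branch_eq v t0 x :
  phi (branch_eq v t0 x) = branch_eq (phi v) (phi t0) (phi x).
Proof.
have hp : is_image phi (v * x) (phi v * phi x) by compute_image.
have ht : is_image phi (t0 + v * x) (phi t0 + phi v * phi x) by compute_image.
have hn : is_image phi (par_unit t0 (v * x)) (par_unit (phi t0) (phi v * phi x)).
  by rewrite /is_image rmorph_par_unit hp.
have hu : is_image phi (par_u 1 (t0 + v * x)) (par_u 1 (phi t0 + phi v * phi x)).
  by rewrite /is_image rmorph_par_u rmorph1 ht.
have hz : is_image phi (par_z 1 (t0 + v * x)) (par_z 1 (phi t0 + phi v * phi x)).
  by rewrite /is_image rmorph_par_z rmorph1 ht.
have h1 : is_image phi 1 1 := rmorph1 phi.
by rewrite -/(is_image _ _ _) /branch_eq; compute_image.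
Qed.

Lemma rmorph_aff_f1 x y : phi (aff_f1 x y) = aff_f1 (phi x) (phi y).
Proof. by rewrite -/(is_image _ _ _) /aff_f1; compute_image. Qed.

Lemma rmorph_aff_f13 x y : phi (aff_f13 x y) = aff_f13 (phi x) (phi y).
Proof.
have h1 : is_image phi (aff_f1 x y) (aff_f1 (phi x) (phi y)) := rmorph_aff_f1 x y.
by rewrite -/(is_image _ _ _) /aff_f13; compute_image.
Qed.

Lemma rmorph_aff_f49gen x y : phi (aff_f49gen x y) = aff_f49gen (phi x) (phi y).
Proof.
have h1 : is_image phi (aff_f1 x y) (aff_f1 (phi x) (phi y)) := rmorph_aff_f1 x y.
have h2 : is_image phi (aff_f13 x y) (aff_f13 (phi x) (phi y)) := rmorph_aff_f13 x y.
by rewrite -/(is_image _ _ _) /aff_f49gen; compute_image.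
Qed.

End LocalParametrizationImages.

Ltac subring_member := lazymatch goal with
  | |- is_true (_ + _ \in _) => apply: rpredD; subring_member
  | |- is_true (- _ \in _) => rewrite rpredN; subring_member
  | |- is_true (_ * _ \in _) => apply: rpredM; subring_member
  | |- is_true (_ ^+ _ \in _) => apply: rpredX; subring_member
  | |- is_true (_%:R \in _) => exact: rpred_nat
  | |- is_true (1 \in _) => exact: rpred1
  | |- _ => assumption
  end.

Section LocalParametrizationSubring.
Variables (R : comNzRingType) (S : subringClosed R).

Lemma par_u_subring t : t \in S -> par_u 1 t \in S.
Proof. by move=> h; rewrite /par_u; subring_member. Qed.

Lemma par_x_subring t : t \in S -> par_x 1 t \in S.
Proof. by move=> /par_u_subring h; rewrite /par_x; subring_member. Qed.

Lemma par_z_subring t : t \in S -> par_z 1 t \in S.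
Proof. by move=> h; have hu := par_u_subring h; rewrite /par_z; subring_member. Qed.

Lemma branch_eq_subring v t0 x : v \in S -> t0 \in S -> x \in S -> branch_eq v t0 x \in S.
Proof.
move=> hv h0 hx; have ht : t0 + v * x \in S by subring_member.
have hu := par_u_subring ht; have hz := par_z_subring ht.
have hn : par_unit t0 (v * x) \in S by rewrite /par_unit; subring_member.
by rewrite /branch_eq; move: ht hu hz hn; move: (t0 + _) (par_u _ _) (par_z _ _) (par_unit _ _)
  => t U Z V ht hu hz hn; subring_member.
Qed.

End LocalParametrizationSubring.

Section AnalyticBranch.
Variable K : numFieldType.
Local Notation O := (cseries2 K).
Local Notation u := (germ ('X_0 : {mpoly K[2]})).
Local Notation v := (germ ('X_1 : {mpoly K[2]})).

Lemma germ_vXM k (a : O) i j :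
  coef2 (v ^+ k * a) i j = if (k <= j)%N then coef2 a i (j - k) else 0.
Proof.
have X1 : 'X_1 ^+ k = 'X_[mnm2 0 k] :> {mpoly K[2]}.
  rewrite mpolyXn; congr 'X_[_]; apply/mnmP.
  by elim/forall_ord2; rewrite mulmnE mnm1E mnm2E ?mul1n ?mul0n.
by rewrite -rmorphXn /= X1 germ_monomM /= subn0.
Qed.

Lemma germ_v_series : v \in v_series K.
Proof.
apply/v_seriesP => i j; rewrite -[v]expr1 -[_ ^+ 1]mulr1 germ_vXM.
by case: ifP; rewrite ?cseries2_1.
Qed.

Lemma const_coef_germ1 : const_coef v = 0.
Proof. by rewrite /const_coef -[v]expr1 -[_ ^+ 1]mulr1 germ_vXM. Qed.

Lemma twist0_germ1 : twist 0 v = 0.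
Proof. by apply: twist0_v_series; [exact: germ_v_series|exact: const_coef_germ1]. Qed.

Lemma ramify_germ1 n : (0 < n)%N -> ramify n v = v ^+ n.
Proof.
move=> n0; apply: cseries2P => i j; rewrite ramifyE -[v]expr1 -exprM mul1n.
rewrite -[v ^+ 1]mulr1 -[v ^+ n]mulr1 !germ_vXM !cseries2_1.
case: ifP => [/dvdnP[k ->]|nj].
  rewrite mulnK //; case: k => [|k]; first by rewrite mul0n /= [(n <= 0)%N]leqNgt n0.
  rewrite leq_pmull // mulSn addKn muln_eq0 [n == _]eqn0Ngt n0 orbF.
  by rewrite subn1.
case: ifP => // nj'; case: (i == 0)%N => //=; case: eqP => // /eqP.
by rewrite subn_eq0 => jn; rewrite (@anti_leq j n) ?jn ?nj' // dvdnn in nj.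
Qed.

Section Branch.
Variable t0 : K.
Hypothesis t0_root : t0 ^+ 4 + 13 * t0 = 0.
Hypothesis t0_simple : 4 * t0 ^+ 3 + 13 != 0.

Lemma series_root (S : comNzRingType) (phi : {rmorphism K -> S}) :
  phi t0 ^+ 4 + 13 * phi t0 = 0.
Proof. by rewrite -(rmorph0 phi) -t0_root rmorphD rmorphM rmorphXn rmorph_nat. Qed.

Lemma analytic_reparametrization : exists t W c : O,
  [/\ t \in v_series K, W \in v_series K & c \in v_series K] /\
  [/\ const_coef t = t0, const_coef W != 0 & const_coef c != 0] /\
  [/\ par_u 1 t = v * W, par_z 1 t * c = 1 & par_y 1 t * c = v ^+ 9].
Proof.
pose V0 := 4 * t0 ^+ 3 + 13.
have [P hP] : exists P : {poly O}, P = branch_eq v%:P (cst t0)%:P 'X.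
  by exists (branch_eq v%:P (cst t0)%:P 'X).
have Px a : P.[a] = branch_eq v (cst t0) a.
  rewrite hP; have := rmorph_branch_eq (horner_eval a) v%:P (cst t0)%:P 'X.
  by rewrite /= /horner_eval !hornerC hornerX.
have Pmap : map_poly (@const_coef K) P = 1 - (V0 ^+ 9)%:P * 'X^9.
  rewrite hP rmorph_branch_eq /= !map_polyC map_polyX /= const_coef_germ1 const_coef_cst.
  rewrite branch_eq0; last exact: (series_root (@polyC K)).
  by rewrite /V0 (rmorphXn (@polyC K)) rmorphD rmorphM rmorphXn /= !rmorph_nat.
have V09 : V0 ^+ 9 != 0 by rewrite expf_neq0.
have [|||a va [a0 Pa]] := @hensel K P V0^-1.
- by rewrite hP; apply: branch_eq_subring; rewrite ?polyOverX ?polyOverC ?cst_v_series ?germ_v_series.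
- by rewrite Pmap rootE -polyC1 hornerD hornerN hornerM !hornerC hornerXn exprVn divff ?subrr.
- rewrite -deriv_map Pmap rootE -polyC1 derivB derivM !derivC derivXn mul0r !add0r.
  rewrite hornerN hornerM hornerC hornerMn hornerXn oppr_eq0 mulf_eq0 (negPf V09) /=.
  by rewrite mulrn_eq0 expf_eq0 invr_eq0 negb_and t0_simple.
have vt : cst t0 + v * a \in v_series K.
  by rewrite rpredD ?cst_v_series // rpredM // germ_v_series.
have rt : cst t0 ^+ 4 + 13 * cst t0 = 0 by exact: (series_root (@cst K)).
have t_const : const_coef (cst t0 + v * a) = t0.
  by rewrite rmorphD rmorphM /= const_coef_cst const_coef_germ1 mul0r addr0.
pose t := cst t0 + v * a; pose W := a * par_unit (cst t0) (v * a).
have hU : par_u 1 t = v * W by rewrite par_u_local // mulrA.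
have vW : W \in v_series K.
  have h1 := germ_v_series.
  have h2 := cst_v_series t0; rewrite /W /par_unit; subring_member.
have W0 : const_coef W != 0.
  rewrite rmorphM rmorph_par_unit rmorphM /= a0 const_coef_cst const_coef_germ1 mul0r.
  rewrite (_ : par_unit t0 0 = V0) ?mulVf ?oner_eq0 // /par_unit /V0; ring.
have z0 : const_coef (par_z 1 t) = - 1.
  by rewrite rmorph_par_z rmorph1 /= t_const par_z_at_root.
have [c hc] : invertible (par_z 1 t).
  by apply: invertible_series; rewrite z0 oppr_eq0 oner_eq0.
exists t, W, c; split.
  by split=> //; apply: v_series_inverse hc; exact: par_z_subring.
split; last split=> //.
  split=> //; apply/eqP => c0; have /eqP := congr1 (@const_coef K) hc.
  by rewrite rmorphM rmorph1 /= c0 mulr0 eq_sym oner_eq0.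
(* The root equation says that y / v^9 equals z on the branch, so y c = v^9 in the affine chart. *)
have hz : par_z 1 t = W ^+ 9 * (t * par_u 1 t ^+ 3 - 1).
  by apply/eqP; rewrite eq_sym -subr_eq0 -/(branch_eq _ _ _) -Px Pa.
rewrite (_ : v ^+ 9 = v ^+ 9 * (par_z 1 t * c)); last by rewrite hc mulr1.
rewrite hz /par_y expr1n hU; ring.
Qed.

(** As u = v W with W a unit, xi = u^12 c has order 12 in v and A = u^49 c^4 has order 49. *)
Lemma branch_expansion : exists xi t A : O,
  [/\ xi \in v_series K, vanishes_to 2 xi & xi != 0] /\
  [/\ const_coef t = t0, A = aff_f1 xi (v ^+ 9),
      aff_f13 xi (v ^+ 9) = t * xi * A ^+ 3, aff_f49gen xi (v ^+ 9) = 0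
    & coef2 A 0 49 != 0].
Proof.
have [t [W [c [[vt vW vc] [[ht W0 c0] [hU hz hy]]]]]] := analytic_reparametrization.
have [eA eB eF] := aff_par hz; rewrite hy in eA eB eF.
have hxi : par_x 1 t * c = v ^+ 12 * (W ^+ 12 * c) by rewrite /par_x hU mul1r exprMn mulrA.
have vanX k (a : O) : vanishes_to k (v ^+ k * a).
  move=> i j h; rewrite germ_vXM leqNgt (leq_ltn_trans _ h) //; exact: leq_addl.
have coefX k (a : O) : coef2 (v ^+ k * a) 0 k = const_coef a.
  by rewrite germ_vXM leqnn subnn.
exists (par_x 1 t * c), t, (aff_f1 (par_x 1 t * c) (v ^+ 9)); split; split=> //.
- by rewrite rpredM // par_x_subring.
- by rewrite hxi; apply: vanishes_to_leq (vanX _ _).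
- rewrite hxi; apply/eqP => /(congr1 (fun a => coef2 a 0 12)) /eqP.
  by rewrite coefX cseries2_0 rmorphM rmorphXn /= mulf_eq0 expf_eq0 (negPf W0) (negPf c0).
- by rewrite eA hU exprMn -mulrA coefX rmorphM !rmorphXn mulf_neq0 ?expf_neq0.
Qed.

End Branch.
End AnalyticBranch.

(** A cube root of a primitive cube root of unity: its order divides 9 but not 3. *)
Lemma exists_ninth_root (K : numClosedFieldType) : exists z : K, 9.-primitive_root z.
Proof.
pose y : K := (- 1 + sqrtC (- 3)) / 2.
have y2 : y ^+ 2 + y + 1 = 0.
  have -> : y ^+ 2 + y + 1 = (sqrtC (- 3) ^+ 2 + 3) / 4 by rewrite /y; field.
  by rewrite sqrtCK addNr mul0r.
have y3 : y ^+ 3 = 1.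
  have e : y ^+ 3 - 1 = (y - 1) * (y ^+ 2 + y + 1) by ring.
  by apply/eqP; rewrite -subr_eq0 e y2 mulr0.
have y1 : y != 1.
  apply/eqP => e; move/eqP: y2; rewrite e (_ : 1 ^+ 2 + 1 + 1 = 3%:R) ?pnatr_eq0 //; ring.
pose z := 3.-root y; have z3 : z ^+ 3 = y by rewrite rootCK.
have z9 : z ^+ 9 = 1 by rewrite (exprM z 3 3) z3.
have [m hm m9] := prim_order_exists (isT : (0 < 9)%N) z9.
have : m \in divisors 9 by rewrite -dvdn_divisors.
have m3 : ~~ (m %| 3)%N by rewrite (prim_order_dvd hm) z3.
move=> hd; exists z; rewrite (_ : 9%N = m) //.
by move: hd m3; rewrite (_ : divisors 9 = [:: 1; 3; 9]%N) // !inE => /or3P[] /eqP ->.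
Qed.

(** The roots are 0 and the three cube roots of -13, where the derivative 4 t^3 + 13 is 13 and
    -39. *)
Lemma exists_branch_parameters (K : numClosedFieldType) : exists t : 'I_4 -> K,
  [/\ injective t, forall i, t i ^+ 4 + 13 * t i = 0 & forall i, 4 * t i ^+ 3 + 13 != 0].
Proof.
have [z hz] := exists_ninth_root K.
have w3 : 3.-primitive_root (z ^+ 3) := dvdn_prim_root hz (isT : (3 %| 9)%N).
move: (z ^+ 3) w3 => w hw; have w3 := prim_expr_order hw.
pose c : K := 3.-root (- 13); have c3 : c ^+ 3 = - 13 by rewrite rootCK.
have c0 : c != 0.
  by apply/eqP => e; move/eqP: c3; rewrite e expr0n eq_sym oppr_eq0 pnatr_eq0.
have cube j : (c * w ^+ j) ^+ 3 = - 13 by rewrite exprMn exprAC w3 expr1n mulr1.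
pose s : 4.-tuple K := [tuple of 0 :: [seq c * w ^+ j | j <- iota 0 3]].
have sP i : tnth s i = 0 \/ tnth s i ^+ 3 = - 13.
  by have := mem_tnth i s; rewrite inE => /orP[/eqP|/mapP[j _ ->]]; [left|right].
exists (tnth s); split=> [|i|i].
- apply/tuple_uniqP; rewrite /s cons_uniq map_inj_in_uniq ?iota_uniq ?andbT.
    apply/mapP => -[j _ /esym/eqP]; rewrite mulf_eq0 (negPf c0) /= => /eqP w0.
    by have /eqP := cube j; rewrite w0 mulr0 expr0n eq_sym oppr_eq0 pnatr_eq0.
  move=> j k; rewrite !mem_iota /= => hj hk /(mulfI c0)/eqP.
  by rewrite (eq_prim_root_expr hw) !modn_small // => /eqP.
- have [->|h] := sP i; first by rewrite mulr0 expr0n addr0.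
  by rewrite exprS h mulrN mulrC addNr.
- have [->|->] := sP i; first by rewrite expr0n mulr0 add0r pnatr_eq0.
  by rewrite (_ : _ + _ = - 39) ?oppr_eq0 ?pnatr_eq0 //; ring.
Qed.

Section NumberOfBranches.
Variable K : numFieldType.
Local Notation O := (cseries2 K).
Local Notation u := (germ ('X_0 : {mpoly K[2]})).
Local Notation v := (germ ('X_1 : {mpoly K[2]})).

Lemma rmorph_f49gen (phi : {rmorphism {mpoly K[3]} -> O}) : phi 'X_2 = 1 ->
  phi (f49gen K) = aff_f49gen (phi 'X_0) (phi 'X_1).
Proof.
move=> h2; have hx : is_image phi 'X_0 (phi 'X_0) by [].
have hy : is_image phi 'X_1 (phi 'X_1) by [].
have hz : is_image phi 'X_2 1 := h2.
have hA : is_image phi (f1 K) (aff_f1 (phi 'X_0) (phi 'X_1)).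
  apply: (@is_image_eq _ _ phi _ (phi 'X_0 ^+ 3 * 1 + phi 'X_1 ^+ 4)).
    by rewrite f1E; compute_image.
  by rewrite mulr1.
have hB : is_image phi (f13 K) (aff_f13 (phi 'X_0) (phi 'X_1)).
  by rewrite f13E /aff_f13; compute_image.
apply: (is_image_eq (q := 13 * aff_f13 (phi 'X_0) (phi 'X_1) * aff_f1 (phi 'X_0) (phi 'X_1) ^+ 9
  + 4 * aff_f13 (phi 'X_0) (phi 'X_1) ^+ 3 * phi 'X_0 ^+ 10
  - 6 * aff_f13 (phi 'X_0) (phi 'X_1) ^+ 2 * phi 'X_0 ^+ 23
  + 4 * aff_f13 (phi 'X_0) (phi 'X_1) * phi 'X_0 ^+ 36 - phi 'X_0 ^+ 49
  - aff_f1 (phi 'X_0) (phi 'X_1) ^+ 12 * 1)).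
  by rewrite f49genE; compute_image.
by rewrite mulr1.
Qed.

Lemma ramify_f49gen : ramify 9 (germ (dehom (f49gen K))) = aff_f49gen u (v ^+ 9).
Proof.
have := @rmorph_f49gen (ramify 9 \o (@germ K \o @dehom K)); rewrite /= !dehom_var.
by rewrite !rmorph1 /= ramify_germ0 ramify_germ1 //; apply.
Qed.

Lemma twist0_f49gen : twist 0 (germ (dehom (f49gen K))) = aff_f49gen u 0.
Proof.
have := @rmorph_f49gen (twist 0 \o (@germ K \o @dehom K)); rewrite /= !dehom_var.
by rewrite !rmorph1 /= twist_germ0 twist0_germ1; apply.
Qed.

(** The factor theorem in the variable u. *)
Lemma aff_f49gen_divides (xi y : O) : aff_f49gen xi y = 0 ->
  divides (u - xi) (aff_f49gen u y).
Proof.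
move=> h; have [D [hD _]] := horner_difference (aff_f49gen 'X y%:P) u xi.
exists D; rewrite -hD.
have e a : (aff_f49gen 'X y%:P).[a] = aff_f49gen a y.
  have := rmorph_aff_f49gen (horner_eval a) 'X y%:P.
  by rewrite /= /horner_eval hornerX hornerC.
by rewrite !e h subr0.
Qed.

End NumberOfBranches.

Theorem f49gen_num_branches (K : numClosedFieldType) :
  num_branches (f49gen K) (point001 K) 4.
Proof.
have [z hz] := exists_ninth_root K.
have [t0 [t0_inj t0_root t0_simple]] := exists_branch_parameters K.
have [xi hxi] := choice (fun i => branch_expansion (t0_root i) (t0_simple i)).
have [t ht] := choice hxi; have {hxi} [A hA] := choice ht.
pose v := germ ('X_1 : {mpoly K[2]}).
have vxi i : xi i \in v_series K by have [[]] := hA i.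
have xi2 i : vanishes_to 2 (xi i) by have [[]] := hA i.
have xi0 i : xi i != 0 by have [[]] := hA i.
have t_const i : const_coef (t i) = t0 i by have [_ []] := hA i.
have AE i : A i = aff_f1 (xi i) (v ^+ 9) by have [_ []] := hA i.
have BE i : aff_f13 (xi i) (v ^+ 9) = t i * xi i * A i ^+ 3 by have [_ []] := hA i.
have xi_root i : aff_f49gen (xi i) (v ^+ 9) = 0 by have [_ []] := hA i.
have A49 i : coef2 (A i) 0 49 != 0 by have [_ []] := hA i.
have {hA ht} A0 i : A i != 0.
  by apply: contraNneq (A49 i) => ->; rewrite cseries2_0.
have tv w : w ^+ 9 = 1 -> twist w (v ^+ 9) = v ^+ 9.
  by move=> w9; rewrite -(@ramify_germ1 _ 9) // twist_ramify.
have [|||||g [w [irr nassoc unit_w e]]] := @puiseux_branches K 8 4 z xi hz vxi xi2 _ _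
    (germ (dehom (f49gen K)))
    (germ 'X_0 ^+ 13 + 13 * germ 'X_0 ^+ 4 - 1).
(* If w fixes xi it fixes A, so w^49 = 1 on its coefficient of v^49; with w^9 = 1 this gives w^4 = 1
   and then w = 1. *)
- move=> i w w9 h; have : twist w (A i) = A i by rewrite AE rmorph_aff_f1 /= h tv.
  move=> /(congr1 (fun a => coef2 a 0 49)); rewrite twistE => e.
  have w49 : w ^+ (9 * 5 + 4) = 1 by apply: (mulfI (A49 i)); rewrite mulr1.
  have w4 : w ^+ 4 = 1 by rewrite -w49 exprD exprM w9 expr1n mul1r.
  by rewrite -w9 (exprD w (4 * 2) 1) exprM w4 expr1n mul1r.
(* Conjugate branches have conjugate values of B / (x A^3), hence the same constant term t0, and the
   four t0 are distinct. *)
- move=> i j w w9 h; apply: t0_inj; rewrite -!t_const -(const_coef_twist w (t j)).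
  congr const_coef; apply: (@cseries2_mulfI _ (xi i * A i ^+ 3)).
    by rewrite cseries2_mulf_neq0 // cseries2_expf_neq0.
  have hA' : twist w (A j) = A i by rewrite !AE rmorph_aff_f1 /= -h tv.
  have := BE i; rewrite h -[in LHS](tv w w9) -(rmorph_aff_f13 (twist w)) BE.
  rewrite 2!rmorphM rmorphXn /= hA' -h => e.
  by rewrite [LHS]mulrC [RHS]mulrC [LHS]mulrA [RHS]mulrA; exact: esym e.
- by move=> i; rewrite ramify_f49gen; exact: aff_f49gen_divides.
- by rewrite twist0_f49gen aff_f49gen_x.
- rewrite rmorphB rmorphD rmorphXn rmorphM rmorphXn rmorph1 /= germ0_const.
  by rewrite !expr0n mulr0 addr0 sub0r oppr_eq0 oner_eq0.
(* Every branch occurs with multiplicity 1. *)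
exists g, (fun=> 1%N), w; split; [exact: irr|exact: nassoc|by []|exact: unit_w|].
by rewrite local_equation001 e; congr (_ * _); apply: eq_bigr.
Qed.

Theorem mainTheorem4 (R : realType) :
  exists f49 : {mpoly R[i][3]},
    [/\ 'X_0 ^+ 3 * f49 = f13 R[i] ^+ 4 - f1 R[i] ^+ 13,
        f49 \is 49.-homog
      & let f := f49 + 13 *: (f13 R[i] * f1 R[i] ^+ 9) in
        [/\ irreducible_elt f /\ rational_curve f,
            forall p : point R[i], singular f p <-> p = point001 R[i],
            num_branches f (point001 R[i]) 4,
            nearly_free f /\ exponents f 24 25 25
          & total_tjurina f 1727]].
Proof.
exists (f49 R[i]); split; [exact: f49_spec|exact: f49_homog|].
rewrite -/(f49gen R[i]) /=; split.
- split; [exact: f49gen_irreducible|exact: f49gen_rational].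
- exact: singular_f49gen.
- exact: f49gen_num_branches.
- split; [exact: f49gen_nearly_free|exact: f49gen_exponents].
- exact: f49gen_total_tjurina.
Qed.
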